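(* Let $p$ be a prime, let $r,d\ge 2$ be integers with $p\nmid r$ and $p>(d-1)r-d$, and let $$R=\frac{\mathbb F_p[X_0,X_1,\dots,X_d]}{(X_0^r+X_1^r+\cdots+X_d^r)}$$ with its standard grading. Let $x_i$ be the image of $X_i$ in $R$ and $\mathfrak m=(x_0,x_1,\dots,x_d)$. Let $f_1,\dots,f_d$ be a homogeneous system of parameters in $R$ such that $\deg(f_i)=e$ for $1\le i\le d$, and let $J=(f_1,\dots,f_d)$. Then: (a) $(J^n)^*=J^n+\mathfrak m^{(n-1)e+de}$ for all $n\ge 1$; (b) $G^*(J)$ is Cohen-Macaulay; (c) $r_J(\mathfrak m^e)=\left[\frac{r-1-d}{e}\right]+d$ and $r^*(J)\le\left[\frac{r-1-d}{e}\right]+1$; (d) if $\left[\frac{r-1-d}{e}\right]\le d-2$, then $\mathcal R^*(J)$ is Cohen-Macaulay.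
   Context: For a Noetherian ring $R$ of prime characteristic $p$, $R^0$ denotes the set of elements of $R$ not contained in any minimal prime. For an ideal $K=(b_1,\dots,b_s)$ and $q$ a power of $p$, put $K^{[q]}=(b_1^q,\dots,b_s^q)$. The tight closure $K^*$ of $K$ is the ideal of all $x\in R$ for which there is $c\in R^0$ with $cx^q\in K^{[q]}$ for all sufficiently large powers $q$ of $p$. We set $(J^0)^*=R$. $G^*(J)=\bigoplus_{n\ge0}(J^n)^*/(J^{n+1})^*$ and $\mathcal R^*(J)=\bigoplus_{n\ge 0}(J^n)^*t^n$ are the associated graded ring and the Rees algebra of the filtration $\{(J^n)^*\}_{n\ge0}$. $[\,y\,]$ denotes the integer part (floor) of $y$, i.e. the greatest integer $\le y$. $r_J(\mathfrak m^e)$ is the reduction number of $\mathfrak m^e$ with respect to $J$: the least integer $k\ge 0$ such that $J(\mathfrak m^e)^n=(\mathfrak m^e)^{n+1}$ for all $n\ge k$. $r^*(J)$ is the reduction number of the filtration $\{(J^n)^*\}$ with respect to $J$; for an integer $k$, the inequality $r^*(J)\le k$ means that $J(J^n)^*=(J^{n+1})^*$ for all integers $n\ge 0$ with $n\ge k$. *)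

(* Defs.v *)
From HB Require Import structures.
From mathcomp Require Import all_boot all_order all_algebra.
From mathcomp Require Import mpoly.
From mathcomp Require Import boolp classical_sets.

Set Implicit Arguments.
Unset Strict Implicit.
Unset Printing Implicit Defensive.

Import GRing.Theory.
Local Open Scope ring_scope.
Local Open Scope classical_set_scope.
Local Open Scope quotient_scope.

Section Ideals.
Variable A : comPzRingType.
Implicit Types (I K L P S : set A) (x y a : A).

Definition is_ideal I :=
  [/\ I 0, (forall x y, I x -> I y -> I (x + y)) & (forall a x, I x -> I (a * x))].

Definition ideal_gen S : set A :=
  [set x | forall I, is_ideal I -> S `<=` I -> I x].

Definition ideal_add I K : set A := [set x | exists y z, [/\ I y, K z & x = y + z]].

Definition ideal_mul I K : set A :=
  ideal_gen [set x | exists y z, [/\ I y, K z & x = y * z]].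

Fixpoint ideal_pow I n : set A :=
  if n is n'.+1 then ideal_mul I (ideal_pow I n') else setT.

Definition radical I : set A := [set x | exists n, I (x ^+ n)].

Definition is_prime_ideal P :=
  [/\ is_ideal P, ~ P 1 & forall x y, P (x * y) -> P x \/ P y].

Definition is_maximal_ideal P :=
  [/\ is_ideal P, ~ P 1 & forall I, is_ideal I -> P `<=` I -> I = P \/ I = setT].

Definition is_minimal_prime P :=
  is_prime_ideal P /\ forall P', is_prime_ideal P' -> P' `<=` P -> P' = P.

Definition noetherian :=
  forall I, is_ideal I -> exists bs : seq A, I = ideal_gen [set` bs].

(* C 0 < C 1 < ... < C n, a chain of length n; values of C beyond n are
   irrelevant. *)
Definition is_prime_chain (C : nat -> set A) n :=
  (forall i, (i <= n)%N -> is_prime_ideal (C i)) /\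
  (forall i, (i < n)%N -> C i `<` C i.+1).

Definition is_krull_dim n :=
  (exists C, is_prime_chain C n) /\
  (forall C k, is_prime_chain C k -> (k <= n)%N).

Definition is_height P n :=
  (exists2 C, is_prime_chain C n & C n = P) /\
  (forall C k, is_prime_chain C k -> C k = P -> (k <= n)%N).

Definition is_regular_seq (s : seq A) :=
  (forall i, (i < size s)%N -> forall y,
     ideal_gen [set` take i s] (s`_i * y) -> ideal_gen [set` take i s] y) /\
  ~ ideal_gen [set` s] 1.

Definition is_depth I n :=
  (exists s, [/\ is_regular_seq s, [set` s] `<=` I & size s = n]) /\
  (forall s, is_regular_seq s -> [set` s] `<=` I -> (size s <= n)%N).

(* Eisenbud, Commutative Algebra, Ch. 18: Noetherian, with
   depth(M, A) = codim M for every maximal ideal M. *)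
Definition cohen_macaulay :=
  noetherian /\
  forall M, is_maximal_ideal M -> exists n, is_depth M n /\ is_height M n.

(* R^0 *)
Definition off_minimal_primes : set A :=
  [set c | forall P, is_minimal_prime P -> ~ P c].

(* K^[q] *)
Definition frobenius_power K q : set A :=
  [set x | exists2 bs : seq A, K = ideal_gen [set` bs] &
           ideal_gen [set b ^+ q | b in [set` bs]] x].

Definition tight_closure p K : set A :=
  [set x | exists2 c, off_minimal_primes c &
           exists e0, forall e, (e0 <= e)%N ->
             frobenius_power K (p ^ e)%N (c * x ^+ (p ^ e)%N)].

Definition is_reduction_number J I k :=
  let reduces l := forall n, (l <= n)%N ->
    ideal_mul J (ideal_pow I n) = ideal_pow I n.+1 in
  reduces k /\ (forall l, reduces l -> (k <= l)%N).

Definition filt_reduction_number_le J (F : nat -> set A) (k : int) :=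
  forall n : nat, k <= n%:Z -> ideal_mul J (F n) = F n.+1.

End Ideals.

Section IdealTheory.
Variable A : comPzRingType.
Implicit Types (I K L P S : set A) (x y a : A).

Lemma is_ideal_opp I x : is_ideal I -> I x -> I (- x).
Proof. by case=> _ _ hM hx; rewrite -mulN1r; apply: hM. Qed.

Lemma ideal_gen_is_ideal S : is_ideal (ideal_gen S).
Proof.
split=> [I [] //|x y hx hy I hI hS|a x hx I hI hS]; case: (hI) => h0 hD hM.
- by apply: hD; [apply: hx | apply: hy].
- by apply: hM; apply: hx.
Qed.

Lemma sub_ideal_gen S : S `<=` ideal_gen S.
Proof. by move=> x Sx I _; apply. Qed.

Lemma ideal_gen_min S I : is_ideal I -> S `<=` I -> ideal_gen S `<=` I.
Proof. by move=> hI hS x; apply. Qed.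

Lemma ideal_mul_in I K x y : I x -> K y -> ideal_mul I K (x * y).
Proof. by move=> hx hy; apply: sub_ideal_gen; exists x, y. Qed.

Lemma ideal_mul_min I K L : is_ideal L ->
  (forall x y, I x -> K y -> L (x * y)) -> ideal_mul I K `<=` L.
Proof. by move=> hL h; apply: ideal_gen_min => // _ [x [y [hx hy ->]]]; apply: h. Qed.

Lemma colon_is_ideal I y : is_ideal I -> is_ideal [set x | I (x * y)].
Proof.
case=> h0 hD hM; split=> /= [|u v|a u]; first by rewrite mul0r.
  by rewrite mulrDl; apply: hD.
by rewrite -mulrA; apply: hM.
Qed.

Lemma ideal_mulA I K L :
  ideal_mul I (ideal_mul K L) = ideal_mul (ideal_mul I K) L.
Proof.
apply/seteqP; split.
  apply: ideal_mul_min => [|x y hx hy]; first exact: ideal_gen_is_ideal.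
  rewrite mulrC; move: y hy.
  apply: (ideal_mul_min (colon_is_ideal x (ideal_gen_is_ideal _))) => u v hu hv /=.
  by rewrite mulrC mulrA; apply: ideal_mul_in => //; apply: ideal_mul_in.
apply: ideal_mul_min => [|x y hx hy]; first exact: ideal_gen_is_ideal.
move: x hx.
apply: (ideal_mul_min (colon_is_ideal y (ideal_gen_is_ideal _))) => u v hu hv /=.
by rewrite -mulrA; apply: ideal_mul_in => //; apply: ideal_mul_in.
Qed.

Lemma ideal_pow_is_ideal I n : is_ideal (ideal_pow I n).
Proof. by case: n => [|n]; [split | apply: ideal_gen_is_ideal]. Qed.

Lemma ideal_mulT I : is_ideal I -> ideal_mul setT I = I.
Proof.
move=> hI; apply/seteqP; split; last first.
  by move=> x hx; rewrite -[x]mul1r; apply: ideal_mul_in.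
by apply: ideal_mul_min => // x y _; case: hI => _ _; apply.
Qed.

Lemma ideal_pow_add I m n :
  ideal_mul (ideal_pow I m) (ideal_pow I n) = ideal_pow I (m + n).
Proof.
elim: m => [|m IH]; first by rewrite /= ideal_mulT //; apply: ideal_pow_is_ideal.
by rewrite /= -ideal_mulA IH.
Qed.

Lemma ideal_mul_gen (bs cs : seq A) :
  ideal_mul (ideal_gen [set` bs]) (ideal_gen [set` cs]) =
  ideal_gen [set` [seq b * c | b <- bs, c <- cs]].
Proof.
apply/seteqP; split; last first.
  apply: ideal_gen_min; first exact: ideal_gen_is_ideal.
  move=> _ /= /allpairsP[[b c] /= [hb hc ->]].
  by apply: ideal_mul_in; apply: sub_ideal_gen.
apply: ideal_mul_min => [|x y hx hy]; first exact: ideal_gen_is_ideal.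
move: x hx.
apply: (ideal_gen_min (colon_is_ideal y (ideal_gen_is_ideal _))) => b hb /=.
rewrite mulrC; move: y hy.
apply: (ideal_gen_min (colon_is_ideal b (ideal_gen_is_ideal _))) => c hc /=.
by apply: sub_ideal_gen => /=; rewrite mulrC; apply: allpairs_f.
Qed.

Lemma ideal_gen1 : ideal_gen [set` [:: 1 : A]] = setT.
Proof.
apply/seteqP; split=> // x _; rewrite -[x]mulr1.
case: (ideal_gen_is_ideal [set` [:: 1 : A]]) => _ _; apply.
by apply: sub_ideal_gen; rewrite /= inE.
Qed.

Lemma ideal_pow_fg (bs : seq A) n :
  exists cs : seq A, ideal_pow (ideal_gen [set` bs]) n = ideal_gen [set` cs].
Proof.
elim: n => [|n [cs IH]] /=.
  by exists [:: 1]; rewrite ideal_gen1.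
by eexists; rewrite IH ideal_mul_gen.
Qed.

Lemma off_minimal_primes1 : off_minimal_primes (1 : A).
Proof. by move=> P [[]]. Qed.

Lemma off_minimal_primesM x y : off_minimal_primes x -> off_minimal_primes y ->
  off_minimal_primes (x * y).
Proof.
move=> hx hy P hP hxy; case: (hP) => -[_ _ hM] _.
by case: (hM _ _ hxy); [apply: hx | apply: hy].
Qed.

End IdealTheory.

Section FrobeniusPower.
Variables (A : comNzRingType) (p : nat).
Hypothesis pcharA : p \in [pchar A].
Implicit Types (I K L : set A) (x y a : A).

Lemma exprD_pchar_pow x y e :
  (x + y) ^+ (p ^ e)%N = x ^+ (p ^ e)%N + y ^+ (p ^ e)%N.
Proof.
apply: exprDn_pchar.
by rewrite pnatX pnatE ?(pcharf_prime pcharA) // pcharA.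
Qed.

Lemma frobenius_gen_mem (bs : seq A) e x : ideal_gen [set` bs] x ->
  ideal_gen [set b ^+ (p ^ e)%N | b in [set` bs]] (x ^+ (p ^ e)%N).
Proof.
have [h0 hD hM] :=
  ideal_gen_is_ideal [set b ^+ (p ^ e)%N | b in [set` bs]].
move: x; apply: (ideal_gen_min (I := [set x | ideal_gen
  [set b ^+ (p ^ e)%N | b in [set` bs]] (x ^+ (p ^ e)%N)])) => [|b hb /=].
  split=> [|x y hx hy|a x hx] /=.
  - by rewrite expr0n expn_eq0 eqn0Ngt prime_gt0 ?(pcharf_prime pcharA).
  - by rewrite exprD_pchar_pow; apply: hD.
  - by rewrite exprMn; apply: hM.
by apply: sub_ideal_gen; exists b.
Qed.

(* K^[q] does not depend on the generators chosen for K. *)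
Lemma frobenius_powerE (bs : seq A) e :
  frobenius_power (ideal_gen [set` bs]) (p ^ e)%N =
  ideal_gen [set b ^+ (p ^ e)%N | b in [set` bs]].
Proof.
apply/seteqP; split=> [x [cs Ebc]|x hx]; last by exists bs.
move: x; apply: ideal_gen_min => [|_ [c hc <-]]; first exact: ideal_gen_is_ideal.
by apply: frobenius_gen_mem; rewrite Ebc; apply: sub_ideal_gen.
Qed.

Lemma tight_closure_is_ideal (bs : seq A) :
  is_ideal (tight_closure p (ideal_gen [set` bs])).
Proof.
split.
- exists 1; first exact: off_minimal_primes1.
  exists 0%N => e _; rewrite frobenius_powerE mul1r expr0n expn_eq0 eqn0Ngt.
  rewrite prime_gt0 ?(pcharf_prime pcharA) //.
  by case: (ideal_gen_is_ideal [set b ^+ (p ^ e)%N | b in [set` bs]]).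
- move=> x y [c hc [e1 hx]] [c' hc' [e2 hy]].
  exists (c * c'); first exact: off_minimal_primesM.
  exists (maxn e1 e2) => e; rewrite geq_max => /andP[/hx + /hy].
  rewrite frobenius_powerE exprD_pchar_pow mulrDr.
  have [h0 hD hM] :=
    ideal_gen_is_ideal [set b ^+ (p ^ e)%N | b in [set` bs]].
  move=> {}hx {}hy; apply: hD; last by rewrite -mulrA; apply: hM.
  by rewrite [c * c']mulrC -mulrA; apply: hM.
- move=> a x [c hc [e0 hx]]; exists c => //; exists e0 => e /hx.
  rewrite frobenius_powerE exprMn mulrCA.
  by case: (ideal_gen_is_ideal [set b ^+ (p ^ e)%N | b in [set` bs]]) => _ _; apply.
Qed.

Lemma tight_closureT : tight_closure p [set: A] = setT.
Proof.
apply/seteqP; split=> // x _; exists 1; first exact: off_minimal_primes1.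
exists 0%N => e _; rewrite -ideal_gen1 frobenius_powerE mul1r.
by apply: frobenius_gen_mem; rewrite ideal_gen1.
Qed.

Lemma tight_closure_sub (bs cs : seq A) :
  ideal_gen [set` bs] `<=` ideal_gen [set` cs] ->
  tight_closure p (ideal_gen [set` bs]) `<=` tight_closure p (ideal_gen [set` cs]).
Proof.
move=> hbc x [c hc [e0 hx]]; exists c => //; exists e0 => e /hx.
rewrite !frobenius_powerE; move: (c * _).
apply: ideal_gen_min => [|_ [b hb <-]]; first exact: ideal_gen_is_ideal.
by apply: frobenius_gen_mem; apply: hbc; apply: sub_ideal_gen.
Qed.

Lemma tight_closure_mul (bs cs : seq A) x y :
  tight_closure p (ideal_gen [set` bs]) x ->
  tight_closure p (ideal_gen [set` cs]) y ->
  tight_closure p (ideal_mul (ideal_gen [set` bs]) (ideal_gen [set` cs])) (x * y).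
Proof.
move=> [c hc [e1 hx]] [c' hc' [e2 hy]].
exists (c * c'); first exact: off_minimal_primesM.
exists (maxn e1 e2) => e; rewrite geq_max => /andP[/hx + /hy].
rewrite ideal_mul_gen !frobenius_powerE exprMn mulrACA.
move: (c * _) (c' * _) => u v hu hv; move: u hu.
apply: (ideal_gen_min (colon_is_ideal v (ideal_gen_is_ideal _))) => _ [b hb <-] /=.
rewrite mulrC; move: v hv.
apply: (ideal_gen_min (colon_is_ideal _ (ideal_gen_is_ideal _))) => _ [b' hb' <-] /=.
apply: sub_ideal_gen; exists (b * b') => /=; first exact: allpairs_f.
by rewrite mulrC exprMn.
Qed.

End FrobeniusPower.

Record filtration (A : comNzRingType) := Filtration {
  filt :> nat -> set A;
  filt_ideal : forall n, is_ideal (filt n);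
  filt0 : filt 0%N = setT;
  filt_decr : forall n, filt n.+1 `<=` filt n;
  filt_mul : forall m n x y, filt m x -> filt n y -> filt (m + n)%N (x * y) }.

Section TightClosureFiltration.
Variables (A : comNzRingType) (p : nat) (pcharA : p \in [pchar A]).
Variables (d : nat) (f : 'I_d -> A).

Let J := ideal_gen (range f).
Let Fil (n : nat) : set A := tight_closure p (ideal_pow J n).

Fact tc_fg n : exists cs : seq A, ideal_pow J n = ideal_gen [set` cs].
Proof.
have -> : J = ideal_gen [set` codom f]; last exact: ideal_pow_fg.
congr ideal_gen; apply/seteqP; split=> [_ [i _ <-]|x /codomP[i ->]] /=.
  exact: codom_f.
by exists i.
Qed.

Fact tc_ideal n : is_ideal (Fil n).
Proof. by rewrite /Fil; have [cs ->] := tc_fg n; apply: tight_closure_is_ideal. Qed.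

Fact tc_0 : Fil 0 = setT.
Proof. exact: tight_closureT. Qed.

Fact tc_decr n : Fil n.+1 `<=` Fil n.
Proof.
have [bs Eb] := tc_fg n.+1; have [cs Ec] := tc_fg n.
rewrite /Fil Eb Ec; apply: tight_closure_sub => //; rewrite -Eb -Ec /=.
apply: ideal_mul_min; first exact: ideal_pow_is_ideal.
by move=> x y _; case: (ideal_pow_is_ideal J n) => _ _; apply.
Qed.

Fact tc_mul m n x y : Fil m x -> Fil n y -> Fil (m + n)%N (x * y).
Proof.
rewrite /Fil -ideal_pow_add; have [bs ->] := tc_fg m; have [cs ->] := tc_fg n.
exact: tight_closure_mul.
Qed.

(* The filtration {(J^n)^*} for J = (f_1, ..., f_d). *)
Definition tc_filtration : filtration A := Filtration tc_ideal tc_0 tc_decr tc_mul.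

End TightClosureFiltration.

Section Rees.
Variables (A : comNzRingType) (F : filtration A).

Definition rees_pred : {pred {poly A}} := fun u => `[< forall n, F n u`_n >].

(* \bigoplus_n F_n t^n, as a subring of A[t] *)
Record rees := Rees { rees_val : {poly A}; _ : rees_val \in rees_pred }.

HB.instance Definition _ := [isSub for rees_val].
HB.instance Definition _ := [Choice of rees by <:].

Lemma sum_filt n (G : nat -> A) k :
  (forall i, (i < k)%N -> F n (G i)) -> F n (\sum_(i < k) G i).
Proof.
have [h0 hD _] := filt_ideal F n; move=> h.
by apply: (big_ind (F n)) => // i _; apply: h.
Qed.

Fact rees_subring_closed : subring_closed rees_pred.
Proof.
split=> [|u v /asboolP hu /asboolP hv|u v /asboolP hu /asboolP hv];
  apply/asboolP => n; have [h0 hD hM] := filt_ideal F n.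
- by case: n h0 {hD hM} => [|n] h0; rewrite coef1 ?filt0.
- by rewrite coefB; apply: hD => //; apply: is_ideal_opp => //; apply: filt_ideal.
- rewrite coefM.
  apply: (@sum_filt n (fun j : nat => u`_j * v`_(n - j))) => j hj.
  by rewrite -[n in F n](subnKC (_ : (j <= n)%N)) //; apply: filt_mul.
Qed.

HB.instance Definition _ :=
  GRing.SubChoice_isSubComNzRing.Build {poly A} rees_pred rees rees_subring_closed.

End Rees.

(* Library quotients {ideal_quot I} need I proper; this one allows the zero
   ring. *)
Section IdealQuotient.
Variables (A : comPzRingType) (I : set A) (idealI : is_ideal I).

Definition quot_pred of is_ideal I : {pred A} := fun x => `[< I x >].

Fact quot_pred_zmod_closed : zmod_closed (quot_pred idealI).
Proof.
have [h0 hD _] := idealI; split=> [|x y /asboolP hx /asboolP hy]; apply/asboolP => //.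
by apply: hD => //; apply: is_ideal_opp.
Qed.

HB.instance Definition _ :=
  GRing.isZmodClosed.Build A (quot_pred idealI) quot_pred_zmod_closed.

Definition quot_ring := Quotient.quot (quot_pred idealI).

HB.instance Definition _ := GRing.Zmodule.on quot_ring.
HB.instance Definition _ := EqQuotient.on quot_ring.

Definition quot_one : quot_ring := \pi_quot_ring 1.
Definition quot_mul (x y : quot_ring) : quot_ring := \pi_quot_ring (repr x * repr y).

Lemma quot_piE x y : (\pi_quot_ring x == \pi_quot_ring y) = `[< I (x - y) >].
Proof. by rewrite -(Quotient.idealrBE (quot_pred idealI)). Qed.

Fact quot_mul_pi x y : quot_mul (\pi_quot_ring x) (\pi_quot_ring y) = \pi_quot_ring (x * y).
Proof.
have [h0 hD hM] := idealI.
have hr z : I (repr (\pi_quot_ring z) - z).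
  by apply/asboolP; rewrite -quot_piE reprK.
apply/eqP; rewrite quot_piE; apply/asboolP.
rewrite -[_ * repr _](subrK (repr (\pi_quot_ring x) * y)) -mulrBr -addrA -mulrBl.
by apply: hD; [apply: hM | rewrite mulrC; apply: hM].
Qed.

Fact quot_mulA : associative quot_mul.
Proof.
elim/quotW => x; elim/quotW => y; elim/quotW => z.
by rewrite (quot_mul_pi y z) (quot_mul_pi x y) (quot_mul_pi x) (quot_mul_pi (x * y)) mulrA.
Qed.

Fact quot_mulC : commutative quot_mul.
Proof. by move=> x y; rewrite /quot_mul mulrC. Qed.

Fact quot_mul1 : left_id quot_one quot_mul.
Proof. by elim/quotW => x; rewrite /quot_one quot_mul_pi mul1r. Qed.

Fact quot_mulDl : left_distributive quot_mul +%R.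
Proof.
have piD u v : \pi_quot_ring (u + v) = \pi_quot_ring u + \pi_quot_ring v.
  exact: (@Quotient.pi_add A (quot_pred idealI)).
elim/quotW => x; elim/quotW => y; elim/quotW => z.
by rewrite -piD (quot_mul_pi (x + y)) (quot_mul_pi x z) (quot_mul_pi y z) mulrDl piD.
Qed.

HB.instance Definition _ := GRing.Zmodule_isComPzRing.Build quot_ring
  quot_mulA quot_mulC quot_mul1 quot_mulDl.

End IdealQuotient.

Section AssociatedGraded.
Variables (A : comNzRingType) (F : filtration A).

Definition gr_ideal : set (rees F) :=
  [set u | forall n, F n.+1 (rees_val u)`_n].

Fact gr_is_ideal : is_ideal gr_ideal.
Proof.
split=> [n|u v hu hv n|u v hv n]; have [h0 hD hM] := filt_ideal F n.+1.
- by rewrite [rees_val _](rmorph0 (val : {rmorphism rees F -> {poly A}})) coef0.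
- rewrite [rees_val _](rmorphD (val : {rmorphism rees F -> {poly A}})) coefD.
  by apply: hD.
- rewrite [rees_val _](rmorphM (val : {rmorphism rees F -> {poly A}})) coefM.
  apply: (@sum_filt _ F n.+1
    (fun j : nat => (rees_val u)`_j * (rees_val v)`_(n - j))) => j hj.
  have -> : n.+1 = (j + (n - j).+1)%N by rewrite addnS subnKC.
  by apply: filt_mul; [case: (u) => w /= /asboolP; apply | apply: hv].
Qed.

(* \bigoplus_n F_n / F_{n+1}: the class of \sum_n a_n t^n is the family of the
   classes of the a_n, with the induced product. *)
Definition assoc_gr := quot_ring gr_is_ideal.

HB.instance Definition _ := GRing.ComPzRing.on assoc_gr.

End AssociatedGraded.

Section FermatRing.
Variables (p d r : nat).

Definition fermat_poly : {mpoly 'F_p[d.+1]} := \sum_(i < d.+1) 'X_i ^+ r.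

Hypothesis r_ge2 : (2 <= r)%N.

Definition fermat_ideal of (2 <= r)%N : {pred {mpoly 'F_p[d.+1]}} :=
  fun g => `[< exists h, g = h * fermat_poly >].

Fact fermat_idealr_closed : idealr_closed (fermat_ideal r_ge2).
Proof.
split.
- by apply/asboolP; exists 0; rewrite mul0r.
- apply/asboolP => -[h /(congr1 (meval (fun=> 0)))/eqP].
  rewrite meval1 mevalM [X in _ * X]raddf_sum big1 /= ?mulr0 ?oner_eq0 // => i _.
  by rewrite rmorphXn /= mevalXU expr0n gtn_eqF // ltnW.
- move=> a u v /asboolP[h ->] /asboolP[k ->]; apply/asboolP.
  by exists (a * h + k); rewrite mulrDl mulrA.
Qed.

HB.instance Definition _ :=
  isIdealr.Build {mpoly 'F_p[d.+1]} (fermat_ideal r_ge2) fermat_idealr_closed.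

(* 'F_p[X_0, ..., X_d] / (X_0^r + ... + X_d^r) *)
Definition fermat_ring := {ideal_quot (fermat_ideal r_ge2)}.

HB.instance Definition _ := GRing.ComNzRing.on fermat_ring.
HB.instance Definition _ := EqQuotient.on fermat_ring.

Definition fermat_pi (g : {mpoly 'F_p[d.+1]}) : fermat_ring := \pi g.

Fact fermat_pchar : prime p -> p \in [pchar fermat_ring].
Proof.
move=> p_pr; rewrite inE p_pr /=.
have -> : p%:R = fermat_pi p%:R.
  by rewrite /fermat_pi (rmorph_nat (\pi_fermat_ring : {rmorphism _ -> _})).
have -> : (p%:R : {mpoly 'F_p[d.+1]}) = 0.
  by rewrite -(rmorph_nat (@mpolyC d.+1 'F_p)) (pcharf0 (pchar_Fp p_pr)) rmorph0.
by rewrite /fermat_pi (rmorph0 (\pi_fermat_ring : {rmorphism _ -> _})).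
Qed.

Definition fermat_max : set fermat_ring :=
  ideal_gen [set fermat_pi 'X_i | i in [set: 'I_d.+1]].

(* The degree-k component of the standard grading (0 included). *)
Definition fermat_homog (k : nat) : set fermat_ring :=
  [set fermat_pi g | g in [set g | g \is k.-homog]].

Definition is_hsop n (f : 'I_n -> fermat_ring) :=
  [/\ is_krull_dim fermat_ring n,
      forall i, exists k, fermat_homog k (f i) &
      radical (ideal_gen (range f)) = fermat_max].

End FermatRing.

Arguments fermat_max p d {r} r_ge2.
Arguments fermat_pchar {p} d {r} r_ge2.

(* Main.v *)
(* Write S = F_p[X_0, ..., X_d], R = S / (F) and J = (f_1, ..., f_d) with f_i of
   degree e.  As (F, f_1, ..., f_d) is a regular sequence, Koszul homology puts
   the socle of R / J in degree sigma = d e + r - d - 1, and the same holds for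
   powers of the parameters.

   The inclusion of J^n + m^((n-1)e+de) in (J^n)^* is degree bookkeeping, x_0^r
   being a test multiplier.  For the converse, J^n is the intersection of the
   ideals (f_1^a_1, ..., f_d^a_d) with sum_i a_i = n + d - 1, so it is enough to
   show that the tight closure of a parameter ideal has no new elements in degree
   below the sum of the degrees of the parameters.  For such an element u all the
   x_i^(r-1) u^q lie in the Frobenius power of the ideal, hence, by the socle
   degree, so does u^q.  One then descends from u^p to u: as p > (d-1) r - d, the
   power F^(p-1) has enough monomials with small exponents, and their multinomial
   coefficients do not vanish mod p.

   R is free over F_p[f_1, ..., f_d] on monomials b_j, and in these coordinates
   (J^n)^* is spanned by the f^m b_j with n <= |m| + delta_j, where
   delta_j = max (0, [deg b_j / e] - d + 1).  So G^*(J) is free over the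
   polynomial ring in the classes of the f_i t, on the b_j t^(delta_j).  When
   delta_j < d for all j, R^*(J) is free over the polynomial ring in f_1,
   f_2 - f_1 t, ..., f_d - f_(d-1) t, - f_d t, on the elements b_j t^k
   (k <= delta_j) and b_j f_(k+1) (delta_j < k < d).  A finite free algebra over a
   polynomial ring over a field is Cohen-Macaulay.  The reduction numbers are
   read off the socle degree. *)
From HB Require Import structures.
Require Import Defs.
From mathcomp Require Import all_boot all_order all_algebra finfield.
From mathcomp Require Import mpoly.
From mathcomp Require Import boolp classical_sets.
From mathcomp Require Import ring zify.

Set Implicit Arguments.
Unset Strict Implicit.
Unset Printing Implicit Defensive.

Import Order.TTheory GRing.Theory Num.Theory.
Local Open Scope ring_scope.
Local Open Scope classical_set_scope.

(** * Ideals and primes *)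

(** The definition of Cohen-Macaulay asks for depth = height at every maximal ideal, graded or not.
    For a ring finite free over F[y_1, ..., y_D], with F finite, both numbers are shown to be D:
    chains of primes are bounded by counting elements of bounded degree, and Zariski's lemma
    supplies at each maximal ideal a regular sequence of D values g_i(y_i). It then remains to
    exhibit bases. In the tight closure computation the obstacle is that the multiplier c in R^0 is
    arbitrary. As R is reduced, c is a nonzerodivisor, and its norm to F_p[X_0, ..., X_(d-1)] is a
    nonzero multiplier free of X_d. Multiplying a relation by F^(Q-1), Q a power of p, and taking
    one coefficient over the Q-th powers replaces such a multiplier by X_d^(r-1), whose degree no
    longer depends on c; X_d^(r-1) in turn yields X_i^(r-1) for i < d. The bound on p is what makes
    the exponents in F^(p-1) fit: for r >= d a failure would give p <= (d-1) r - d - 1. *)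

Section IdealBasics.
Variable A : comPzRingType.
Implicit Types (I K P W : set A) (x y a : A).

Lemma ideal0 I : is_ideal I -> I 0. Proof. by case. Qed.

Lemma idealD I x y : is_ideal I -> I x -> I y -> I (x + y).
Proof. by case=> _ h _; apply: h. Qed.

Lemma idealLM I : is_ideal I -> forall a x, I x -> I (a * x).
Proof. by case=> _ _; apply. Qed.

Lemma idealRM I : is_ideal I -> forall a x, I x -> I (x * a).
Proof. by move=> hI a x hx; rewrite mulrC; apply: idealLM. Qed.

Lemma idealB I x y : is_ideal I -> I x -> I y -> I (x - y).
Proof. by move=> hI hx hy; apply: idealD => //; apply: is_ideal_opp. Qed.

Lemma idealDr I x y : is_ideal I -> I y -> I (x + y) -> I x.
Proof. by move=> hI hy hxy; rewrite -(addrK y x); apply: idealB. Qed.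

Lemma ideal_sum I : is_ideal I ->
  forall (T : Type) (s : seq T) (P : pred T) (G : T -> A),
  (forall i, P i -> I (G i)) -> I (\sum_(i <- s | P i) G i).
Proof.
move=> hI T s P G hG; apply: (big_ind I) => //; first exact: ideal0.
by move=> x y; apply: idealD.
Qed.

Lemma ideal_expr I x n : is_ideal I -> (0 < n)%N -> I x -> I (x ^+ n).
Proof. by case: n => // n hI _ hx; rewrite exprS; apply: idealRM. Qed.

Lemma set0_is_ideal : is_ideal [set 0 : A].
Proof.
split=> //= [x y -> ->|a x ->]; first by rewrite addr0.
by rewrite mulr0.
Qed.

Definition adjoin I a : set A := [set x | exists c y, I y /\ x = c * a + y].

Lemma adjoin_is_ideal I a : is_ideal I -> is_ideal (adjoin I a).
Proof.
move=> hI; split.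
- by exists 0, 0; split; [apply: ideal0 | rewrite mul0r addr0].
- move=> _ _ [c [y [hy ->]]] [c' [y' [hy' ->]]]; exists (c + c'), (y + y').
  by split; [apply: idealD | ring].
- move=> b _ [c [y [hy ->]]]; exists (b * c), (b * y).
  by split; [apply: idealLM | ring].
Qed.

Lemma sub_adjoin I a : I `<=` adjoin I a.
Proof. by move=> y hy; exists 0, y; rewrite mul0r add0r. Qed.

Lemma adjoin_self I a : is_ideal I -> adjoin I a a.
Proof. by move=> hI; exists 1, 0; rewrite mul1r addr0; split=> //; apply: ideal0. Qed.

Lemma ideal_gen_nil : ideal_gen [set` [::]] = [set 0 : A].
Proof.
apply/seteqP; split.
  by apply: ideal_gen_min => //; apply: set0_is_ideal.
by move=> _ ->; apply: ideal0; apply: ideal_gen_is_ideal.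
Qed.

Lemma ideal_gen_cons a (s : seq A) :
  ideal_gen [set` a :: s] = adjoin (ideal_gen [set` s]) a.
Proof.
have hs := ideal_gen_is_ideal [set` s].
apply/seteqP; split.
  apply: ideal_gen_min; first exact: adjoin_is_ideal.
  move=> x /=; rewrite inE => /orP[/eqP ->|hx]; first exact: adjoin_self.
  by apply: sub_adjoin; apply: sub_ideal_gen.
have hg := ideal_gen_is_ideal [set` a :: s].
move=> _ [c [y [hy ->]]]; apply: (idealD hg).
  by apply: (idealLM hg); apply: sub_ideal_gen; rewrite /= inE eqxx.
move: y hy; apply: ideal_gen_min => // y hy.
by apply: sub_ideal_gen; rewrite /= inE; apply/orP; right.
Qed.

Lemma ideal_gen_mono (S T : set A) : S `<=` T -> ideal_gen S `<=` ideal_gen T.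
Proof.
move=> h; apply: ideal_gen_min; first exact: ideal_gen_is_ideal.
by move=> x /h; apply: sub_ideal_gen.
Qed.

Lemma ideal_gen_seqP (s : seq A) x : ideal_gen [set` s] x <->
  exists c : nat -> A, x = \sum_(i < size s) c i * s`_i.
Proof.
split; last first.
  have hg := ideal_gen_is_ideal [set` s].
  move=> [c ->]; apply: (ideal_sum hg) => i _; apply: (idealLM hg).
  by apply: sub_ideal_gen; apply: mem_nth.
elim: s x => [|a s IH] x.
  by rewrite ideal_gen_nil => ->; exists (fun=> 0); rewrite big_ord0.
rewrite ideal_gen_cons => -[c [y [/IH[k ->] ->]]].
exists (fun n => if n is n'.+1 then k n' else c).
by rewrite big_ord_recl /=.
Qed.

Lemma exists_prime_disjoint I W : is_ideal I -> W 1 ->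
  (forall x y, W x -> W y -> W (x * y)) -> (forall x, I x -> ~ W x) ->
  exists P, [/\ is_prime_ideal P, I `<=` P & forall x, P x -> ~ W x].
Proof.
move=> hI W1 WM hIW.
(* [Zorn_bigcup] also asks for the union of the empty chain, hence the extra case [set0]; it is
   excluded afterwards because I is strictly larger. *)
pose Pr X := X = set0 \/ [/\ is_ideal X, I `<=` X & forall x, X x -> ~ W x].
have [F hF totF|Q [hQ hmax]] := @Zorn_bigcup A Pr.
  have [[X0 hX0]|hno] := pselect (exists X, F X /\ X !=set0); last first.
    left; apply/seteqP; split=> // x [X FX Xx]; apply: hno.
    by exists X; split=> //; exists x.
  case: hX0 => FX0 ne0; right.
  have good X : F X -> X !=set0 ->
      [/\ is_ideal X, I `<=` X & forall x, X x -> ~ W x].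
    move=> FX [z hz]; have := hF _ FX; rewrite /Pr => -[E|] //.
    by rewrite E in hz.
  have [hX0I hX0S _] := good _ FX0 ne0.
  split=> [|x hx|x [X FX Xx]]; last first.
  - by have [_ _] := good X FX (ex_intro _ _ Xx); apply.
  - by exists X0 => //; apply: hX0S.
  split.
  - by exists X0 => //; apply: ideal0.
  - move=> x y [X FX Xx] [Y FY Yy].
    have [hXI _ _] := good X FX (ex_intro _ _ Xx).
    have [hYI _ _] := good Y FY (ex_intro _ _ Yy).
    have [XY|YX] := totF _ _ FX FY.
      by exists Y => //; apply: idealD => //; apply: XY.
    by exists X => //; apply: idealD => //; apply: YX.
  - move=> a x [X FX Xx]; exists X => //.
    by have [hXI _ _] := good X FX (ex_intro _ _ Xx); apply: idealLM.
have [hQI hIQ hQW] : [/\ is_ideal Q, I `<=` Q & forall x, Q x -> ~ W x].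
  have [Q0|//] := hQ; exfalso; apply: (hmax I); last by right; split.
  rewrite Q0 properEneq; split=> //; apply/eqP => E.
  by have := ideal0 hI; rewrite -E.
exists Q; split=> //; split=> // [/hQW//|x y Qxy].
have key z : ~ Q z -> exists c u, Q u /\ W (c * z + u).
  move=> nQz; apply: contrapT => hno; apply: (hmax (adjoin Q z)).
    rewrite properEneq; split; last exact: sub_adjoin.
    by apply/eqP => E; apply: nQz; rewrite E; apply: adjoin_self.
  right; split; first exact: adjoin_is_ideal.
    by apply: subset_trans hIQ _; apply: sub_adjoin.
  by move=> _ [c [u [hu ->]]] hW; apply: hno; exists c, u.
apply: contrapT => /not_orP[/key[c [u [hu Wu]]] /key[c' [v [hv Wv]]]].
apply: (hQW _ _ (WM _ _ Wu Wv)).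
have -> : (c * x + u) * (c' * y + v) =
  c * c' * (x * y) + ((c * x + u) * v + c' * y * u) by ring.
by repeat (apply: idealD => //); apply: idealLM.
Qed.

Lemma exists_minimal_prime P : is_prime_ideal P ->
  exists2 Q, is_minimal_prime Q & Q `<=` P.
Proof.
move=> hP.
(* Zorn's lemma is available for unions, so it is applied to the complements of primes. *)
pose Pr X := X = set0 \/ exists Q, [/\ is_prime_ideal Q, Q `<=` P & X = ~` Q].
have [F hF totF|X [hX hmax]] := @Zorn_bigcup A Pr.
  have [[X0 [FX0 ne0]]|hno] := pselect (exists X, F X /\ X !=set0); last first.
    left; apply/seteqP; split=> // x [X FX Xx]; apply: hno.
    by exists X; split=> //; exists x.
  right.
  have good X : F X -> X !=set0 ->
      exists Q, [/\ is_prime_ideal Q, Q `<=` P & X = ~` Q].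
    move=> FX [z hz]; have := hF _ FX; rewrite /Pr => -[E|] //.
    by rewrite E in hz.
  exists [set x | forall X, F X -> ~ X x]; split; last first.
  - apply/seteqP; split=> [x [X FX Xx] /= h|x /=].
      exact: h _ FX Xx.
    move=> h; apply: contrapT => hno; apply: h => X FX Xx; apply: hno.
    by exists X.
  - move=> x hx; have [Q [_ QP EX]] := good _ FX0 ne0; apply: QP.
    by apply: contrapT => nQ; apply: (hx _ FX0); rewrite EX.
  split=> [| /(_ _ FX0) |x y hxy].
  - split=> /=.
    + move=> X FX X0'; have [Q [[hQ _ _] _ EX]] := good _ FX (ex_intro _ _ X0').
      by move: X0'; rewrite EX; apply; apply: ideal0.
    + move=> x y hx hy X FX Xxy.
      have [Q [[hQ _ _] _ EX]] := good _ FX (ex_intro _ _ Xxy).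
      have := Xxy; rewrite EX; apply; apply: idealD => //; apply: contrapT.
        by move=> nQ; apply: (hx _ FX); rewrite EX.
      by move=> nQ; apply: (hy _ FX); rewrite EX.
    + move=> a x hx X FX Xax.
      have [Q [[hQ _ _] _ EX]] := good _ FX (ex_intro _ _ Xax).
      have := Xax; rewrite EX; apply; apply: idealLM => //; apply: contrapT.
      by move=> nQ; apply: (hx _ FX); rewrite EX.
  - by have [Q [[_ nQ1 _] _ ->]] := good _ FX0 ne0; apply.
  - apply: contrapT => /not_orP[/existsNP[X /not_implyP[FX /contrapT Xx]]].
    move=> /existsNP[Y /not_implyP[FY /contrapT Yy]].
    have aux Z : F Z -> Z x -> Z y -> False.
      move=> FZ Zx Zy; have [Q [[_ _ hQM] _ EZ]] := good _ FZ (ex_intro _ _ Zx).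
      apply: (hxy _ FZ); rewrite EZ => /hQM[].
        by move: Zx; rewrite EZ.
      by move: Zy; rewrite EZ.
    by have [/(_ _ Xx) h|/(_ _ Yy) h] := totF _ _ FX FY; [apply: (aux Y) | apply: (aux X)].
have [Q [hQ QP EX]] : exists Q, [/\ is_prime_ideal Q, Q `<=` P & X = ~` Q].
  have [X0|//] := hX; exfalso; apply: (hmax (~` P)); last by right; exists P; split.
  rewrite X0 properEneq; split=> //; apply/eqP => E.
  have : (~` P) 1 by case: hP.
  by rewrite -E.
exists Q => //; split=> // Q' hQ' Q'Q; apply: contrapT => ne.
apply: (hmax (~` Q')); last by right; exists Q'; split=> //; apply: (subset_trans Q'Q QP).
rewrite EX properEneq; split; last by apply: subsetC.
by apply/eqP => /(congr1 (fun Z => ~` Z)); rewrite !setCK => E; apply: ne.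
Qed.

(** The products s a^n with s outside P form a multiplicative set, which misses I because a is a
    nonzerodivisor modulo I. A prime over I avoiding this set lies in P and does not contain a. *)
Lemma prime_below I P a : is_ideal I -> is_prime_ideal P -> I `<=` P ->
  (forall y, I (a * y) -> I y) -> P a ->
  exists Q, [/\ is_prime_ideal Q, I `<=` Q & Q `<` P].
Proof.
move=> hI [hP nP1 hPM] IP reg Pa.
pose W := [set x | exists s n, ~ P s /\ x = s * a ^+ n].
have [| |x hx|Q [hQ IQ hQW]] := @exists_prime_disjoint I W hI.
- by exists 1, 0%N; rewrite expr0 mulr1.
- move=> _ _ [s [n [hs ->]]] [t [m [ht ->]]]; exists (s * t), (n + m)%N.
  by split; [move=> /hPM[] | rewrite exprD; ring].
- move=> [s [n [hs E]]]; apply: hs; apply: IP; move: hx; rewrite {}E.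
  elim: n => [|n IH]; first by rewrite expr0 mulr1.
  by rewrite exprS mulrCA => /reg.
exists Q; split=> //; rewrite properEneq; split.
  apply/eqP => E; rewrite -E in Pa; apply: (hQW _ Pa); exists 1, 1%N.
  by rewrite expr1 mul1r.
move=> x Qx; apply: contrapT => nPx; apply: (hQW _ Qx).
by exists x, 0%N; rewrite expr0 mulr1.
Qed.

Lemma nonzerodivisor_off_minimal_primes a :
  (forall y, a * y = 0 -> y = 0) -> off_minimal_primes a.
Proof.
move=> reg P [hP hmin] Pa; have [hPI _ _] := hP.
have [|||Q [hQ _ QP]] := @prime_below [set 0] P a set0_is_ideal hP => //.
  by move=> _ ->; apply: ideal0.
by move: QP; rewrite properEneq => -[/eqP ne QP]; apply: ne; apply: hmin.
Qed.

(** A nonzero y with a y = 0 is not nilpotent, so some minimal prime misses y and must contain a. *)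
Lemma off_minimal_primes_regular a :
  (forall x n, x ^+ n = 0 -> x = 0) -> off_minimal_primes a ->
  forall y, a * y = 0 -> y = 0.
Proof.
move=> red ha y hay; apply: contrapT => y0.
have [|||P [hP _ hPW]] := @exists_prime_disjoint [set 0] [set x | exists n, x = y ^+ n] set0_is_ideal.
- by exists 0%N; rewrite expr0.
- by move=> _ _ [n ->] [m ->]; exists (n + m)%N; rewrite exprD.
- by move=> _ -> [n /esym/red].
have [Q hQ QP] := exists_minimal_prime hP.
have /(hPW _) : P y.
  apply: QP; have [[hQI _ hQM] _] := hQ; have := ideal0 hQI; rewrite -hay.
  by case/hQM => // /(ha _ hQ).
by apply; exists 1%N.
Qed.

End IdealBasics.

(** * Cohen-Macaulay rings from parameters *)

Section CohenMacaulayCriterion.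
Variable A : comPzRingType.
Implicit Types (P M : set A) (s : seq A).

Lemma maximal_is_prime M : is_maximal_ideal M -> is_prime_ideal M.
Proof.
move=> [hM nM1 hmax]; split=> // x y Mxy; apply: contrapT => /not_orP[nx ny].
have [E|E] := hmax _ (adjoin_is_ideal x hM) (@sub_adjoin _ M x).
  by apply: nx; rewrite -E; apply: adjoin_self.
have [c [u [hu E1]]] : adjoin M x 1 by rewrite E.
apply: ny; rewrite -[y]mul1r E1 mulrDl -mulrA.
by apply: (idealD hM); [apply: (idealLM hM) | apply: (idealRM hM)].
Qed.

(** By [prime_below], each further regular element in P forces a strictly smaller prime that still
    contains the earlier ones. *)
Lemma regular_seq_chain s n P : is_regular_seq s -> (n <= size s)%N ->
  is_prime_ideal P -> [set` take n s] `<=` P ->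
  exists2 C, is_prime_chain C n & C n = P.
Proof.
move=> [hreg _]; elim: n P => [|n IH] P hn hP sP.
  by exists (fun=> P) => //; split.
have hPI : is_ideal P by case: hP.
have [|||y||Q [hQ sQ QP]] := @prime_below A (ideal_gen [set` take n s]) P s`_n.
- exact: ideal_gen_is_ideal.
- exact: hP.
- apply: ideal_gen_min => // x hx; apply: sP.
  by rewrite /= (take_nth 0) // mem_rcons inE; apply/orP; right.
- exact: hreg.
- by apply: sP; rewrite /= (take_nth 0) // mem_rcons inE eqxx.
have [|C [hC1 hC2] hCn] := IH Q (ltnW hn) hQ.
  by apply: subset_trans sQ; apply: sub_ideal_gen.
exists (fun i => if (i <= n)%N then C i else P); last by rewrite ltnn.
split=> i hi.
  by case: ifP => // hin; apply: hC1.
have hin : (i <= n)%N by rewrite -ltnS.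
rewrite hin; case: ltnP => hni; first exact: hC2.
have -> : i = n by apply/eqP; rewrite eqn_leq hin hni.
by rewrite hCn.
Qed.

(** A regular sequence of length k in M gives a chain of primes of length k ending at M. Hence D
    bounds depth and height, and both attain it. *)
Lemma cohen_macaulay_criterion D : noetherian A ->
  (forall C k, @is_prime_chain A C k -> (k <= D)%N) ->
  (forall M, is_maximal_ideal M -> exists s,
     [/\ is_regular_seq s, [set` s] `<=` M & size s = D]) ->
  cohen_macaulay A.
Proof.
move=> noeth chains regs; split=> // M hM; have [s [hs sM ss]] := regs M hM.
have hP := maximal_is_prime hM; exists D; split; split.
- by exists s.
- move=> s' hs' s'M; have [|C hC _] := regular_seq_chain hs' (leqnn _) hP.
    by rewrite take_size.
  exact: chains hC.
- have [|C hC hCn] := regular_seq_chain hs (leqnn _) hP; first by rewrite take_size.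
  by exists C; rewrite -ss.
- by move=> C k hC _; apply: chains hC.
Qed.

End CohenMacaulayCriterion.

(* [itpoly F n] is F[y_1][y_2]...[y_n]; the variable adjoined first is the
   innermost one. *)
Fixpoint itpoly (F : comNzRingType) (n : nat) : comNzRingType :=
  if n is n'.+1 then itpoly {poly F} n' else F.

(** * Hilbert's basis theorem *)

Section Hilbert.
Variable F : comNzRingType.
Hypothesis noethF : noetherian F.

(** Covers the low degrees in [hilbert_basis], where the lifted leading coefficients may have too
    large a degree to be used. In each single degree the top coefficients form a finitely generated
    ideal. *)
Lemma hilbert_bounded (I : set {poly F}) N : is_ideal I ->
  exists gs : seq {poly F}, [set` gs] `<=` I /\
    forall q, I q -> (size q <= N)%N -> ideal_gen [set` gs] q.
Proof.
move=> hI; elim: N => [|N [gs [hgs IH]]].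
  exists [::]; split=> // q _; rewrite leqn0 size_poly_eq0 => /eqP ->.
  by apply: ideal0; apply: ideal_gen_is_ideal.
pose L := [set c | exists q, [/\ I q, (size q <= N.+1)%N & q`_N = c]].
have hL : is_ideal L.
  split.
  - by exists 0; rewrite size_poly0 coef0; split=> //; apply: ideal0.
  - move=> _ _ [q [Iq sq <-]] [q' [Iq' sq' <-]]; exists (q + q').
    rewrite coefD; split=> //; first exact: idealD.
    by rewrite (leq_trans (size_polyD _ _)) // geq_max sq.
  - move=> a _ [q [Iq sq <-]]; exists (a%:P * q); rewrite coefCM; split=> //.
      exact: idealLM.
    by rewrite mul_polyC (leq_trans (size_scale_leq _ _)).
have [bs Lbs] := noethF hL.
have [hs [sz hsI hsb]] : exists hs : seq {poly F},
    [/\ size hs = size bs, (forall i, (i < size bs)%N -> I hs`_i) &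
     forall i, (i < size bs)%N -> (size (hs`_i)%R <= N.+1)%N /\ (hs`_i)`_N = bs`_i].
  have : forall b, b \in bs -> exists q, [/\ I q, (size q <= N.+1)%N & q`_N = b].
    by move=> b hb; have : L b by rewrite Lbs; apply: sub_ideal_gen.
  elim: (bs) => [|b l IHl] h; first by exists [::].
  have [|hs [sz h1 h2]] := IHl; first by move=> c hc; apply: h; rewrite inE hc orbT.
  have [|q [Iq sq qb]] := h b; first by rewrite inE eqxx.
  by exists (q :: hs); split=> /=; [rewrite sz | case|case].
exists (hs ++ gs); split.
  move=> q; rewrite /= mem_cat => /orP[/(nthP 0)[i hi <-]|/hgs //].
  by apply: hsI; rewrite -sz.
move=> q Iq sq.
have : L q`_N by exists q.
rewrite Lbs => /ideal_gen_seqP[c Ec].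
have hG := ideal_gen_is_ideal [set` hs ++ gs].
pose u := \sum_(i < size bs) (c i)%:P * hs`_i.
have hu : I u by apply: (ideal_sum hI) => i _; apply: (idealLM hI); apply: hsI.
have su : (size u <= N.+1)%N.
  apply: (leq_trans (size_sum _ _ _)); apply/bigmax_leqP => i _.
  rewrite mul_polyC (leq_trans (size_scale_leq _ _)) //.
  by have [] := hsb i (ltn_ord i).
have EN : u`_N = q`_N.
  rewrite coef_sum Ec; apply: eq_bigr => i _; rewrite coefCM.
  by have [_ ->] := hsb i (ltn_ord i).
rewrite -[q](subrK u); apply: (idealD hG).
  apply: (@ideal_gen_mono _ [set` gs]).
    by move=> x hx; rewrite /= mem_cat; apply/orP; right.
  apply: IH; first exact: idealB.
  apply/leq_sizeP => j; rewrite leq_eqVlt coefB => /orP[/eqP <-|hj].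
    by rewrite EN subrr.
  by rewrite (leq_sizeP _ _ sq) // (leq_sizeP _ _ su) // subrr.
apply: (ideal_sum hG) => i _; apply: (idealLM hG); apply: sub_ideal_gen.
by rewrite /= mem_cat mem_nth ?sz.
Qed.

Lemma hilbert_basis : noetherian {poly F}.
Proof.
move=> I hI.
(* The index n may exceed the degree of q, so that zero and cancelling leading terms need no
   separate treatment. *)
pose L := [set c | exists q n, [/\ I q, (size q <= n.+1)%N & q`_n = c]].
have shift (q : {poly F}) n m : (size q <= n.+1)%N ->
    (size (q * 'X^m)%R <= (n + m).+1)%N /\ (q * 'X^m)`_(n + m) = q`_n.
  move=> sq; split; last by rewrite coefMXn ltnNge leq_addl addnK.
  have [->|q0] := eqVneq q 0; first by rewrite mul0r size_poly0.
  by rewrite size_mulXn // addnC -addSn leq_add2r.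
have hL : is_ideal L.
  split.
  - by exists 0, 0%N; rewrite size_poly0 coef0; split=> //; apply: ideal0.
  - move=> _ _ [q [n [Iq sq <-]]] [q' [n' [Iq' sq' <-]]].
    have [s1 c1] := shift q n n' sq; have [s2 c2] := shift q' n' n sq'.
    exists (q * 'X^n' + q' * 'X^n), (n + n')%N; split.
    + by apply: (idealD hI); apply: (idealRM hI).
    + by rewrite (leq_trans (size_polyD _ _)) // geq_max s1 addnC s2.
    + by rewrite coefD c1 addnC c2.
  - move=> a _ [q [n [Iq sq <-]]]; exists (a%:P * q), n; rewrite coefCM; split=> //.
      exact: idealLM.
    by rewrite mul_polyC (leq_trans (size_scale_leq _ _)).
have [bs Lbs] := noethF hL.
have [hs [ns [sz hsb]]] : exists (hs : seq {poly F}) (ns : seq nat),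
    size hs = size bs /\ forall i, (i < size bs)%N ->
     [/\ I hs`_i, (size (hs`_i)%R <= (nth 0 ns i).+1)%N & (hs`_i)`_(nth 0 ns i) = bs`_i].
  have : forall b, b \in bs -> exists q n, [/\ I q, (size q <= n.+1)%N & q`_n = b].
    by move=> b hb; have : L b by rewrite Lbs; apply: sub_ideal_gen.
  elim: (bs) => [|b l IHl] h; first by exists [::], [::].
  have [|hs [ns [sz h1]]] := IHl; first by move=> c hc; apply: h; rewrite inE hc orbT.
  have [|q [n [Iq sq qb]]] := h b; first by rewrite inE eqxx.
  by exists (q :: hs), (n :: ns); split=> /=; [rewrite sz | case].
pose N := \max_(i < size bs) nth 0%N ns i.
have [gs [gsI hgs]] := hilbert_bounded N.+1 hI.
exists (hs ++ gs).
have hG := ideal_gen_is_ideal [set` hs ++ gs].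
have hsI i : (i < size bs)%N -> I hs`_i by case/hsb.
apply/seteqP; split; last first.
  apply: ideal_gen_min => // q.
  rewrite /= mem_cat => /orP[/(nthP 0)[i hi <-]|/gsI //].
  by apply: hsI; rewrite -sz.
move=> q Iq; move: {2}(size q) (leqnn (size q)) => k.
elim: k q Iq => [|k IH] q Iq sq.
  by move: sq; rewrite leqn0 size_poly_eq0 => /eqP ->; apply: ideal0.
have [sN|sN] := leqP (size q) N.+1.
  apply: (@ideal_gen_mono _ [set` gs]); last exact: hgs.
  by move=> x hx; rewrite /= mem_cat; apply/orP; right.
have : L q`_k by exists q, k.
rewrite Lbs => /ideal_gen_seqP[c Ec].
have Nk : (N < k)%N by rewrite -ltnS (leq_trans sN).
have nk i (hi : (i < size bs)%N) : (nth 0 ns i <= k)%N.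
  by rewrite (leq_trans _ (ltnW Nk)) // /N (bigD1 (Ordinal hi)) //=; exact: leq_maxl.
pose u := \sum_(i < size bs) (c i)%:P * (hs`_i * 'X^(k - nth 0 ns i)).
have Gu : ideal_gen [set` hs ++ gs] u.
  apply: (ideal_sum hG) => i _; apply: (idealLM hG); apply: (idealRM hG).
  by apply: sub_ideal_gen; rewrite /= mem_cat mem_nth ?sz.
have hu : I u by apply: (ideal_sum hI) => i _; apply: (idealLM hI); apply: (idealRM hI); apply: hsI.
have su : (size u <= k.+1)%N.
  apply: (leq_trans (size_sum _ _ _)); apply/bigmax_leqP => i _.
  rewrite mul_polyC (leq_trans (size_scale_leq _ _)) //.
  have [_ s1 _] := hsb i (ltn_ord i); have [s2 _] := shift _ _ (k - nth 0 ns i)%N s1.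
  by rewrite (leq_trans s2) // subnKC // nk.
have Ek : u`_k = q`_k.
  rewrite coef_sum Ec; apply: eq_bigr => i _; rewrite coefCM.
  have [_ s1 Eb] := hsb i (ltn_ord i); have [_] := shift _ _ (k - nth 0 ns i)%N s1.
  by rewrite subnKC ?nk // => ->; rewrite Eb.
rewrite -[q](subrK u); apply: (idealD hG) => //; apply: IH; first exact: idealB.
apply/leq_sizeP => j; rewrite leq_eqVlt coefB => /orP[/eqP <-|hj].
  by rewrite Ek subrr.
by rewrite (leq_sizeP _ _ sq) // (leq_sizeP _ _ su) // subrr.
Qed.
End Hilbert.

Lemma noetherian_itpoly (F : comNzRingType) n : noetherian F -> noetherian (itpoly F n).
Proof. by elim: n F => //= n IH F hF; apply: IH; apply: hilbert_basis. Qed.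

Lemma noetherian_field (F : fieldType) : noetherian F.
Proof.
move=> I hI; have [[x [Ix x0]]|h] := pselect (exists x, I x /\ x != 0); last first.
  exists [::]; rewrite ideal_gen_nil; apply/seteqP; split=> [x Ix|_ -> ]; last exact: ideal0.
  by apply: contrapT => /eqP x0; apply: h; exists x.
exists [:: 1]; rewrite ideal_gen1; apply/seteqP; split=> // y _.
by rewrite -[y](mulfVK x0); apply: (idealLM hI).
Qed.

Lemma noetherian_image (A B : comPzRingType) (ev : {rmorphism A -> B}) :
  (forall b, exists a, ev a = b) -> noetherian A -> noetherian B.
Proof.
move=> surj hA I hI.
have hI' : is_ideal [set a | I (ev a)].
  split=> [|x y|a x] /=; first by rewrite rmorph0; apply: ideal0.
    by rewrite rmorphD; apply: idealD.
  by rewrite rmorphM; apply: idealLM.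
have [s Es] := hA _ hI'.
exists (map ev s); apply/seteqP; split; last first.
  apply: ideal_gen_min => // _ /= /mapP[a ha ->].
  by have : [set a | I (ev a)] a by rewrite Es; apply: sub_ideal_gen.
move=> b; have [a <-] := surj b => Ia.
have : ideal_gen [set` s] a by rewrite -Es.
have hG := ideal_gen_is_ideal [set` map ev s].
move=> /ideal_gen_seqP[c ->]; rewrite rmorph_sum; apply: (ideal_sum hG) => i _.
rewrite rmorphM; apply: (idealLM hG); apply: sub_ideal_gen.
by apply: map_f; apply: mem_nth.
Qed.

(** * Bounding the dimension by counting *)

Section ItpolyEvaluation.
Variable K : comNzRingType.

Definition heval (F : comNzRingType) (phi : {rmorphism F -> K}) (x : K) :
    {rmorphism {poly F} -> K} :=
  horner_morph (fun a => mulrC x (phi a)).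

Fixpoint itev (F : comNzRingType) (phi : {rmorphism F -> K}) (xs : seq K) :
    {rmorphism itpoly F (size xs) -> K} :=
  if xs is x :: xs' then itev (heval phi x) xs' else phi.

Lemma hevalE (F : comNzRingType) (phi : {rmorphism F -> K}) x (g : {poly F}) :
  heval phi x g = (map_poly phi g).[x].
Proof. by []. Qed.

Lemma hevalC (F : comNzRingType) (phi : {rmorphism F -> K}) x a :
  heval phi x a%:P = phi a.
Proof. exact: horner_morphC. Qed.

Lemma hevalX (F : comNzRingType) (phi : {rmorphism F -> K}) x :
  heval phi x 'X = x.
Proof. exact: horner_morphX. Qed.

Lemma itev_const (F : comNzRingType) (phi : {rmorphism F -> K}) xs a :
  exists u, itev phi xs u = phi a.
Proof.
elim: xs F phi a => [|x xs IH] F phi a; first by exists a.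
by have [u hu] := IH _ (heval phi x) a%:P; exists u; rewrite [LHS]hu hevalC.
Qed.

Lemma itev_gen (F : comNzRingType) (phi : {rmorphism F -> K}) xs x :
  x \in xs -> exists u, itev phi xs u = x.
Proof.
elim: xs F phi => [|y xs IH] F phi //; rewrite inE => /orP[/eqP ->|h].
  by have [u hu] := itev_const (heval phi y) xs 'X; exists u; rewrite [LHS]hu hevalX.
by have [u hu] := IH _ (heval phi y) h; exists u.
Qed.

End ItpolyEvaluation.

Section ChainBound.
Variable K : comNzRingType.

(** Factors X can be cancelled from g, since x is not in the prime P. Once the constant term c is
    nonzero, g(x) and c differ by a multiple of x, which lies in Q. *)
Lemma chain_step (P Q : set K) (F : comNzRingType) (phi : {rmorphism F -> K}) x
    (g : {poly F}) : is_prime_ideal P -> is_ideal Q -> P `<=` Q ->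
  Q x -> ~ P x -> g != 0 -> P (heval phi x g) -> exists2 c, c != 0 & Q (phi c).
Proof.
move=> [hP _ hPM] hQ PQ Qx nPx; elim/poly_ind: g => [|g c IH]; first by rewrite eqxx.
have [->|c0 _] := eqVneq c 0.
  rewrite addr0 rmorphM hevalX => g0 /hPM[|//]; apply: IH.
  by apply: contraNneq g0 => ->; rewrite mul0r.
rewrite rmorphD rmorphM /= hevalX hevalC => h; exists c => //.
have := PQ _ h; rewrite addrC; apply: idealDr => //; exact: idealLM.
Qed.

(** A relation among elements that enter the primes of a chain one after the other loses one
    variable at each prime. Over a field the surviving nonzero constant is a unit, so such elements
    are algebraically independent. The list runs down the chain because its head is the innermost
    variable, which is eliminated last. *)
Lemma chain_eliminate (C : nat -> set K) (F : comNzRingType)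
    (phi : {rmorphism F -> K}) (xs : seq K) (u : itpoly F (size xs)) :
  (forall i, (i <= size xs)%N -> is_prime_ideal (C i)) ->
  (forall i, (i < size xs)%N -> C i `<=` C i.+1) ->
  (forall i, (i < size xs)%N -> C (size xs - i)%N xs`_i /\ ~ C (size xs - i.+1)%N xs`_i) ->
  u != 0 -> C 0%N (itev phi xs u) -> exists2 a, a != 0 & C (size xs) (phi a).
Proof.
elim: xs F phi u => [|x xs IH] F phi u hC hsub hx u0 hu; first by exists u.
have [||i hi|g g0 Cg] := IH _ (heval phi x) u _ _ _ u0 hu.
- by move=> i hi; apply: hC; apply: leqW.
- by move=> i hi; apply: hsub; apply: leqW.
- exact: (hx i.+1).
have [h1 h2] := hx 0%N isT; rewrite /= subn0 subn1 /= in h1 h2.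
apply: (chain_step _ _ _ h1 h2 g0 Cg); first by apply: hC => /=; apply: leqnSn.
  by have [] := hC _ (leqnn _).
exact: hsub.
Qed.

Variables (Fl : nat -> set K) (s : nat).
Hypothesis Fl0 : forall b, Fl b 0.
Hypothesis FlD : forall b x y, Fl b x -> Fl b y -> Fl b (x + y).
Hypothesis FlS : forall b b' x, (b <= b')%N -> Fl b x -> Fl b' x.

Lemma Fl_horner (F : comNzRingType) (phi : {rmorphism F -> K}) x b N (E : nat -> F) :
  (forall y c, Fl c y -> Fl (c + s)%N (x * y)) -> (forall i, (i < N)%N -> Fl b (phi (E i))) ->
  Fl (b + N * s)%N (heval phi x (\poly_(i < N) E i)).
Proof.
move=> hx hE; rewrite poly_def rmorph_sum.
apply: (big_ind (Fl (b + N * s)%N)) => [//|y z|i _]; first exact: FlD.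
rewrite -mul_polyC rmorphM /= hevalC rmorphXn /= hevalX.
apply: (@FlS (b + i * s)%N); first by rewrite leq_add2l leq_mul2r (ltnW (ltn_ord i)) orbT.
elim: {1 3}(nat_of_ord i) => [|n IH]; first by rewrite expr0 mulr1 addn0; apply: hE.
by rewrite exprS mulrCA mulSn addnCA addnC; apply: hx.
Qed.

(** Counts the polynomials whose partial degrees are all below N: their number is exponential in
    N^(size xs), while the level of their values in the filtration [Fl] is only linear in N. *)
Lemma itpoly_box (xs : seq K) (F : comNzRingType) (phi : {rmorphism F -> K})
    (X : finType) (e : X -> F) (b N : nat) :
  injective e -> (forall a, Fl b (phi (e a))) ->
  (forall x y c, x \in xs -> Fl c y -> Fl (c + s)%N (x * y)) ->
  exists (T : finType) (e' : T -> itpoly F (size xs)),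
    [/\ injective e', #|T| = (#|X| ^ (N ^ size xs))%N &
        forall t, Fl (b + size xs * (N * s))%N (itev phi xs (e' t))].
Proof.
elim: xs F phi X e b => [|x xs IH] F phi X e b inje hb hx.
  by exists X, e; split=> //= t; rewrite mul0n addn0.
pose E (c : {ffun 'I_N -> X}) (i : nat) := if insub i is Some j then e (c j) else 0.
pose e1 (c : {ffun 'I_N -> X}) : {poly F} := \poly_(i < N) E c i.
have inje1 : injective e1.
  move=> c c' /polyP h; apply/ffunP => i; apply: inje.
  by have := h i; rewrite !coef_poly ltn_ord /E valK.
have hb1 c : Fl (b + N * s)%N (heval phi x (e1 c)).
  apply: Fl_horner => [y k|i hi]; first by apply: hx; rewrite inE eqxx.
  by rewrite /E insubT.
have [|T [e' [inje' cT hT]]] := IH _ (heval phi x) _ e1 _ inje1 hb1.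
  by move=> y z c hy; apply: hx; rewrite inE hy orbT.
exists T, e'; split=> // [|t]; last by rewrite /= mulSn addnA; apply: hT.
by rewrite cT card_ffun card_ord /= -expnM expnS.
Qed.

End ChainBound.

(** A chain of length D + 1 gives D + 1 elements as in [chain_eliminate]. About |F|^(N^(D+1))
    polynomials in them take values in a level with at most |F|^(C M^D) elements, M linear in N. Two
    polynomials then agree, and their difference is a forbidden relation. *)
Lemma prime_chain_bound (K : comNzRingType) (Fl : nat -> set K) (F : finFieldType)
    (phi : {rmorphism F -> K}) (D C0 b0 : nat) :
  (forall b, Fl b 0) -> (forall b x y, Fl b x -> Fl b y -> Fl b (x + y)) ->
  (forall b b' x, (b <= b')%N -> Fl b x -> Fl b' x) ->
  (forall x, exists s, forall n y, Fl n y -> Fl (n + s)%N (x * y)) ->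
  (forall a, Fl b0 (phi a)) ->
  (forall n, exists (T : finType) (v : T -> K),
    (#|T| <= #|F| ^ (C0 * n.+1 ^ D))%N /\ forall x, Fl n x -> exists t, v t = x) ->
  forall C k, @is_prime_chain K C k -> (k <= D)%N.
Proof.
move=> Fl0 FlD FlS Flx Flphi Flcard C k [hC1 hC2]; rewrite leqNgt; apply/negP => Dk.
have hC i : (i <= D.+1)%N -> is_prime_ideal (C i).
  by move=> hi; apply: hC1; apply: leq_trans Dk.
have hx i : (i < D.+1)%N -> exists x, C i.+1 x /\ ~ C i x.
  move=> hi; apply: contrapT => no.
  have [sub nsub] := hC2 i (leq_trans hi Dk); apply: nsub => x Cx.
  by apply: contrapT => nx; apply: no; exists x.
have [y hy] : exists y : nat -> K, forall i, (i < D.+1)%N -> C i.+1 (y i) /\ ~ C i (y i).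
  have /choice[y hy] : forall i, exists x, (i < D.+1)%N -> C i.+1 x /\ ~ C i x.
    move=> i; case: (ltnP i D.+1) => [/hx[x h]|_]; first by exists x.
    by exists 0.
  by exists y.
pose xs := mkseq (fun i => y (D - i)%N) D.+1.
have sxs : size xs = D.+1 by rewrite size_mkseq.
have [s hs] : exists s, forall x z c, x \in xs -> Fl c z -> Fl (c + s)%N (x * z).
  elim: (xs) => [|x l [s hs]]; first by exists 0%N.
  have [s' hs'] := Flx x; exists (s + s')%N => w z c; rewrite inE => /orP[/eqP ->|hw] hz.
    by apply: (FlS (c + s')%N); [rewrite leq_add2l leq_addl | apply: hs'].
  by apply: (FlS (c + s)%N); [rewrite leq_add2l leq_addr | apply: hs].
(* With these choices the level M of the values satisfies M + 1 <= N L, and C0 (N L)^D < N^(D+1). *)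
pose L := (b0 + D.+1 * s).+1.
pose N := (C0 * L ^ D).+1.
have [T [e' [inje' cT hT]]] := @itpoly_box K Fl s Fl0 FlD FlS xs F phi F id b0 N (@inj_id _) Flphi hs.
pose M := (b0 + size xs * (N * s))%N.
have [T' [v [cT' hv]]] := Flcard M.
have /choice[g hg] : forall t, exists t', v t' = itev phi xs (e' t).
  by move=> t; apply: hv; apply: hT.
have ninj : ~ injective g.
  move=> injg; have := leq_card g injg; rewrite cT => /leq_trans/(_ cT').
  have F1 : (1 < #|F|)%N by apply: card_finNzRing_gt1.
  rewrite leq_exp2l // leqNgt => /negP; apply.
  have ML : (M.+1 <= N * L)%N.
    rewrite /M /L sxs mulnS mulnDr; nia.
  have mono a b : (a <= b)%N -> (a ^ D <= b ^ D)%N.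
    by case: (posnP D) => [->|D0] ab; rewrite ?expn0 ?leq_exp2r.
  apply: (@leq_ltn_trans (C0 * (N * L) ^ D)); first by rewrite leq_mul2l mono ?orbT.
  by rewrite expnMn mulnCA sxs expnSr ltn_mul2l expn_gt0 /N ltnS leqnn.
have [t [t' [ne E]]] : exists t t', t <> t' /\ g t = g t'.
  apply: contrapT => no; apply: ninj => t t' E; apply: contrapT => ne.
  by apply: no; exists t, t'.
have [|i hi|i hi|||a a0 Ca] := @chain_eliminate K C F phi xs (e' t - e' t').
- by rewrite sxs.
- by rewrite sxs in hi; have /properW := hC2 i (leq_trans hi Dk).
- rewrite sxs in hi *; rewrite nth_mkseq //; have := hy (D - i)%N.
  by rewrite subSn ?subSS ?ltnS ?leq_subr //; apply.
- by rewrite subr_eq0; apply/eqP => /inje'.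
- rewrite rmorphB -!hg E subrr; apply: ideal0; by case: (hC 0%N isT).
rewrite sxs in Ca; have [hI n1 _] := hC _ (leqnn D.+1); apply: n1.
by rewrite -(rmorph1 phi) -(mulVf a0) rmorphM; apply: idealLM.
Qed.

(** * Zariski's lemma *)

Section Zariski.
Variable K : fieldType.

Section Denominators.
Variables (F : comNzRingType) (phi : {rmorphism F -> K}).
Implicit Types (c k : F) (z : K) (q : {poly K}).

Definition frac_mem c z := exists a s, z = phi a / phi c ^+ s.

Definition frac_integral c z :=
  exists q, [/\ q \is monic, root q z & forall i, frac_mem c q`_i].

Lemma frac_mem_mono c k z : phi k != 0 -> frac_mem c z -> frac_mem (c * k) z.
Proof.
move=> k0 [a [s ->]]; exists (a * k ^+ s), s.
rewrite !rmorphM rmorphXn exprMn invfM mulrACA mulfV ?mulr1 //.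
by rewrite expf_neq0.
Qed.

Lemma frac_integral_mono c k z : phi k != 0 -> frac_integral c z -> frac_integral (c * k) z.
Proof.
by move=> k0 [q [h1 h2 h3]]; exists q; split=> // i; apply: frac_mem_mono.
Qed.

(** Presents phi(F)[1/phi(c)] as the image of a polynomial ring, so that integrality over it becomes
    [integralOver]. *)
Let psi c := heval phi (phi c)^-1.

Lemma frac_memP c z : phi c != 0 -> frac_mem c z <-> exists w, psi c w = z.
Proof.
move=> c0; split=> [[a [s ->]]|[w <-]].
  by exists (a%:P * 'X^s); rewrite rmorphM /= hevalC rmorphXn /= hevalX exprVn.
elim/poly_ind: w => [|w a [b [s IH]]].
  by exists 0, 0%N; rewrite !rmorph0 mul0r.
exists (b + a * c ^+ s.+1), s.+1.
rewrite (rmorphD (psi c)) (rmorphM (psi c)) IH hevalC hevalX.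
rewrite rmorphD rmorphM rmorphXn mulrDl mulfK ?expf_neq0 //.
by rewrite exprSr invfM mulrA.
Qed.

Lemma frac_integralP c z : phi c != 0 -> frac_integral c z <-> integralOver (psi c) z.
Proof.
move=> c0; split=> [[q [h1 h2 h3]]|[q h1 h2]].
  apply: (integral_root_monic h1 h2); apply/integral_poly => i.
  by have [w <-] := (frac_memP _ c0).1 (h3 i); apply: integral_id.
exists (map_poly (psi c) q); split=> [||i]; rewrite ?monic_map //.
by apply/(frac_memP _ c0); rewrite coef_map; eexists.
Qed.

(** Inverting also the numerator k of the leading coefficient makes q monic. *)
Lemma frac_integral_of_root c q z : phi c != 0 -> q != 0 -> root q z ->
  (forall i, frac_mem c q`_i) -> exists2 k, phi k != 0 & frac_integral (c * k) z.
Proof.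
move=> c0 q0 qz hq; have [k [s Ek]] := hq (size q).-1.
have l0 : lead_coef q != 0 by rewrite lead_coef_eq0.
have k0 : phi k != 0.
  by apply: contraNneq l0 => k0; rewrite /lead_coef Ek k0 mul0r.
exists k => //; exists ((lead_coef q)^-1 *: q); split=> [||i].
- by rewrite monicE lead_coefZ mulVf.
- by rewrite rootZ // invr_eq0.
- have [a [t Ea]] := frac_mem_mono k0 (hq i).
  exists (c ^+ s.+1 * a), t.+1.
  rewrite coefZ /lead_coef Ek Ea invf_div !rmorphM rmorphXn !exprS.
  have cs0 : phi c ^+ s != 0 by rewrite expf_neq0.
  have ct0 : (phi c * phi k) ^+ t != 0 by rewrite expf_neq0 // mulf_neq0.
  move: (phi c ^+ s) ((phi c * phi k) ^+ t) cs0 ct0 => u v u0 v0.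
  by field; rewrite k0 c0 v0.
Qed.

Lemma frac_integral_inv c z : phi c != 0 -> frac_integral c z ->
  exists2 k, phi k != 0 & frac_integral (c * k) z^-1.
Proof.
move=> c0 [q [h1 h2 h3]].
have [->|z0] := eqVneq z 0.
  exists 1; rewrite ?rmorph1 ?oner_eq0 // invr0; exists 'X; split=> [||i]; rewrite ?monicX ?rootX //.
  by exists (i == 1%N)%:R, 0%N; rewrite coefX rmorph_nat expr0 divr1.
have sq : (0 < size q)%N by rewrite size_poly_gt0 monic_neq0.
(* The reversed polynomial has z^-1 as a root. It is nonzero because its constant coefficient is the
   leading coefficient 1 of q. *)
pose Q := \poly_(i < size q) q`_((size q).-1 - i).
apply: (@frac_integral_of_root c Q) => //.
- apply/eqP => /(congr1 (fun u : {poly K} => u`_0)); rewrite /= coef_poly sq subn0 coef0.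
  by move: h1; rewrite monicE /lead_coef => /eqP -> /eqP; rewrite oner_eq0.
- rewrite rootE horner_poly; apply/eqP/(mulfI (expf_neq0 (size q).-1 z0)).
  rewrite mulr0 mulr_sumr -[RHS](eqP h2) horner_coef.
  rewrite [RHS](reindex_inj rev_ord_inj) /=; apply: eq_bigr => i _.
  have hi := ltn_ord i.
  have -> : ((size q).-1 - i = size q - i.+1)%N by rewrite -subn1 -subnDA add1n.
  have -> : (size q).-1 = (size q - i.+1 + i)%N by rewrite -{1}(subnK hi) addnS.
  by rewrite mulrCA exprD exprVn mulfK // expf_neq0.
- move=> i; rewrite coef_poly; case: ifP => // _.
  by exists 0, 0%N; rewrite rmorph0 mul0r.
Qed.

End Denominators.

(** If x were transcendental, 1 + X h would divide a power of h as a polynomial; but it is coprime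
    to h and not constant. *)
Lemma algebraic_of_goldman (F : comNzRingType) (phi : {rmorphism F -> K}) x (h : {poly F}) :
  heval phi x h != 0 ->
  (forall a, heval phi x a != 0 -> exists b n, heval phi x (a * b) = heval phi x (h ^+ n)) ->
  exists2 g : {poly F}, map_poly phi g != 0 & heval phi x g = 0.
Proof.
move=> h0 hh; apply: contrapT => no.
have key g : heval phi x g = 0 -> map_poly phi g = 0.
  by move=> g0; apply: contrapT => /eqP ne; apply: no; exists g.
have H0 : map_poly phi h != 0.
  by apply: contraNneq h0; rewrite hevalE => ->; rewrite horner0.
have sH : (1 < size (1 + 'X * map_poly phi h)%R)%N.
  rewrite addrC mulrC -[1]/(1%:P) size_MXaddC (negbTE H0) /= ltnS.
  by rewrite size_poly_gt0.
have [|b [n E]] := hh (1 + 'X * h).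
  apply/eqP => /key; rewrite rmorphD rmorph1 rmorphM /= map_polyX => E.
  by rewrite E size_poly0 in sH.
have /key/eqP : heval phi x ((1 + 'X * h) * b - h ^+ n) = 0 by rewrite rmorphB E subrr.
rewrite rmorphB rmorphM rmorphXn rmorphD rmorph1 rmorphM /= map_polyX subr_eq0 => /eqP {}E.
set H := map_poly phi h in E sH H0.
have cop : coprimep (1 + 'X * H) (H ^+ n).
  apply: coprimep_expr; apply/Bezout_eq1_coprimepP.
  by exists (1, - 'X) => /=; ring.
have : (1 + 'X * H) %| 1.
  by rewrite -(Gauss_dvdpl _ cop) mul1r -E dvdp_mulIl.
by move=> /dvdp_leq; rewrite oner_eq0 size_poly1 leqNgt sH => /(_ isT).
Qed.

(** The conclusion says that phi(F) is a Goldman domain: inverting the single element h gives its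
    fraction field. To go down from phi(F)[x] to phi(F), choose c such that x and the inverse of
    h(x) are integral over phi(F)[1/c]. The inverse of any nonzero a in phi(F) is then integral over
    this ring, hence belongs to it. *)
Lemma goldman (F : comNzRingType) (phi : {rmorphism F -> K}) (xs : seq K) :
  (forall z, exists u, itev phi xs u = z) ->
  exists2 h, phi h != 0 & forall a, phi a != 0 -> exists b n, phi (a * b) = phi (h ^+ n).
Proof.
elim: xs F phi => [|x xs IH] F phi surj.
  exists 1; first by rewrite rmorph1 oner_eq0.
  move=> a a0; have [b hb] := surj (phi a)^-1; exists b, 0%N.
  by rewrite rmorphM [phi b]hb expr0 rmorph1 mulfV.
have [h h0 hh] := IH _ (heval phi x) surj.
have [g g0 gx] := algebraic_of_goldman h0 hh.
have F1 : phi 1 != 0 by rewrite rmorph1 oner_eq0.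
have mem1 c a : frac_mem phi c (phi a) by exists a, 0%N; rewrite expr0 divr1.
have [k1 k10 int1] : exists2 k, phi k != 0 & frac_integral phi (1 * k) x.
  apply: (frac_integral_of_root F1 g0); first by rewrite rootE; apply/eqP.
  by move=> i; rewrite coef_map; apply: mem1.
rewrite mul1r in int1.
have ev_int c b : phi c != 0 -> frac_integral phi c x -> frac_integral phi c (heval phi x b).
  move=> c0 /(frac_integralP _ c0) hx; apply/(frac_integralP _ c0); rewrite hevalE.
  apply: integral_horner => //; apply/integral_poly => i.
  have [w Ew] := (frac_memP _ c0).1 (mem1 c b`_i).
  have -> : (map_poly phi b)`_i = heval phi (phi c)^-1 w by rewrite coef_map Ew.
  exact: integral_id.
have [k2 k20 int2] := frac_integral_inv k10 (ev_int _ h k10 int1).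
set c := k1 * k2 in int2.
have c0 : phi c != 0 by rewrite rmorphM mulf_neq0.
have int1c : frac_integral phi c x := frac_integral_mono k20 int1.
clearbody c.
exists c => // a a0.
have [|b [n E]] := hh a%:P; first by rewrite hevalC.
have intz : frac_integral phi c (phi a)^-1.
  have -> : (phi a)^-1 = heval phi x b * (heval phi x h)^-1 ^+ n.
    apply: (mulfI a0); rewrite mulfV //; move: E; rewrite rmorphM rmorphXn /= hevalC mulrA => ->.
    by rewrite -exprMn mulfV ?expr1n.
  apply/(frac_integralP _ c0); apply: integral_mul.
    by apply/(frac_integralP _ c0); apply: ev_int.
  elim: n {E} => [|n IHn]; first exact: integral1.
  by rewrite exprS; apply: integral_mul => //; apply/(frac_integralP _ c0).
have [q [qm qz hq]] := intz.
have memM u v : frac_mem phi c u -> frac_mem phi c v -> frac_mem phi c (u * v).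
  move=> [a1 [s1 ->]] [a2 [s2 ->]]; exists (a1 * a2), (s1 + s2)%N.
  by rewrite rmorphM exprD invfM mulrACA.
have memD u v : frac_mem phi c u -> frac_mem phi c v -> frac_mem phi c (u + v).
  move=> [a1 [s1 ->]] [a2 [s2 ->]]; exists (a1 * c ^+ s2 + a2 * c ^+ s1), (s1 + s2)%N.
  rewrite rmorphD !rmorphM !rmorphXn exprD.
  have e1 : phi c ^+ s1 != 0 by rewrite expf_neq0.
  have e2 : phi c ^+ s2 != 0 by rewrite expf_neq0.
  by move: (phi c ^+ s1) (phi c ^+ s2) e1 e2 => u' v' e1 e2; field; rewrite e1 e2.
have : frac_mem phi c (phi a)^-1.
  have sq : (1 < size q)%N by apply: root_size_gt1 qz; apply: monic_neq0.
  (* The monic equation of 1/a has degree m + 1; multiplied by a^m it expresses 1/a through the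
     coefficients of q and powers of a. *)
  pose m := (size q).-2.
  have Esq : size q = m.+2 by rewrite /m -!subn1; lia.
  move: qz; rewrite rootE horner_coef Esq big_ord_recr /=.
  have -> : q`_m.+1 = 1 by move: qm; rewrite monicE /lead_coef Esq => /eqP.
  rewrite mul1r exprSr => /eqP/(congr1 (fun u => phi a ^+ m * u)).
  rewrite mulr0 mulrDr mulrA -exprMn mulfV // expr1n mul1r mulr_sumr => /eqP.
  rewrite addrC addr_eq0 => /eqP ->; rewrite -sumrN.
  apply: (big_ind (frac_mem phi c)) => [|//|i _].
    by exists 0, 0%N; rewrite rmorph0 mul0r.
  have -> : - (phi a ^+ m * (q`_i * (phi a)^-1 ^+ i)) = phi (- a ^+ (m - i)) * q`_i.
    rewrite rmorphN rmorphXn mulNr; congr (- _).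
    have hi : (i <= m)%N by rewrite -ltnS.
    rewrite -{1}(subnK hi) exprD -!mulrA; congr (_ * _).
    by rewrite mulrCA -exprMn mulfV // expr1n mulr1.
  exact: memM.
move=> [b' [s E']]; exists b', s; rewrite rmorphM rmorphXn.
have e : phi c ^+ s != 0 by rewrite expf_neq0.
by move/(congr1 (fun u => phi a * u * phi c ^+ s)): E'; rewrite mulfV // mul1r -mulrA mulfVK.
Qed.

Lemma zariski (F : comNzRingType) (phi : {rmorphism F -> K}) (x : K) (xs : seq K) :
  (forall z, exists u, itev phi (x :: xs) u = z) ->
  exists2 g : {poly F}, map_poly phi g != 0 & (map_poly phi g).[x] = 0.
Proof.
by move=> /(@goldman _ (heval phi x) xs)[h h0 hh]; apply: algebraic_of_goldman h0 hh.
Qed.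

End Zariski.

(** * Residue fields *)

Section QuotientMap.
Variables (A : comPzRingType) (I : set A) (hI : is_ideal I).

Definition qpi (x : A) : quot_ring hI := \pi_(quot_ring hI)%qT x.

Fact qpi_is_zmod_morphism : zmod_morphism qpi.
Proof.
have piD u v : qpi (u + v) = qpi u + qpi v by exact: (@Quotient.pi_add A (quot_pred hI)).
move=> x y; apply: (addIr (qpi y)).
by rewrite -piD !subrK.
Qed.

HB.instance Definition _ :=
  GRing.isZmodMorphism.Build A (quot_ring hI) qpi qpi_is_zmod_morphism.

Fact qpi_is_monoid_morphism : monoid_morphism qpi.
Proof. by split=> // x y; rewrite /qpi -quot_mul_pi. Qed.

HB.instance Definition _ :=
  GRing.isMonoidMorphism.Build A (quot_ring hI) qpi qpi_is_monoid_morphism.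

Lemma qpi_eq0 x : qpi x = 0 <-> I x.
Proof.
rewrite -(rmorph0 qpi); split=> [/eqP|h].
  by rewrite quot_piE subr0 => /asboolP.
by apply/eqP; rewrite quot_piE subr0; apply/asboolP.
Qed.

Lemma qpi_surj z : exists x, qpi x = z.
Proof. by exists (repr z); rewrite /qpi reprK. Qed.

End QuotientMap.

Lemma residue_field (A : comNzRingType) (M : set A) : is_maximal_ideal M ->
  exists (K : fieldType) (pi : {rmorphism A -> K}),
    (forall z, exists x, pi x = z) /\ forall x, pi x = 0 <-> M x.
Proof.
move=> hM; have [hI n1 hmax] := hM.
have nz : (1 : quot_ring hI) != 0.
  by apply/eqP; rewrite -(rmorph1 (qpi hI)) => /qpi_eq0.
pose Qm := GRing.PzSemiRing_isNonZero.Build (quot_ring hI) nz.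
pose Q : comNzRingType := HB.pack (quot_ring hI) Qm.
have /choice[inv hinv] (z : quot_ring hI) : exists w,
    (z = 0 -> w = 0) /\ (z != 0 -> w * z = 1).
  have [->|z0] := eqVneq z 0; first by exists 0.
  have [x Ex] := qpi_surj z.
  have [E|E] := hmax _ (adjoin_is_ideal x hI) (@sub_adjoin _ M x).
    case/eqP: z0; rewrite -Ex; apply/qpi_eq0; rewrite -E; exact: adjoin_self.
  have [c [u [hu E1]]] : adjoin M x 1 by rewrite E.
  exists (qpi hI c); split=> [/eqP|_]; first by rewrite (negbTE z0).
  rewrite -Ex -rmorphM -[RHS](rmorph1 (qpi hI)) E1 rmorphD.
  by rewrite [X in _ = _ + X](_ : _ = 0) ?addr0 //; apply/qpi_eq0.
pose Qf := GRing.ComNzRing_isField.Build Q (fun x h => (hinv x).2 h) ((hinv 0).1 erefl).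
pose K : fieldType := HB.pack (quot_ring hI) Q Qf.
exists K, (qpi hI : {rmorphism A -> K}); split; first exact: qpi_surj.
exact: qpi_eq0.
Qed.

(** * Free algebras over polynomial rings *)

(** Monic polynomials are nonzerodivisors modulo any ideal extended from the coefficients: those of
    V are recovered from the top down. *)
Lemma monic_mul_coef_ideal (A : comNzRingType) (I : set A) (G V : {poly A}) :
  is_ideal I -> G \is monic -> (forall n, I (G * V)`_n) -> forall n, I V`_n.
Proof.
move=> hI Gm h.
suff key N : (forall n, (N <= n)%N -> I V`_n) -> forall n, I V`_n.
  apply: (key (size V)) => n hn; rewrite nth_default //; exact: ideal0.
elim: N => [|N IH] hN; first by move=> n; apply: hN.
apply: IH => n; rewrite leq_eqVlt => /orP[/eqP <-|]; last exact: hN.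
set m := (size G).-1; have sG : (0 < size G)%N by rewrite size_poly_gt0 monic_neq0.
have := h (m + N)%N; rewrite coefM.
have mN : (m < (m + N).+1)%N by rewrite ltnS leq_addr.
rewrite (bigD1 (Ordinal mN)) //= addKn.
have -> : G`_m = 1 by move: Gm; rewrite monicE => /eqP.
rewrite mul1r; apply: idealDr => //; apply: ideal_sum => // i hi.
have [lim|] := ltnP i m.
  by apply: (idealLM hI); apply: hN; move: lim; clear; lia.
rewrite leq_eqVlt => /orP[/eqP E|mi].
  by move: hi; rewrite -val_eqE /= -E eqxx.
rewrite nth_default; first by rewrite mul0r; apply: ideal0.
by rewrite -(prednK sG).
Qed.

Section SeparateVariables.
Variables (F : fieldType) (D : nat) (g : 'I_D -> {poly F}).
Hypothesis g_monic : forall i, g i \is monic.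

Definition poly_in_var (i : 'I_D) : {mpoly F[D]} :=
  (map_poly (@mpolyC D F) (g i)).['X_i].

Section SeparatingMorphism.
Variable tau : 'I_D -> {rmorphism {mpoly F[D]} -> {poly {mpoly F[D]}}}.
Hypothesis tauX : forall v l, tau v 'X_l = if l == v then 'X else ('X_l)%:P.
Hypothesis tauC : forall v c, tau v c%:MP = (c%:MP)%:P.

Let tauE v l (q : {poly F}) : tau v (map_poly (@mpolyC D F) q).['X_l] =
  (map_poly polyC (map_poly (@mpolyC D F) q)).[if l == v then 'X else ('X_l)%:P].
Proof.
rewrite -horner_map /= tauX; congr (_.[_]).
by apply/polyP => n; rewrite !coef_map /= tauC.
Qed.

Let tau_same v : tau v (poly_in_var v) = map_poly (@mpolyC D F) (g v).
Proof. by rewrite /poly_in_var tauE eqxx; exact: comp_polyXr. Qed.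

Let tau_other v l : l != v -> tau v (poly_in_var l) = (poly_in_var l)%:P.
Proof. by move=> ne; rewrite /poly_in_var tauE (negbTE ne) horner_map. Qed.

Let tauK v u : (tau v u).['X_v] = u.
Proof.
elim/mpolyind: u => [|c m u _ _ IH]; first by rewrite rmorph0 horner0.
rewrite (rmorphD (tau v)) hornerD; congr (_ + _); last exact: IH.
rewrite -mul_mpolyC (rmorphM (tau v)) hornerM tauC hornerC; congr (_ * _).
rewrite mpolyXE_id rmorph_prod horner_prod; apply: eq_bigr => l _.
rewrite rmorphXn horner_exp tauX; case: eqP => [->|_]; by rewrite ?hornerX ?hornerC.
Qed.

(** Through tau v, a polynomial is read in the single variable X_v. Then g_v(X_v) becomes monic
    while the other g_l(X_l) become constants, and evaluation at X_v undoes tau v. *)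
Lemma poly_in_var_regular_of (s : seq 'I_D) (v : 'I_D) (u : {mpoly F[D]}) : v \notin s ->
  ideal_gen [set` map poly_in_var s] (poly_in_var v * u) ->
  ideal_gen [set` map poly_in_var s] u.
Proof.
move=> vs; set I := ideal_gen _; have hI : is_ideal I by apply: ideal_gen_is_ideal.
have coefI t : I t -> forall n, I (tau v t)`_n.
  have hX : is_ideal [set x | forall n, I (tau v x)`_n].
    split=> [n|x y hx hy n|a x hx n]; first by rewrite rmorph0 coef0; apply: (ideal0 hI).
      by rewrite rmorphD coefD; apply: (idealD hI).
    by rewrite rmorphM coefM; apply: (ideal_sum hI) => i _; apply: (idealLM hI).
  apply: (ideal_gen_min hX) => _ /mapP[l hl ->] n.
  rewrite tau_other; last by apply: contraNneq vs => <-.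
  rewrite coefC; case: eqP => _; last exact: (ideal0 hI).
  by apply: sub_ideal_gen; apply: map_f.
move=> /coefI; rewrite rmorphM tau_same => h.
have hu := monic_mul_coef_ideal hI (monic_map _ (g_monic v)) h.
rewrite -(tauK v u) horner_coef; apply: (ideal_sum hI) => i _.
by apply: (idealRM hI).
Qed.

End SeparatingMorphism.

Lemma poly_in_var_regular (s : seq 'I_D) (v : 'I_D) (u : {mpoly F[D]}) : v \notin s ->
  ideal_gen [set` map poly_in_var s] (poly_in_var v * u) ->
  ideal_gen [set` map poly_in_var s] u.
Proof.
pose img v l : {poly {mpoly F[D]}} := if l == v then 'X else ('X_l)%:P.
apply: (@poly_in_var_regular_of (fun v => mmap (polyC \o @mpolyC D F) (img v))) => [w l|w c].
  by rewrite [LHS]mmapX mmap1U.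
exact: mmapC.
Qed.

End SeparateVariables.

Section FreeAlgebra.
Variables (F : finFieldType) (A : comNzRingType) (kap : {rmorphism F -> A}).
Variables (D : nat) (th : 'I_D -> A) (J : finType) (w : J -> A).

Definition pcombine (P : J -> {mpoly F[D]}) : A := \sum_j mmap kap th (P j) * w j.

Let ph : {rmorphism {mpoly F[D]} -> A} := mmap kap th.

Lemma pcombineD P Q : pcombine (fun j => P j + Q j) = pcombine P + pcombine Q.
Proof.
rewrite /pcombine -big_split; apply: eq_bigr => j _ /=.
by rewrite (rmorphD ph) mulrDl.
Qed.

Lemma pcombineM u P : pcombine (fun j => u * P j) = mmap kap th u * pcombine P.
Proof.
rewrite /pcombine mulr_sumr; apply: eq_bigr => j _.
by rewrite (rmorphM ph) mulrA.
Qed.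

Hypothesis pcombine_surj : forall x, exists P, pcombine P = x.
Hypothesis pcombine_inj : forall P, pcombine P = 0 -> forall j, P j = 0.

Let pcombine_uniq P Q : pcombine P = pcombine Q -> forall j, P j = Q j.
Proof.
move=> E j; apply/eqP; rewrite -subr_eq0; apply/eqP.
apply: (pcombine_inj (P := fun j => P j - Q j)).
have -> : (fun j => P j - Q j) = (fun j => P j + (-1) * Q j).
  by apply/funext => l; rewrite mulN1r.
by rewrite pcombineD pcombineM rmorphN1 mulN1r E subrr.
Qed.

Let gens := codom th ++ codom w.

Let itev_image (K : comNzRingType) (pi : {rmorphism A -> K}) (ys : seq K) :
  {subset map pi gens <= ys} ->
  forall x, exists u, itev (pi \o kap : {rmorphism F -> K}) ys u = pi x.
Proof.
move=> hys x; have [P <-] := pcombine_surj x.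
pose im y := exists u, itev (pi \o kap : {rmorphism F -> K}) ys u = pi y.
have im_const c : im (kap c) by apply: itev_const.
have imD y z : im y -> im z -> im (y + z).
  by move=> [a Ea] [b Eb]; exists (a + b); rewrite !rmorphD Ea Eb.
have imM y z : im y -> im z -> im (y * z).
  by move=> [a Ea] [b Eb]; exists (a * b); rewrite !rmorphM Ea Eb.
have im0 : im 0 by exists 0; rewrite !rmorph0.
have im1 : im 1 by exists 1; rewrite !rmorph1.
have im_gen y : y \in gens -> im y by move=> hy; apply: itev_gen; apply/hys/map_f.
apply: (big_ind im) => // j _; apply: (imM); last first.
  by apply: im_gen; rewrite mem_cat codom_f orbT.
apply: (big_ind im) => // m _; apply: (imM) => //.
rewrite /mmap1; apply: (big_ind im) => [||i _]; [exact: im1 | exact: imM |].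
elim: (m i) => [|n IH]; rewrite ?expr0 // exprS; apply: imM => //.
by apply: im_gen; rewrite mem_cat codom_f.
Qed.

Let Fl n := [set x | exists P, pcombine P = x /\ forall j, (msize (P j) <= n)%N].

Let msize_bound (P : J -> {mpoly F[D]}) : exists n, forall j, (msize (P j) <= n)%N.
Proof. by exists (\max_j msize (P j)) => j; apply: leq_bigmax. Qed.

(* Over a finite field the elements of bounded degree are at most #|F|^(C n^D)
   many, which bounds the length of prime chains by counting. *)
Lemma free_algebra_chain_bound C k : @is_prime_chain A C k -> (k <= D)%N.
Proof.
have [P1 E1] := pcombine_surj 1; have [b0 hb0] := msize_bound P1.
apply: (@prime_chain_bound A Fl F kap D #|J| b0).
- move=> b; exists (fun=> 0); rewrite /pcombine; split=> [|j]; last by rewrite msize0.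
  by apply: big1 => j _; rewrite (rmorph0 ph) mul0r.
- move=> b _ _ [P [<- hP]] [Q [<- hQ]]; exists (fun j => P j + Q j).
  rewrite pcombineD; split=> // j; apply: leq_trans (msizeD_le _ _) _.
  by rewrite geq_max (hP j) (hQ j).
- by move=> b b' x hb [P [E hP]]; exists P; split=> // j; apply: leq_trans (hP j) hb.
(* Multiplication by x raises the level by a constant: one more than the largest [msize] among the
   coordinates of the products x w_j. *)
- move=> x; have /choice[Q hQ] : forall j, exists Q, pcombine Q = x * w j by [].
  have /choice[t ht] : forall i, exists n, forall j, (msize (Q j i) <= n)%N.
    by move=> i; apply: msize_bound (fun j => Q j i).
  exists (\max_i t i).+1 => n _ [P [<- hP]].
  exists (fun i => \sum_j P j * Q j i); split=> [|i].
    rewrite /pcombine mulr_sumr.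
    under eq_bigr => i _ do rewrite (rmorph_sum ph) mulr_suml.
    rewrite exchange_big; apply: eq_bigr => j _ /=.
    rewrite mulrCA -hQ /pcombine mulr_sumr; apply: eq_bigr => i _.
    by rewrite (rmorphM ph) mulrA.
  apply: leq_trans (msize_sum _ _ _) _; apply/bigmax_leqP => j _.
  apply: leq_trans (msizeM_le _ _) _.
  have := hP j; have := ht i j; have : (t i <= \max_i t i)%N by apply: leq_bigmax.
  by move=> h1 h2 h3; rewrite addnS ltnS; apply: leq_add h3 (leq_trans h2 h1).
- move=> a; exists (fun j => a%:MP * P1 j); split.
    by rewrite pcombineM E1 mulr1; apply: mmapC.
  by move=> j; rewrite mul_mpolyC; apply: leq_trans (msizeZ_le _ _) (hb0 j).
- move=> n.
  (* All exponents occurring at level n are at most n, so an element is determined by #|J| (n+1)^D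
     scalars. *)
  pose idx (m : 'X_{1..D}) : {ffun 'I_D -> 'I_n.+1} := [ffun i => inord (m i)].
  exists {ffun J * {ffun 'I_D -> 'I_n.+1} -> F}.
  exists (fun t : {ffun J * {ffun 'I_D -> 'I_n.+1} -> F} => pcombine (fun j => \sum_(m : 'X_{1..D < n}) t (j, idx m) *: 'X_[m])).
  split; first by rewrite !card_ffun card_prod card_ffun !card_ord.
  move=> _ [P [<- hP]].
  exists [ffun jf : J * {ffun 'I_D -> 'I_n.+1} => (P jf.1)@_[multinom (jf.2 i : nat) | i < D]].
  congr pcombine; apply/funext => j; rewrite [RHS](mpolywE (hP j)).
  apply: eq_bigr => m _; rewrite ffunE /=; congr (_@__ *: _).
  apply/mnmP => i; rewrite mnmE ffunE inordK // ltnS.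
  apply: leq_trans (ltnW (bmdeg m)); rewrite mdegE (bigD1 i) //=; exact: leq_addr.
Qed.

(* By Zariski's lemma each th i satisfies a monic g_i modulo M; the values
   g_i(th i) then form a regular sequence because A is free over F[th]. *)
Lemma free_algebra_regular_seq M : is_maximal_ideal M -> exists s : seq A,
  [/\ is_regular_seq s, [set` s] `<=` M & size s = D].
Proof.
move=> hM; have [K [pi [pisurj pi0]]] := residue_field hM.
have [hI n1 _] := hM.
have alg i : exists g : {poly F}, g \is monic /\ M (map_poly kap g).[th i].
  have [z|g g0 gx] := @zariski K F (pi \o kap : {rmorphism F -> K}) (pi (th i)) (map pi gens).
    have [x <-] := pisurj z; apply: itev_image => y hy.
    by rewrite inE hy orbT.
  have {}g0 : g != 0 by apply: contraNneq g0 => ->; rewrite rmorph0.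
  exists ((lead_coef g)^-1 *: g); rewrite monicE lead_coefZ mulVf ?lead_coef_eq0 //.
  split=> //; apply/pi0; rewrite -mul_polyC rmorphM /= map_polyC hornerM rmorphM /=.
  rewrite -[X in _ * X](_ : (map_poly (pi \o kap) g).[pi (th i)] = _); last first.
    by rewrite map_poly_comp horner_map.
  by rewrite [X in _ * X]gx mulr0.
have /choice[g hg] := alg.
have gm i : g i \is monic by have [] := hg i.
have phE i : ph (poly_in_var g i) = (map_poly kap (g i)).[th i].
  rewrite /poly_in_var -horner_map /= mmapX mmap1U; congr (_.[_]).
  by apply/polyP => n; rewrite !coef_map /= mmapC.
pose v := map (poly_in_var g) (enum 'I_D).
have sv : size v = D by rewrite size_map size_enum_ord.
have spv : size (map ph v) = D by rewrite size_map.
exists (map ph v); split; last exact: spv.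
  split; last first.
    move=> h; apply: n1; move: h; apply: ideal_gen_min => // _ /= /mapP[_ /mapP[i _ ->] ->].
    by rewrite [ph _]phE; have [] := hg i.
  move=> i; rewrite spv => hi y.
  pose vi := Ordinal hi.
  have -> : (map ph v)`_i = ph (poly_in_var g vi).
    rewrite (nth_map 0) ?sv // (nth_map vi) ?size_enum_ord //.
    by rewrite (_ : nth vi _ i = vi) //; apply: val_inj; rewrite /= nth_enum_ord.
  rewrite -map_take -map_take; set l := take i (enum 'I_D).
  have lv : vi \notin l.
    by rewrite in_take ?mem_enum // index_enum_ord /= ltnn.
  (* Because w is a basis, membership in an ideal generated by elements of F[th] is decided
     coordinatewise. *)
  have coords P : ideal_gen [set` map ph (map (poly_in_var g) l)] (pcombine P) ->
      forall j, ideal_gen [set` map (poly_in_var g) l] (P j).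
    move=> /ideal_gen_seqP[c Ec] j.
    have /choice[Q hQ] : forall k, exists Q, pcombine Q = c k by [].
    rewrite size_map in Ec; set h := map (poly_in_var g) l in Ec *.
    have E : pcombine P = pcombine (fun j => \sum_(k < size h) h`_k * Q k j).
      rewrite Ec /pcombine.
      under [RHS]eq_bigr => i0 _ do rewrite (rmorph_sum ph) mulr_suml.
      rewrite exchange_big; apply: eq_bigr => k _ /=.
      rewrite -hQ (nth_map 0) // mulrC /pcombine mulr_sumr; apply: eq_bigr => i0 _.
      by rewrite (rmorphM ph) mulrA.
    have hh := ideal_gen_is_ideal [set` h].
    rewrite (pcombine_uniq E) /=; apply: (ideal_sum hh) => k _; apply: (idealRM hh).
    by apply: sub_ideal_gen; apply: mem_nth.
  have [P <-] := pcombine_surj y; rewrite -pcombineM => /coords hP.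
  have hG := ideal_gen_is_ideal [set` map ph (map (poly_in_var g) l)].
  apply: (ideal_sum hG) => j _; apply: (idealRM hG).
  have /ideal_gen_seqP[c ->] := poly_in_var_regular gm lv (hP j).
  rewrite (rmorph_sum ph); apply: (ideal_sum hG) => k _; rewrite (rmorphM ph).
  by apply: (idealLM hG); apply: sub_ideal_gen; apply/map_f/mem_nth.
move=> _ /= /mapP[_ /mapP[i _ ->] ->].
by rewrite [ph _]phE; have [] := hg i.
Qed.

Theorem free_algebra_cohen_macaulay : cohen_macaulay A.
Proof.
apply: (@cohen_macaulay_criterion A D).
- have h := @itev_image A idfun gens.
  apply: (noetherian_image (h _)); first by move=> x /mapP[y hy ->].
  by apply: noetherian_itpoly; apply: noetherian_field.
- exact: free_algebra_chain_bound.
- exact: free_algebra_regular_seq.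
Qed.

End FreeAlgebra.

(** * Koszul complexes *)

Section Koszul.
Variable A : comNzRingType.
Implicit Types (I : set A) (b : seq A) (z y w : seq bool -> A) (s : seq bool).

(* A chain of the Koszul complex of b assigns a coefficient to each subset of
   the positions of b, encoded as a bit sequence of length size b. *)
Fixpoint kdiff b z s : A :=
  match b, s with
  | x :: b', c :: s' =>
      if c then - kdiff b' (fun t => z (true :: t)) s'
      else kdiff b' (fun t => z (false :: t)) s' + x * z (true :: s')
  | _, _ => 0
  end.

(** Exterior multiplication on the left by the 1-chain with coefficients a. *)
Fixpoint khomotopy (a : seq A) z s : A :=
  match a, s with
  | x :: a', c :: s' =>
      if c then x * z (false :: s') - khomotopy a' (fun t => z (true :: t)) s'
      else khomotopy a' (fun t => z (false :: t)) s'
  | _, _ => 0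
  end.

Definition kdeg n i z := forall s, z s != 0 -> size s = n /\ count id s = i.

Lemma kdiffD b z y s : kdiff b (fun t => z t + y t) s = kdiff b z s + kdiff b y s.
Proof.
elim: b z y s => [|x b IH] z y [|[] s] /=; rewrite ?addr0 ?IH ?opprD //.
by rewrite mulrDr addrACA.
Qed.

Lemma kdiffZ b a z s : kdiff b (fun t => a * z t) s = a * kdiff b z s.
Proof.
elim: b z s => [|x b IH] z [|[] s] /=; rewrite ?mulr0 ?IH ?mulrN //.
by rewrite mulrDr mulrCA.
Qed.

Lemma kdiffN b z s : kdiff b (fun t => - z t) s = - kdiff b z s.
Proof.
rewrite -mulN1r -kdiffZ.
by congr kdiff; apply/funext => t; rewrite mulN1r.
Qed.

Lemma kdiffB b z y s : kdiff b (fun t => z t - y t) s = kdiff b z s - kdiff b y s.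
Proof. by rewrite kdiffD kdiffN. Qed.

Lemma kdiff0 b s : kdiff b (fun=> 0) s = 0.
Proof.
rewrite -[RHS](mul0r (kdiff b (fun=> 0) s)) -kdiffZ.
by congr kdiff; apply/funext => t; rewrite mul0r.
Qed.

Lemma kdiff_ideal I b z : is_ideal I -> (forall s, I (z s)) -> forall s, I (kdiff b z s).
Proof.
move=> hI; elim: b z => [|x b IH] z hz [|[] s] /=; try exact: ideal0.
  by apply: is_ideal_opp => //; apply: IH.
by apply: idealD => //; [apply: IH | apply: idealLM].
Qed.

Lemma khomotopy_ideal I a z : is_ideal I -> (forall s, I (z s)) ->
  forall s, I (khomotopy a z s).
Proof.
move=> hI; elim: a z => [|x a IH] z hz [|[] s] /=; try exact: ideal0.
  by apply: idealB => //; [apply: idealLM | apply: IH].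
exact: IH.
Qed.

Lemma kdiff_support b z s : kdiff b z s != 0 ->
  exists t, [/\ z t != 0, size t = size s & count id t = (count id s).+1].
Proof.
elim: b z s => [|x b IH] z [|c s] /=; rewrite ?eqxx //; case: c.
  by rewrite oppr_eq0 => /IH[t [h1 h2 h3]]; exists (true :: t); rewrite /= h2 h3.
have [->|h _] := eqVneq (z (true :: s)) 0; last by exists (true :: s).
by rewrite mulr0 addr0 => /IH[t [h1 h2 h3]]; exists (false :: t); rewrite /= h2 h3.
Qed.

Lemma khomotopy_support a z s : khomotopy a z s != 0 ->
  exists t, [/\ z t != 0, size t = size s & count id s = (count id t).+1].
Proof.
elim: a z s => [|x a IH] z [|c s] /=; rewrite ?eqxx //; case: c; last first.
  by move=> /IH[t [h1 h2 h3]]; exists (false :: t); rewrite /= h2 h3.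
have [->|h _] := eqVneq (z (false :: s)) 0; last by exists (false :: s).
rewrite mulr0 sub0r oppr_eq0 => /IH[t [h1 h2 h3]].
by exists (true :: t); rewrite /= h2 h3.
Qed.

Lemma kdiff_deg n b i z : kdeg n i.+1 z -> kdeg n i (kdiff b z).
Proof.
move=> hz s /kdiff_support[t [/hz[s1 c1] st ct]]; split; first by rewrite -st.
by move: ct; rewrite c1 => -[->].
Qed.

Lemma khomotopy_deg n a i z : kdeg n i z -> kdeg n i.+1 (khomotopy a z).
Proof.
by move=> hz s /khomotopy_support[t [/hz[s1 c1] st ct]]; rewrite -st s1 ct c1.
Qed.

Lemma kdiff_deg0 n b z s : kdeg n 0 z -> kdiff b z s = 0.
Proof.
move=> hz; apply/eqP; apply: contraT => /kdiff_support[t [/hz[_ ->]]].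
by [].
Qed.

Lemma kdiffK b z s : kdiff b (kdiff b z) s = 0.
Proof.
elim: b z s => [|x b IH] z [|c s] //=; case: c.
  by rewrite kdiffN opprK IH.
by rewrite kdiffD kdiffZ IH add0r mulrN addrN.
Qed.

Lemma khomotopyD a z y s :
  khomotopy a (fun t => z t + y t) s = khomotopy a z s + khomotopy a y s.
Proof.
elim: a z y s => [|x a IH] z y [|[] s] /=; rewrite ?addr0 ?IH //.
by rewrite mulrDr opprD addrACA.
Qed.

Lemma khomotopyZ a c z s : khomotopy a (fun t => c * z t) s = c * khomotopy a z s.
Proof.
elim: a z s => [|x a IH] z [|[] s] /=; rewrite ?mulr0 ?IH //.
by rewrite mulrBr mulrCA.
Qed.

Lemma khomotopyN a z s : khomotopy a (fun t => - z t) s = - khomotopy a z s.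
Proof.
rewrite -mulN1r -khomotopyZ.
by congr khomotopy; apply/funext => t; rewrite mulN1r.
Qed.

(* The standard homotopy showing that the ideal (b) kills Koszul homology. *)
Lemma kdiff_khomotopy a b z s : size a = size b -> size s = size b ->
  kdiff b (khomotopy a z) s + khomotopy a (kdiff b z) s =
  (\sum_(i < size b) a`_i * b`_i) * z s.
Proof.
elim: b a z s => [|x b IH] [|y a] z [|c s] //= ; first by rewrite big_ord0 mul0r addr0.
move=> [sa] [ss]; rewrite big_ord_recl /= mulrDl; case: c.
  have H : _ = _ * z (true :: s) := IH a (fun t => z (true :: t)) s sa ss.
  by rewrite kdiffB kdiffZ khomotopyN -H; ring.
have H : _ = _ * z (false :: s) := IH a (fun t => z (false :: t)) s sa ss.
by rewrite khomotopyD khomotopyZ -H; ring.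
Qed.

(** Vanishing of the Koszul homology H_i(b; A/I), written with lifts to A so that no quotient module
    has to be formed. *)
Definition kvanish b I i := forall z, kdeg (size b) i z ->
  (forall s, I (kdiff b z s)) ->
  exists2 y, kdeg (size b) i.+1 y & forall s, I (z s - kdiff b y s).

Lemma kvanish_top b I i : is_ideal I -> (size b < i)%N -> kvanish b I i.
Proof.
move=> hI hi z hz _; exists (fun=> 0) => [s|s]; first by rewrite eqxx.
rewrite kdiff0 subr0; have [->|/hz[ss cs]] := eqVneq (z s) 0; first exact: ideal0.
by move: hi; rewrite -ss -cs ltnNge count_size.
Qed.

Lemma kdeg_choice n i (P : seq bool -> A -> Prop) :
  (forall s, exists c, P s c) -> (forall s, ~ (size s = n /\ count id s = i) -> P s 0) ->
  exists2 y, kdeg n i y & forall s, P s (y s).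
Proof.
move=> h1 h0; have /choice[y hy] := h1.
exists (fun s => if (size s == n) && (count id s == i) then y s else 0) => s.
  by case: ifP => [/andP[/eqP -> /eqP ->]|]; rewrite ?eqxx.
case: ifP => // hn; apply: h0 => -[h h']; by rewrite h h' !eqxx in hn.
Qed.

(** In the long exact sequence of multiplication by a on A/I, the element a of (b) acts as zero on
    homology, so the connecting map from H_(i+1)(b; A/(I, a)) onto H_i(b; A/I) is surjective. The
    proof performs this chase on lifts, dividing by a at the end. *)
Lemma kvanish_descend b I a i : is_ideal I -> (forall u : A, I (a * u) -> I u) ->
  ideal_gen [set` b] a -> kvanish b (adjoin I a) i.+1 -> kvanish b I i.
Proof.
move=> hI reg /ideal_gen_seqP[k Ea] van z hz cz.
pose al := mkseq k (size b).
have sal : size al = size b by rewrite size_mkseq.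
have Ea' : a = \sum_(j < size b) al`_j * b`_j.
  by rewrite Ea; apply: eq_bigr => j _; rewrite nth_mkseq.
pose w := khomotopy al z.
have hw : kdeg (size b) i.+1 w by apply: khomotopy_deg.
have Iw s : I (a * z s - kdiff b w s).
  have [ss|ss] := eqVneq (size s) (size b).
    rewrite Ea' -(kdiff_khomotopy _ sal ss) addrAC subrr add0r.
    exact: khomotopy_ideal.
  have -> : z s = 0 by apply: contraNeq ss => /hz[->].
  have -> : kdiff b w s = 0 by apply: contraNeq ss => /(kdiff_deg hw)[->].
  by rewrite mulr0 subr0; apply: ideal0.
have [s|v hv Ev] := van w hw.
  exists (z s), (kdiff b w s - a * z s); split; last by ring.
  by rewrite -opprB; apply: is_ideal_opp.
have [s|s hs|y hy Ey] := @kdeg_choice (size b) i.+1 (fun s c => I (w s - kdiff b v s - a * c)).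
- by have [c [u [hu E]]] := Ev s; exists c; rewrite E mulrC addrAC subrr add0r.
- have -> : w s = 0 by apply/eqP; apply: contraT => /hw /hs.
  have -> : kdiff b v s = 0 by apply/eqP; apply: contraT => /(kdiff_deg hv) /hs.
  by rewrite mulr0 !subr0; apply: ideal0.
exists y => // s; apply: reg; rewrite mulrBr -kdiffZ.
have := kdiff_ideal b hI Ey s; rewrite !kdiffB kdiffK subr0 => h.
have -> : forall X : A, a * z s - X = (a * z s - kdiff b w s) + (kdiff b w s - X).
  by move=> X; ring.
exact: idealD.
Qed.

(** The other part of the same sequence: H_(i+1)(b; A/(I, a)) sits between H_(i+1)(b; A/I) and
    H_i(b; A/I). *)
Lemma kvanish_quotient b I a i : is_ideal I -> (forall u : A, I (a * u) -> I u) ->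
  kvanish b I i.+1 -> kvanish b I i -> kvanish b (adjoin I a) i.+1.
Proof.
move=> hI reg van1 van0 z hz cz.
have [s|s hs|z' hz' Ez'] := @kdeg_choice (size b) i (fun s c => I (kdiff b z s - a * c)).
- by have [c [u [hu E]]] := cz s; exists c; rewrite E mulrC addrAC subrr add0r.
- have -> : kdiff b z s = 0 by apply/eqP; apply: contraT => /(kdiff_deg hz) /hs.
  by rewrite mulr0 subr0; apply: ideal0.
have [s|y hy Ey] := van0 z' hz'.
  apply: reg; have := kdiff_ideal b hI Ez' s; rewrite kdiffB kdiffK kdiffZ sub0r.
  by move/(is_ideal_opp hI); rewrite opprK.
have [|s|v hv Ev] := van1 (fun s => z s - a * y s).
- move=> s; have [->|/hy[-> ->]//] := eqVneq (y s) 0; rewrite mulr0 subr0; exact: hz.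
- rewrite kdiffB kdiffZ.
  have -> : kdiff b z s - a * kdiff b y s =
    (kdiff b z s - a * z' s) + a * (z' s - kdiff b y s) by ring.
  by apply: idealD => //; apply: idealLM.
exists v => // s; exists (y s), (z s - a * y s - kdiff b v s); split=> //; ring.
Qed.

(* a is a regular sequence read from its last element to its first. *)
Fixpoint rev_regular (a : seq A) : Prop :=
  if a is x :: a' then
    (forall u : A, ideal_gen [set` a'] (x * u) -> ideal_gen [set` a'] u) /\ rev_regular a'
  else True.

(** Depth sensitivity of the Koszul complex: H_i(b; A/(a)) vanishes trivially for i > size b, and
    each element removed from a extends the vanishing by one degree downwards. *)
Lemma kvanish_acyclic b a : rev_regular a ->
  (forall x, x \in a -> ideal_gen [set` b] x) -> size a = size b ->
  forall i, (0 < i)%N -> kvanish b (ideal_gen [set` [::]]) i.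
Proof.
move=> rega ab sab.
have : forall i, (size a < i)%N -> kvanish b (ideal_gen [set` a]) i.
  by rewrite sab => i; apply: kvanish_top; apply: ideal_gen_is_ideal.
elim: a rega ab {sab} => [|x a IH] //= [regx rega] ab hi; apply: IH => //.
  by move=> y hy; apply: ab; rewrite inE hy orbT.
move=> i ia; apply: (@kvanish_descend _ _ x) => //.
- exact: ideal_gen_is_ideal.
- by apply: ab; rewrite inE eqxx.
- by rewrite -ideal_gen_cons; apply: hi.
Qed.

(** In the opposite direction, each regular element divided out costs one degree of vanishing. *)
Lemma kvanish_mod_regular b a : rev_regular a ->
  (forall i, (0 < i)%N -> kvanish b (ideal_gen [set` [::]]) i) ->
  forall i, (size a < i)%N -> kvanish b (ideal_gen [set` a]) i.
Proof.
elim: a => [|x a IH] //= [regx rega] van [|i] // ia.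
rewrite ideal_gen_cons; apply: kvanish_quotient => //.
- exact: ideal_gen_is_ideal.
- by apply: IH => //; apply: ltnW.
- exact: IH.
Qed.

End Koszul.

(** * Graded pieces of Koszul chains *)

Section GradedPieces.
Variables (F : fieldType) (n : nat).
Implicit Types (x y u : {mpoly F[n]}) (t : int) (m : 'X_{1..n}).

(* Degrees are integers so that shifts by subtraction do not truncate. *)
Definition hc t x : {mpoly F[n]} := if t is Posz k then pihomog mdeg k x else 0.

Lemma hcB t x y : hc t (x - y) = hc t x - hc t y.
Proof. by case: t => k /=; rewrite ?subr0 ?pihomogB. Qed.

Lemma hcD t x y : hc t (x + y) = hc t x + hc t y.
Proof. by case: t => k /=; rewrite ?addr0 ?pihomogD. Qed.

Lemma hc0 t : hc t 0 = 0.
Proof. by case: t => k //=; rewrite pihomog0. Qed.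

Lemma hcN t x : hc t (- x) = - hc t x.
Proof. by rewrite -sub0r hcB hc0 sub0r. Qed.

Lemma hc_sum t (I : Type) (s : seq I) (P : pred I) (G : I -> {mpoly F[n]}) :
  hc t (\sum_(i <- s | P i) G i) = \sum_(i <- s | P i) hc t (G i).
Proof. by apply: (big_morph (hc t)); [apply: hcD | apply: hc0]. Qed.

Lemma hc_id t x : hc t (hc t x) = hc t x.
Proof. by case: t => k //=; rewrite pihomog_id. Qed.

Lemma hc_homog (k : nat) x : x \is k.-homog -> hc k x = x.
Proof. exact: pihomog_dE. Qed.

Lemma hc_homog_ne (k : nat) t x : x \is k.-homog -> t != k -> hc t x = 0.
Proof.
case: t => // l hx ne /=; apply: pihomog_ne0 hx.
by apply: contraNneq ne => ->.
Qed.

Lemma hc_partition x : x = \sum_(k < msize x) hc (k : nat) x.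
Proof. exact: pihomog_partitionE. Qed.

Lemma hc_mul (d : nat) t x y : x \is d.-homog -> hc t (x * y) = x * hc (t - d%:Z) y.
Proof.
move=> hx; have := hc_partition y; move: (msize y) => K Ey.
rewrite [in LHS]Ey [in RHS]Ey mulr_sumr !hc_sum mulr_sumr.
apply: eq_bigr => k _; set z := hc _ y.
have hz : z \is (k : nat).-homog by apply: pihomogP.
have hxz := dhomogM hx hz.
have [->|ne] := eqVneq t (d + k)%N.
  by rewrite hc_homog // PoszD addrC addKr hc_homog.
rewrite (hc_homog_ne hxz) // (hc_homog_ne hz) ?mulr0 //.
by apply: contraNneq ne => E; rewrite PoszD -E addrC subrK.
Qed.

Lemma hc_ideal_gen (th : seq {mpoly F[n]}) t x :
  (forall y, y \in th -> exists d : nat, y \is d.-homog) ->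
  ideal_gen [set` th] x -> ideal_gen [set` th] (hc t x).
Proof.
move=> hth /ideal_gen_seqP[c ->]; rewrite hc_sum.
have hI := ideal_gen_is_ideal [set` th].
apply: (ideal_sum hI) => i _; have hi := mem_nth 0 (ltn_ord i).
have [d hd] := hth _ hi; rewrite mulrC (hc_mul _ _ hd).
by apply: (idealRM hI); apply: sub_ideal_gen.
Qed.

Fixpoint kweight (ds : seq nat) (s : seq bool) : nat :=
  match ds, s with
  | d :: ds', c :: s' => ((if c then d else 0) + kweight ds' s')%N
  | _, _ => 0%N
  end.

(** The component of total degree t, when the basis vector at position i carries the degree ds_i of
    the i-th element; with this grading [kdiff] preserves degrees. *)
Definition kpr t ds (z : seq bool -> {mpoly F[n]}) s := hc (t - (kweight ds s)%:Z) (z s).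

Definition homog_seq (th : seq {mpoly F[n]}) (ds : seq nat) :=
  size ds = size th /\ forall i, (i < size th)%N -> th`_i \is (nth 0%N ds i).-homog.

Lemma homog_seq_cons x th ds : homog_seq (x :: th) ds ->
  exists d ds', [/\ ds = d :: ds', x \is d.-homog & homog_seq th ds'].
Proof.
case: ds => [|d ds] [//= [sz] h]; exists d, ds; split=> //; first exact: (h 0%N isT).
by split=> // i hi; apply: (h i.+1).
Qed.

Lemma homog_seq_mem th ds : homog_seq th ds ->
  forall y, y \in th -> exists d : nat, y \is d.-homog.
Proof. by move=> [_ h] y /(nthP 0)[i hi <-]; eexists; apply: h. Qed.

Lemma kpr_kdiff b ds t z s : homog_seq b ds ->
  hc (t - (kweight ds s)%:Z) (kdiff b z s) = kdiff b (kpr t ds z) s.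
Proof.
elim: b ds t z s => [|x b IH] ds t z s; first by rewrite /= hc0.
move=> /homog_seq_cons[d [ds' [-> hx hb]]]; case: s => [|[] s]; rewrite /= ?hc0 //.
  rewrite hcN PoszD opprD addrA IH //; congr (- kdiff _ _ _).
  by apply/funext => u; rewrite /kpr /= PoszD opprD addrA.
rewrite add0n hcD IH // (hc_mul _ _ hx); congr (_ + _ * _).
by rewrite /kpr /= PoszD opprD addrCA addrC addrAC.
Qed.

Lemma kpr_deg N i t ds z : kdeg N i z -> kdeg N i (kpr t ds z).
Proof. by move=> hz s h; apply: hz; apply: contraNneq h => E; rewrite /kpr E hc0. Qed.

Lemma hc_shift_sum (w T : nat) x : (w + msize x <= T)%N ->
  \sum_(t < T) hc ((t : nat)%:Z - w%:Z) x = x.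
Proof.
move=> hT; have wT : (w <= T)%N by apply: leq_trans hT; apply: leq_addr.
rewrite -(subnKC wT) big_split_ord /= big1 ?add0r => [|t _].
  under eq_bigr => t _ do rewrite PoszD addrAC subrr add0r.
  by rewrite -pihomog_partitionE // leq_subRL.
have : (t : nat)%:Z - w%:Z < 0 by rewrite subr_lt0 ltz_nat.
by case: (_ - _).
Qed.

Lemma kpr_partition N i ds z : kdeg N i z ->
  exists T : nat, forall s, z s = \sum_(t < T) kpr (t : nat) ds z s.
Proof.
move=> hz; pose T := (\max_(s : N.-tuple bool) (kweight ds s + msize (z s)))%N.
exists T => s; have [E|zs] := eqVneq (z s) 0.
  by rewrite big1 // => t _; rewrite /kpr E hc0.
have [/eqP ss _] := hz s zs.
rewrite /kpr hc_shift_sum //.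
exact: (@leq_bigmax _ (fun s : N.-tuple bool => (kweight ds s + msize (z s))%N) (Tuple ss)).
Qed.

End GradedPieces.

Section KoszulBoundary.
Variable A : comNzRingType.
Implicit Types (b : seq A) (z y : seq bool -> A).

Lemma kdiff_in_gen b z s : ideal_gen [set` b] (kdiff b z s).
Proof.
have hI c := ideal_gen_is_ideal [set` c : seq A].
elim: b z s => [|x b IH] z [|c s] /=; try exact: (ideal0 (hI _)).
have sub v : ideal_gen [set` b] v -> ideal_gen [set` x :: b] v.
  by rewrite ideal_gen_cons; apply: sub_adjoin.
case: c; first by apply: (is_ideal_opp (hI _)); apply: sub.
apply: (idealD (hI _)); first exact: sub.
by apply: (idealRM (hI _)); apply: sub_ideal_gen; rewrite /= inE eqxx.
Qed.

Lemma kdeg_delta n0 i (s0 : seq bool) (a : A) : size s0 = n0 -> count id s0 = i ->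
  kdeg n0 i (fun s => if s == s0 then a else 0).
Proof. by move=> h1 h2 s; case: (s =P s0) => [-> _|]; rewrite ?eqxx. Qed.

Lemma kdiff_preimage b x : ideal_gen [set` b] x ->
  exists2 y, kdeg (size b) 1 y & kdiff b y (nseq (size b) false) = x.
Proof.
move=> /ideal_gen_seqP[c ->].
pose z (s : seq bool) : A := if s == nseq (size b) false then 1 else 0.
have hz : kdeg (size b) 0 z.
  by apply: kdeg_delta; rewrite ?size_nseq // count_nseq.
pose a := mkseq c (size b); exists (khomotopy a z); first exact: khomotopy_deg.
have := @kdiff_khomotopy _ a b z (nseq (size b) false).
rewrite size_mkseq size_nseq => /(_ erefl erefl).
have -> : kdiff b z = fun=> 0 by apply/funext => s; apply: kdiff_deg0 hz.
have -> : khomotopy a (fun=> 0) (nseq (size b) false) = 0.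
  by apply: (@khomotopy_ideal _ [set 0] a _ (@set0_is_ideal A)).
rewrite addr0 => ->; rewrite /z eqxx mulr1.
by apply: eq_bigr => i _; rewrite nth_mkseq.
Qed.

Lemma kdeg0_support N z s : kdeg N 0 z -> s != nseq N false -> z s = 0.
Proof.
move=> hz ne; apply: contraNeq ne => /hz[<-].
by elim: s => [|[] s IH] //= /IH {1}->.
Qed.

(** A relation x u in (b) is a 1-cycle with entry -u at the position of x. If it is a boundary, that
    entry lies in (b). *)
Lemma kvanish1_regular x b : kvanish (x :: b) [set 0] 1 ->
  forall u, ideal_gen [set` b] (x * u) -> ideal_gen [set` b] u.
Proof.
move=> van u /kdiff_preimage[y hy Ey].
pose z s := match s with
  | true :: s' => if s' == nseq (size b) false then - u else 0
  | false :: s' => y s' | [::] => 0 end.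
have [|s|W hW EW] := van z.
- case=> [|[] s] /=; first by rewrite eqxx.
    by case: (s =P _) => [-> _|]; rewrite ?eqxx // size_nseq count_nseq.
  by move=> /hy[-> ->].
- have del := @kdeg_delta (size b) 0 (nseq (size b) false) (- u) (size_nseq _ _).
  case: s => [|[] s] //=.
    by rewrite (kdiff_deg0 _ _ (del _)) ?oppr0 // count_nseq.
  case: (s =P _) => [->|/eqP ne]; first by rewrite Ey mulrN subrr.
  rewrite mulr0 addr0.
  by apply: kdeg0_support ne; apply: kdiff_deg.
have := EW (true :: nseq (size b) false); rewrite /= eqxx => /eqP.
rewrite opprK addrC subr_eq0 => /eqP <-; exact: kdiff_in_gen.
Qed.

End KoszulBoundary.

(** * Homogeneous regular sequences and the degree of the socle *)

Section HomogeneousRegular.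
Variables (F : fieldType) (n : nat).
Implicit Types (x u : {mpoly F[n]}) (t : int) (th b : seq {mpoly F[n]}).

(* Nakayama's lemma for the graded module of cycles: a cycle of b is, up to a
   boundary, x times a cycle of lower degree. *)
Lemma kvanish1_tail x b d ds : (0 < d)%N -> x \is d.-homog -> homog_seq b ds ->
  kvanish (x :: b) [set 0] 1 -> kvanish b [set 0] 1.
Proof.
move=> d0 hx hb van.
have step z : kdeg (size b) 1 z -> (forall s, kdiff b z s = 0) ->
    exists y v, [/\ kdeg (size b) 2 y, kdeg (size b) 1 v,
      (forall s, kdiff b v s = 0) & forall s, z s = kdiff b y s + x * v s].
  move=> hz cz; pose Z s := match s with
    | true :: s' => 0 | false :: s' => z s' | [::] => 0 end.
  have [|s|W hW EW] := van Z.
  - case=> [|[] s] /=; rewrite ?eqxx //.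
    by move=> /hz[-> ->].
  - case: s => [|[] s] //=; first by rewrite kdiff0 oppr0.
    by rewrite cz mulr0 addr0.
  exists (fun s => W (false :: s)), (fun s => W (true :: s)); split.
  - by move=> s /hW /= [[->]]; rewrite add0n => ->.
  - by move=> s /hW /= [[->]]; rewrite add1n => -[->].
  - by move=> s; have /= := EW (true :: s); rewrite sub0r opprK.
  - by move=> s; have /eqP := EW (false :: s); rewrite subr_eq0 /= => /eqP.
(* Each use of [step] lowers the total degree by d > 0, and components of negative degree are zero,
   so finitely many uses suffice. *)
have graded N : forall z, kdeg (size b) 1 z -> (forall s, kdiff b z s = 0) ->
    forall t, t < N%:Z -> exists2 y, kdeg (size b) 2 y & forall s, kpr t ds z s = kdiff b y s.
  elim: N => [|N IH] z hz cz t tN.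
    exists (fun=> 0) => [s|s]; first by rewrite eqxx.
    rewrite kdiff0 /kpr; have : t - (kweight ds s)%:Z < 0 by move: tN; clear; lia.
    by case: (t - _).
  have [y [v [hy hv cv E]]] := step z hz cz.
  have [|y' hy' E'] := IH v hv cv (t - d%:Z); first by move: tN d0; clear; lia.
  exists (fun s => kpr t ds y s + x * y' s).
    move=> s; have [->|h _] := eqVneq (y' s) 0; last exact: hy'.
    by rewrite mulr0 addr0; apply: kpr_deg.
  move=> s; rewrite kdiffD kdiffZ -E' -(kpr_kdiff _ _ _ hb) /kpr E hcD.
  congr (_ + _); rewrite (hc_mul _ _ hx); congr (_ * hc _ _).
  by move: (kweight _ _) => w; clear; lia.
move=> z hz cz; have [T ET] := kpr_partition ds hz.
have /choice[Y hY] : forall t : nat, exists y, kdeg (size b) 2 y /\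
    forall s, kpr t ds z s = kdiff b y s.
  by move=> t; have [|y h1 h2] := graded t.+1 z hz cz t; [lia | exists y].
exists (fun s => \sum_(t < T) Y t s).
  move=> s h; have [t ht] : exists t : 'I_T, Y t s != 0.
    apply: contrapT => no; case/eqP: h; apply: big1 => t _.
    by apply: contrapT => /eqP ht; apply: no; exists t.
  by have [h1 _] := hY t; apply: h1.
move=> s; rewrite ET; apply/eqP; rewrite subr_eq0; apply/eqP.
have -> : kdiff b (fun s => \sum_(t < T) Y t s) s = \sum_(t < T) kdiff b (Y t) s.
  elim: T {ET} => [|T IH].
    by rewrite big_ord0 -[RHS](kdiff0 b s); congr kdiff; apply/funext => u; rewrite big_ord0.
  rewrite big_ord_recr /= -IH -kdiffD; congr kdiff.
  by apply/funext => u; rewrite big_ord_recr.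
by apply: eq_bigr => t _; have [_ ->] := hY t.
Qed.

Lemma regular_of_kvanish1 b ds : homog_seq b ds -> all (leq 1) ds ->
  kvanish b [set 0] 1 -> rev_regular b.
Proof.
elim: b ds => [|x b IH] ds //= /homog_seq_cons[d [ds' [-> hx hb]]] /= /andP[d0 hd] van.
split; first exact: kvanish1_regular.
by apply: (IH _ hb hd); apply: (kvanish1_tail d0 hx hb van).
Qed.

Section Monomials.
Variable N : 'I_n -> nat.

Lemma ideal_gen_monomials (l : seq 'I_n) u :
  ideal_gen [set` [seq 'X_i ^+ N i | i <- l]] u <->
  forall m, u@_m != 0 -> exists2 i, i \in l & (N i <= m i)%N.
Proof.
set I := ideal_gen _; have hI : is_ideal I by apply: ideal_gen_is_ideal.
split=> [Iu|h].
  pose C := [set u : {mpoly F[n]} |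
    forall m, u@_m != 0 -> exists2 i, i \in l & (N i <= m i)%N].
  have hC : is_ideal C.
    split=> [m|x y hx hy m|a x hx m] /=; first by rewrite mcoeff0 eqxx.
      rewrite mcoeffD => hm; have [E|] := eqVneq (x@_m) 0; last exact: hx.
      by apply: hy; rewrite E add0r in hm.
    rewrite -mcoeff_msupp => /msuppM_le/allpairsP[[m1 m2] /= [_ h2 ->]].
    have [|i il hi] := hx m2; first by rewrite -mcoeff_msupp.
    by exists i => //; rewrite mnmDE; apply: leq_trans hi (leq_addl _ _).
  have : C u; last by []; move: u Iu; apply: ideal_gen_min => // _ /mapP[i il ->] m.
  rewrite mpolyXn mcoeffX; have [<- _|_] := eqVneq (U_(i) *+ N i)%MM m; last by rewrite eqxx.
  by exists i => //; rewrite mulmnE mnm1E eqxx mul1n.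
rewrite [u]mpolyE big_seq; apply: (ideal_sum hI) => m.
rewrite mcoeff_msupp => /h[i il hi].
have le : (U_(i) *+ N i <= m)%MM.
  by apply/mnm_lepP => k; rewrite mulmnE mnm1E; case: eqP => [<-|_]; rewrite ?mul1n.
rewrite -(submK le) mpolyXD scalerAl; apply: (idealLM hI); apply: sub_ideal_gen.
by rewrite -mpolyXn; apply: (map_f (fun i => 'X_i ^+ N i)).
Qed.

Lemma rev_regular_monomials (l : seq 'I_n) : uniq l ->
  rev_regular [seq 'X_i ^+ N i : {mpoly F[n]} | i <- l].
Proof.
elim: l => [|v l IH] //= /andP[vl ul]; split; last exact: IH.
move=> u /ideal_gen_monomials h; apply/ideal_gen_monomials => m hm.
have [|i il hi] := h (U_(v) *+ N v + m)%MM.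
  by rewrite mpolyXn [_ * u]mulrC mcoeffMX.
exists i => //; move: hi; rewrite mnmDE mulmnE mnm1E.
by case: eqP => [E|_]; [move: vl; rewrite E il | rewrite mul0n add0n].
Qed.

End Monomials.

Definition xvars : seq {mpoly F[n]} := [seq 'X_i | i <- enum 'I_n].

Lemma size_xvars : size xvars = n.
Proof. by rewrite size_map size_enum_ord. Qed.

Lemma homog_xvars : homog_seq xvars (nseq n 1%N).
Proof.
split=> [|i]; rewrite size_xvars ?size_nseq // => hi.
by rewrite nth_nseq hi (nth_map (Ordinal hi)) ?size_enum_ord // dhomogX /= mdeg1.
Qed.

(** The powers of the variables in (th) form a regular sequence of the same length, which makes the
    Koszul complex of th acyclic. For homogeneous elements of positive degree, vanishing of H_1
    gives regularity back. No dimension theory enters. *)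
Theorem hsop_regular th ds : homog_seq th ds -> all (leq 1) ds -> size th = n ->
  (forall i, exists N, ideal_gen [set` th] ('X_i ^+ N)) -> rev_regular th.
Proof.
move=> hth hds sth /choice[N hN]; apply: regular_of_kvanish1 hth hds _.
rewrite -ideal_gen_nil; apply: (@kvanish_acyclic _ th [seq 'X_i ^+ N i | i <- enum 'I_n]) => //.
- by apply: rev_regular_monomials; apply: enum_uniq.
- by move=> _ /mapP[i _ ->].
- by rewrite size_map size_enum_ord.
Qed.

Lemma kvanish_xvars i : (0 < i)%N -> kvanish xvars (ideal_gen [set` [::]]) i.
Proof.
apply: (@kvanish_acyclic _ xvars xvars) => //; last by move=> x hx; apply: (sub_ideal_gen (hx : [set` xvars] x)).
have := @rev_regular_monomials (fun=> 1%N) (enum 'I_n) (enum_uniq _).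
by congr rev_regular; apply: eq_map => k; rewrite expr1.
Qed.

Lemma homog_in_xvars t u : hc t u = u -> t != 0 -> ideal_gen [set` xvars] u.
Proof.
move=> E t0; have -> : xvars = [seq 'X_i ^+ 1 | i <- enum 'I_n] by [].
apply/ideal_gen_monomials => m hm.
have [i hi] : exists i, m i != 0%N.
  apply: contrapT => no; case: t t0 E => [[|k]|k] // _ E; last first.
    by move: hm; rewrite -E mcoeff0 eqxx.
  have /dhomogP/(_ m) : u \is k.+1.-homog by rewrite -E; apply: pihomogP.
  rewrite mcoeff_msupp hm => /(_ isT) /=; rewrite mdegE big1 // => i _.
  by apply: contrapT => /eqP h; apply: no; exists i.
by exists i; rewrite ?mem_enum // lt0n.
Qed.

(** Connecting maps, one for each element of th, carry a class in H_k(x; S/(th)), k = size th, to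
    H_0(x; S) = F, lowering the total degree by the sum of [es]. As F sits in degree 0, only classes
    of total degree [sumn es] can survive. *)
Lemma graded_snake th es z t : homog_seq th es -> rev_regular th ->
  kdeg n (size th) z -> kpr t (nseq n 1%N) z = z ->
  (forall s, ideal_gen [set` th] (kdiff xvars z s)) -> t != (sumn es)%:Z ->
  exists2 y, kdeg n (size th).+1 y & forall s, ideal_gen [set` th] (z s - kdiff xvars y s).
Proof.
elim: th es z t => [|a th IH] es z t.
  case: es => [|e0 es]; [move=> _ _ hz Ez _ t0 | by case].
  have : ideal_gen [set` xvars] (z (nseq n false)).
    apply: (@homog_in_xvars t) => //; rewrite -[in RHS]Ez /kpr.
    by rewrite (_ : kweight _ _ = 0%N) ?subr0 //; elim: (n) => //= k ->.
  move=> /kdiff_preimage; rewrite size_xvars => -[y hy Ey].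
  exists y => // s; rewrite ideal_gen_nil /=; have [->|ne] := eqVneq s (nseq n false).
    by rewrite Ey subrr.
  by rewrite (kdeg0_support hz ne) (kdeg0_support (kdiff_deg hy) ne) subrr.
move=> /homog_seq_cons[d [es' [-> ha hth]]] /= [rega regth] hz Ez cz tne.
set I := ideal_gen [set` th]; have hI : is_ideal I by apply: ideal_gen_is_ideal.
have van := kvanish_mod_regular regth kvanish_xvars.
rewrite ideal_gen_cons in cz *.
(* The quotient of the boundary of z by a is chosen homogeneous, by keeping one graded component of
   each coefficient. *)
have [s|s hs|z' hz' Ez'] := @kdeg_choice _ n (size th) (fun s c => I (kdiff xvars z s - a * c) /\
    hc (t - d%:Z - (kweight (nseq n 1%N) s)%:Z) c = c).
- have [c [u [hu E]]] := cz s.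
  exists (hc (t - d%:Z - (kweight (nseq n 1%N) s)%:Z) c); rewrite hc_id; split=> //.
  have := hc_ideal_gen (t - (kweight (nseq n 1%N) s)%:Z) (homog_seq_mem hth) hu.
  have -> : u = kdiff xvars z s - a * c by rewrite E mulrC addrAC subrr add0r.
  rewrite hcB (hc_mul _ _ ha) (kpr_kdiff _ _ _ homog_xvars) Ez.
  by rewrite addrAC.
- have -> : kdiff xvars z s = 0 by apply/eqP; apply: contraT => /(kdiff_deg hz) /hs.
  by rewrite mulr0 subr0 hc0; split=> //; apply: (ideal0 hI).
have cz' s : I (kdiff xvars z' s).
  apply: rega; have := kdiff_ideal xvars hI (fun s => (Ez' s).1) s.
  rewrite kdiffB kdiffK kdiffZ sub0r.
  by move/(is_ideal_opp hI); rewrite opprK.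
have [||y hy Ey] := IH es' z' (t - d%:Z) hth regth hz' _ cz'.
- by apply/funext => s; rewrite /kpr; have [_ ->] := Ez' s.
- by apply: contraNneq tne => E; rewrite PoszD -E addrC subrK.
have [|s|v hv Ev] := van (size th).+1 (ltnSn _) (fun s => z s - a * y s).
- move=> s; rewrite size_xvars; have [->|/hy//] := eqVneq (y s) 0.
  rewrite mulr0 subr0; exact: hz.
- rewrite kdiffB kdiffZ.
  have -> : kdiff xvars z s - a * kdiff xvars y s =
    (kdiff xvars z s - a * z' s) + a * (z' s - kdiff xvars y s) by ring.
  by apply: (idealD hI); [exact: (Ez' s).1 | apply: (idealLM hI); exact: Ey].
rewrite size_xvars in hv.
exists v => // s; exists (y s), (z s - a * y s - kdiff xvars v s); split=> //; ring.
Qed.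

(** A socle element placed on the top basis vector is an n-cycle modulo (th) of total degree D + n,
    and there are no chains of degree n + 1 left to bound it. *)
Theorem socle_degree th es (D : nat) u : homog_seq th es -> rev_regular th -> size th = n ->
  u \is D.-homog -> (forall i, ideal_gen [set` th] ('X_i * u)) ->
  (D + n)%N != sumn es -> ideal_gen [set` th] u.
Proof.
move=> hth reg sth hu soc ne.
pose z (s : seq bool) := if s == nseq n true then u else 0.
have hz : kdeg n n z by apply: kdeg_delta; rewrite ?size_nseq // count_nseq mul1n.
have cyc s : ideal_gen [set` th] (kdiff xvars z s).
  have hI := ideal_gen_is_ideal [set` th].
  have : forall x, x \in xvars -> forall s, ideal_gen [set` th] (x * z s).
    move=> _ /mapP[i _ ->] s'; rewrite /z; case: eqP => _ //.
    by rewrite mulr0; apply: (ideal0 hI).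
  elim: (xvars) (z) s => [|x b IH] y [|c s] hy; try exact: (ideal0 hI).
  have hb c' : forall x, x \in b -> forall s, ideal_gen [set` th] (x * y (c' :: s)).
    by move=> x' hx' s'; apply: hy; rewrite inE hx' orbT.
  rewrite /=; case: c; first by apply: (is_ideal_opp hI); apply: IH (hb true).
  apply: (idealD hI); first by apply: IH (hb false).
  by apply: hy; rewrite inE eqxx.
have [||||y hy Ey] := @graded_snake th es z (D + n)%N hth reg.
- by rewrite sth.
- apply/funext => s; rewrite /kpr /z; case: eqP => [->|_]; last by rewrite hc0.
  rewrite (_ : kweight _ _ = n); first by rewrite PoszD addrK hc_homog.
  by elim: (n) => //= k ->.
- exact: cyc.
- by [].
have := Ey (nseq n true); rewrite {1}/z eqxx.
have -> : y = fun=> 0.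
  apply/funext => s; apply/eqP; apply: contraT => /hy[ss cs].
  by have := count_size id s; rewrite ss cs sth ltnn.
by rewrite kdiff0 subr0.
Qed.

End HomogeneousRegular.

(** * Monomials and the Cartier operator *)

Section MonomialCoefficients.
Variables (R : comNzRingType) (n : nat).
Implicit Types (u v : {mpoly R[n]}) (m h : 'X_{1..n}).

Lemma mcoeffXM h m u : ('X_[h] * u)@_m = if (h <= m)%MM then u@_(m - h)%MM else 0.
Proof.
case: ifP => hm.
  by rewrite mulrC -{1}(submK hm) addmC mcoeffMX.
apply/eqP; rewrite mcoeff_eq0; apply/negP => /msuppM_le/allpairsP[[m1 m2] /= [h1 _ E]].
move: h1; rewrite msuppX inE => /eqP E1; rewrite E E1 lem_addr in hm; discriminate.
Qed.

Lemma mcoeffM_support u v m : (u * v)@_m != 0 ->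
  exists m1 m2, [/\ u@_m1 != 0, v@_m2 != 0 & m = (m1 + m2)%MM].
Proof.
rewrite -mcoeff_msupp => /msuppM_le/allpairsP[[m1 m2] /= [h1 h2 ->]].
by exists m1, m2; rewrite -!mcoeff_msupp.
Qed.

Lemma mpoly_rmorph_ext (B : pzSemiRingType) (f1 f2 : {rmorphism {mpoly R[n]} -> B}) :
  (forall c, f1 c%:MP = f2 c%:MP) -> (forall i, f1 'X_i = f2 'X_i) -> f1 =1 f2.
Proof.
move=> hC hX u; elim/mpolyind: u => [|c m u _ _ IH]; first by rewrite !rmorph0.
rewrite !rmorphD IH -mul_mpolyC !rmorphM hC mpolyXE_id !rmorph_prod.
by congr (_ * _ + _); apply: eq_bigr => i _; rewrite !rmorphXn hX.
Qed.

End MonomialCoefficients.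

Section CartierOperator.
Variables (p n : nat).
Hypothesis p_prime : prime p.
Local Notation S := {mpoly 'F_p[n]}.
Implicit Types (u G H w : S) (m be : 'X_{1..n}).

Lemma mpoly_pchar : p \in [pchar S].
Proof.
rewrite inE p_prime /= -(rmorph_nat (@mpolyC n 'F_p)).
by rewrite (pcharf0 (pchar_Fp p_prime)) rmorph0.
Qed.

Lemma Fp_expr (c : 'F_p) k : c ^+ (p ^ k) = c.
Proof.
elim: k => [|k IH]; first by rewrite expn0 expr1.
by rewrite expnSr exprM IH -[X in _ ^+ X](card_Fp p_prime) expf_card.
Qed.

(* The coefficient of X^be when G is expanded over the Q-th powers. *)
Definition cartier Q be G : S :=
  \sum_(m : 'X_{1..n < msize G}) G@_(m *+ Q + be)%MM *: 'X_[m].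

Lemma cartier_coef Q be G m : (0 < Q)%N -> (cartier Q be G)@_m = G@_(m *+ Q + be)%MM.
Proof.
move=> Q0; have [hm|hm] := ltnP (mdeg m) (msize G).
  by rewrite (mcoeff_mpoly (fun m => G@_(m *+ Q + be)%MM) hm).
rewrite [RHS]memN_msupp_eq0; last first.
  apply: msize_mdeg_ge; apply: leq_trans hm _.
  by rewrite mdegD mdegMn (leq_trans _ (leq_addr _ _)) // leq_pmulr.
rewrite raddf_sum big1 //= => m' _; rewrite mcoeffZ mcoeffX.
by case: eqP => [E|]; rewrite ?mulr0 //; move: (bmdeg m'); rewrite E ltnNge hm.
Qed.

Lemma cartierD Q be G H : (0 < Q)%N -> cartier Q be (G + H) = cartier Q be G + cartier Q be H.
Proof. by move=> Q0; apply/mpolyP => m; rewrite mcoeffD !cartier_coef // mcoeffD. Qed.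

Lemma cartier_sum Q be (I : Type) (s : seq I) (P : pred I) (f : I -> S) : (0 < Q)%N ->
  cartier Q be (\sum_(i <- s | P i) f i) = \sum_(i <- s | P i) cartier Q be (f i).
Proof.
move=> Q0; apply: big_morph => [x y|]; first exact: cartierD.
by apply/mpolyP => m; rewrite cartier_coef // !mcoeff0.
Qed.

(** Linearity over Q-th powers: scalars pass unchanged because they lie in F_p, and be < Q makes h Q
    <= m Q + be equivalent to h <= m. *)
Lemma cartier_mul k be H G : (forall i, (be i < p ^ k)%N) ->
  cartier (p ^ k) be (H ^+ (p ^ k)%N * G) = H * cartier (p ^ k) be G.
Proof.
have Q0 : (0 < p ^ k)%N by rewrite expn_gt0 prime_gt0.
move=> hbe; elim/mpolyind: H => [|c h H _ _ IH].
  rewrite expr0n eqn0Ngt Q0 !mul0r; apply/mpolyP => m.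
  by rewrite cartier_coef // !mcoeff0.
have -> := exprD_pchar_pow mpoly_pchar (c *: 'X_[h]) H k.
rewrite [in LHS]mulrDl [RHS]mulrDl.
rewrite cartierD // [X in _ + X]IH; congr (_ + _).
rewrite exprZn Fp_expr -!scalerAl mpolyXn; apply/mpolyP => m.
rewrite cartier_coef // !mcoeffZ !mcoeffXM cartier_coef //; congr (_ * _).
have -> : (h *+ (p ^ k) <= m *+ (p ^ k) + be)%MM = (h <= m)%MM.
  apply/mnm_lepP/mnm_lepP => hm i; have := hm i; rewrite mnmDE !mulmnE; last first.
    by move=> hi; rewrite (leq_trans _ (leq_addr _ _)) // leq_mul2r hi orbT.
  move=> hi; rewrite leqNgt; apply/negP => lt.
  have : ((m i).+1 * p ^ k <= h i * p ^ k)%N by rewrite leq_mul2r lt orbT.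
  move=> lt'; have := leq_trans lt' hi; rewrite mulSn leqNgt addnC ltn_add2r.
  by rewrite hbe.
case: ifP => // hm; congr (_@__); apply/mnmP => i.
rewrite !(mnmDE, mnmBE, mulmnE) mulnBl -addnBAC // leq_mul2r.
by rewrite (mnm_lepP hm) orbT.
Qed.

(** The means by which a relation modulo Frobenius powers is brought down to the original ideal. *)
Lemma cartier_mem k be G w (s : seq S) : (forall i, (be i < p ^ k)%N) ->
  ideal_gen [set` [seq x ^+ (p ^ k)%N | x <- s]] (G * w ^+ (p ^ k)%N) ->
  ideal_gen [set` s] (cartier (p ^ k) be G * w).
Proof.
have Q0 : (0 < p ^ k)%N by rewrite expn_gt0 prime_gt0.
move=> hbe /ideal_gen_seqP[c Ec]; apply/ideal_gen_seqP.
exists (fun i => cartier (p ^ k) be (c i)).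
rewrite mulrC -cartier_mul // mulrC Ec cartier_sum // size_map; apply: eq_bigr => i _.
by rewrite (nth_map 0) // mulrC cartier_mul // mulrC.
Qed.

End CartierOperator.

(** * The Fermat polynomial *)

Section VariableFree.
Variables (R : comNzRingType) (n : nat) (i : 'I_n).
Implicit Types (u v : {mpoly R[n]}).

Definition xfree u := forall m, u@_m != 0 -> m i = 0%N.

Lemma xfreeM u v : xfree u -> xfree v -> xfree (u * v).
Proof.
move=> hu hv m /mcoeffM_support[m1 [m2 [h1 h2 ->]]].
by rewrite mnmDE (hu _ h1) (hv _ h2).
Qed.

Lemma xfreeD u v : xfree u -> xfree v -> xfree (u + v).
Proof.
move=> hu hv m; rewrite mcoeffD => h; have [E|] := eqVneq (u@_m) 0; last exact: hu.
by apply: hv; rewrite E add0r in h.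
Qed.

Lemma xfree1 : xfree 1.
Proof. by move=> m; rewrite mcoeff1; have [->|_] := eqVneq m 0%MM; rewrite ?mnm0E ?eqxx. Qed.

Lemma xfree_expr u k : xfree u -> xfree (u ^+ k).
Proof.
move=> hu; elim: k => [|k IH]; first by rewrite expr0; apply: xfree1.
by rewrite exprS; apply: xfreeM.
Qed.

Lemma xfree_sum (I : Type) (s : seq I) (P : pred I) (f : I -> {mpoly R[n]}) :
  (forall j, P j -> xfree (f j)) -> xfree (\sum_(j <- s | P j) f j).
Proof.
move=> h; apply: (big_ind xfree) => //; last exact: xfreeD.
by move=> m; rewrite mcoeff0 eqxx.
Qed.

Lemma xfreeX j : j != i -> xfree 'X_j.
Proof.
move=> ne m; rewrite mcoeffX; have [<- _|] := eqVneq U_(j)%MM m; rewrite ?eqxx //.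
by rewrite mnm1E (negbTE ne).
Qed.

End VariableFree.

Section FermatPolynomial.
Variables (p d r : nat).
Hypotheses (p_prime : prime p) (r_ge2 : (2 <= r)%N) (p_ndvd_r : ~~ (p %| r)%N).
Local Notation S := {mpoly 'F_p[d.+1]}.
Local Notation Fm := (fermat_poly p d r).
Implicit Types (u c w : S) (m : 'X_{1..d.+1}).

Lemma fermat_poly_homog : Fm \is r.-homog.
Proof.
by apply: rpred_sum => i _; rewrite mpolyXn dhomogX /= mdegMn mdeg1 mul1n.
Qed.

Definition fermat_rest (i : 'I_d.+1) : S := \sum_(j < d.+1 | j != i) 'X_j ^+ r.

Lemma fermat_split i : Fm = 'X_i ^+ r + fermat_rest i.
Proof. by rewrite /fermat_poly (bigD1 i). Qed.

Lemma fermat_rest_free i : xfree i (fermat_rest i).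
Proof. by apply: xfree_sum => j hj; apply/xfree_expr/xfreeX. Qed.

Lemma coprime_pr k : coprime (p ^ k) r.
Proof. by apply: coprimeXl; rewrite prime_coprime. Qed.

(** Multiplication by F^(Q-1) turns the generator F into F^Q, after which a coefficient over the
    Q-th powers is taken. When F^(Q-1) is expanded in powers of X_i^r, only X_i^(r(Q-1)) has an
    exponent in the class of Q - r: a term with X_i^(r(Q-1-j)), 0 < j < Q, would give Q | r (Q - j),
    although Q is prime to r. The result is a nonzero scalar times X_i^(r-1). *)
Lemma fermat_test_element (i : 'I_d.+1) c w k (ys : seq S) :
  c != 0 -> xfree i c -> (msize c <= p ^ k)%N -> (r <= p ^ k)%N ->
  ideal_gen [set` rcons [seq y ^+ (p ^ k)%N | y <- ys] Fm] (c * w ^+ (p ^ k)%N) ->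
  ideal_gen [set` rcons ys Fm] ('X_i ^+ r.-1 * w).
Proof.
set Q := (p ^ k)%N => c0 ci sc rQ mem.
have Q0 : (0 < Q)%N by rewrite expn_gt0 prime_gt0.
have key : (r.-1 * Q + (Q - r) = r * Q.-1)%N.
  by rewrite addnBA // -mulSnr prednK ?(ltnW r_ge2) // -{2}[r]muln1 -mulnBr subn1.
pose m0 := mlead c.
have hm0 : c@_m0 != 0 by rewrite mleadc_eq0.
have dm m : c@_m != 0 -> (mdeg m < Q)%N.
  by move=> h; apply: leq_trans sc; apply: msize_mdeg_lt; rewrite mcoeff_msupp.
have le_mdeg m l : (m l <= mdeg m)%N by rewrite mdegE (bigD1 l) //= leq_addr.
(* Division of r (Q - 1) by Q leaves Q - r with quotient r - 1, as in [key]. The other entries pick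
   out the leading monomial of c. *)
pose be : 'X_{1..d.+1} := [multinom (if l == i then Q - r else m0 l)%N | l < d.+1].
have hbe l : (be l < Q)%N.
  rewrite mnmE; case: ifP => _; first by rewrite ltn_subrL (ltnW r_ge2).
  by apply: leq_ltn_trans (le_mdeg _ _) (dm _ hm0).
have : ideal_gen [set` [seq y ^+ Q | y <- rcons ys Fm]] (c * Fm ^+ Q.-1 * w ^+ Q).
  have hI := ideal_gen_is_ideal [set` [seq y ^+ Q | y <- rcons ys Fm]].
  have sub : [set` rcons [seq y ^+ Q | y <- ys] Fm] `<=`
      [set x | ideal_gen [set` [seq y ^+ Q | y <- rcons ys Fm]] (x * Fm ^+ Q.-1)].
    move=> x /=; rewrite mem_rcons inE => /orP[/eqP ->|hx].
      rewrite -exprS prednK //; apply: sub_ideal_gen; apply: (map_f (fun y => y ^+ Q)).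
      by rewrite mem_rcons inE eqxx.
    apply: (idealRM hI); apply: sub_ideal_gen; rewrite /= map_rcons mem_rcons inE.
    by apply/orP; right.
  have := ideal_gen_min (colon_is_ideal (Fm ^+ Q.-1) hI) sub mem.
  by rewrite /= mulrAC.
move=> /(cartier_mem p_prime hbe); rewrite -/Q.
suff -> : cartier Q be (c * Fm ^+ Q.-1) = c@_m0 *: 'X_i ^+ r.-1.
  move=> h; have hI := ideal_gen_is_ideal [set` rcons ys Fm].
  have := idealLM hI (c@_m0)^-1%:MP h.
  by rewrite -!mul_mpolyC !mulrA -rmorphM mulVf // rmorph1 mul1r.
apply/mpolyP => m; rewrite cartier_coef // mcoeffZ.
rewrite (fermat_split i) exprDn mulr_sumr raddf_sum /= big_ord_recl /=.
rewrite big1 ?addr0 => [|[j hj] _]; last first.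
  apply/eqP; apply: contraT => /=.
  rewrite /bump add1n mulrnAr mcoeffMn => h.
  have : (c * (('X_i ^+ r) ^+ (Q.-1 - j.+1) * fermat_rest i ^+ j.+1))@_(m *+ Q + be) != 0.
    by apply: contraNneq h => ->; rewrite mul0rn.
  rewrite mulrCA -exprM mpolyXn mcoeffXM; case: ifP => hle; last by rewrite eqxx.
  move=> /(xfreeM ci (xfree_expr (fermat_rest_free (i := i)) (k := j.+1))).
  rewrite mnmBE mnmDE !mulmnE mnm1E eqxx mul1n mnmE eqxx => E.
  have {}E : ((m i).+1 * Q = r * (Q - j.+1))%N.
    have := mnm_lepP hle i; rewrite mnmDE !mulmnE mnm1E eqxx mul1n mnmE eqxx.
    have -> : (Q - j.+1 = (Q.-1 - j.+1).+1)%N by move: hj; clear; lia.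
    by move: E; rewrite mulSn mulnS; move: (m i * Q)%N (r * _)%N rQ; clear; lia.
  have : (Q %| Q - j.+1)%N.
    by rewrite -(Gauss_dvdr _ (coprime_pr k)) -E dvdn_mull.
  by move=> /dvdn_leq; move: hj Q0; clear; lia.
rewrite subn0 expr0 bin0 mulr1n mulr1 mulrC -exprM !mpolyXn mcoeffXM mcoeffX.
have [E|ne] := eqVneq (U_(i) *+ r.-1)%MM m.
  have hle : (U_(i) *+ (r * Q.-1) <= m *+ Q + be)%MM.
    apply/mnm_lepP => l; rewrite -E mnmDE !mulmnE mnm1E mnmE eq_sym.
    by case: eqP => _; rewrite ?mul0n // !mul1n key.
  rewrite hle mulr1; congr (_@__); apply/mnmP => l.
  rewrite -E mnmBE mnmDE !mulmnE mnm1E mnmE eq_sym; case: eqP => [->|_].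
    by rewrite (ci _ hm0) !mul1n key subnn.
  by rewrite !mul0n add0n subn0.
rewrite mulr0; case: ifP => // hle; apply/eqP; apply: contraT => h.
have hdeg := dm _ h; have hi := ci _ h.
case/eqP: ne; apply/mnmP => l; rewrite mulmnE mnm1E eq_sym.
have := le_mdeg (m *+ Q + be - U_(i) *+ (r * Q.-1))%MM l.
move: hi; rewrite !mnmBE !mnmDE !mulmnE !mnm1E eqxx mul1n !mnmE eqxx.
have := mnm_lepP hle i; rewrite !mnmDE !mulmnE !mnm1E eqxx mul1n mnmE eqxx.
rewrite [i == l]eq_sym; case: eqP => [->|_] /= h1 h2 h3.
  apply/eqP; rewrite mul1n -(eqn_pmul2r Q0); apply/eqP.
  by move: h1 h2 key; clear; lia.
rewrite !mul0n ?subn0 in h3 *; have := leq_ltn_trans h3 hdeg.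
by case: (m l) => // a; rewrite mulSn; lia.
Qed.

End FermatPolynomial.

(** * The last variable as an outer polynomial variable *)

Section LastVariable.
Variables (F : comNzRingType) (n : nat).

Definition of_muni : {rmorphism {poly {mpoly F[n]}} -> {mpoly F[n.+1]}} :=
  heval (@mwiden n F) 'X_ord_max.

Lemma muniX (i : 'I_n) : muni ('X_(widen_ord (leqnSn n) i) : {mpoly F[n.+1]}) = ('X_i)%:P.
Proof.
rewrite muniE msuppX big_seq1 mcoeffX eqxx scale1r mnm1E.
have -> : (widen_ord (leqnSn n) i == ord_max) = false.
  by apply/negbTE; rewrite -val_eqE /= ltn_eqF.
rewrite expr0 alg_polyC; congr (_%:P); congr (mpolyX _ _).
by apply/mnmP => l; rewrite mnmE !mnm1E -!val_eqE.
Qed.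

Lemma muniXmax : muni ('X_ord_max : {mpoly F[n.+1]}) = 'X.
Proof.
rewrite muniE msuppX big_seq1 mcoeffX eqxx scale1r mnm1E eqxx expr1.
have -> : [multinom U_(ord_max : 'I_n.+1)%MM (widen_ord (leqnSn n) i) | i < n] = 0%MM.
  apply/mnmP => l; rewrite mnmE mnm1E mnm0E -val_eqE /= eq_sym.
  by rewrite ltn_eqF.
by rewrite mpolyX0 scale1r.
Qed.

Lemma muniK (u : {mpoly F[n.+1]}) : of_muni (muni u) = u.
Proof.
apply: (mpoly_rmorph_ext (f1 := of_muni \o @muni n F) (f2 := idfun)) => [c|i] /=.
  by rewrite muniC [LHS]hevalC; apply: mwidenC.
case: (unliftP ord_max i) => [j ->|->]; last by rewrite muniXmax [LHS]hevalX.
have -> : lift ord_max j = widen_ord (leqnSn n) j.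
  by apply: val_inj => /=; rewrite /bump leqNgt ltn_ord.
by rewrite muniX [LHS]hevalC; apply: (etrans (mwidenX _ _)); rewrite mnmwiden1.
Qed.

Lemma muni_mwiden (q : {mpoly F[n]}) : muni (mwiden q) = q%:P.
Proof.
apply: (mpoly_rmorph_ext (f1 := @muni n F \o @mwiden n F) (f2 := polyC)) => [c|i] /=.
  by rewrite mwidenC muniC.
by rewrite mwidenX mnmwiden1; apply: muniX.
Qed.

Lemma of_muniK q : muni (of_muni q) = q.
Proof.
elim/poly_ind: q => [|q c IH]; first by rewrite rmorph0 muni0.
rewrite (rmorphD of_muni) (rmorphM of_muni) (rmorphD (@muni n F)).
rewrite (rmorphM (@muni n F)); congr (_ * _ + _); first exact: IH.
  by apply: etrans (congr1 _ (hevalX _ _)) _; apply: muniXmax.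
by apply: etrans (congr1 _ (hevalC _ _ _)) _; apply: muni_mwiden.
Qed.

End LastVariable.

Lemma cross_mul (T : comNzRingType) (C k1 F1 c1 h k2 G : T) :
  k1 * C = c1 * h -> k2 * G = F1 * h -> C * (k1 * F1) = k2 * c1 * G.
Proof.
move=> E1 E2; have -> : C * (k1 * F1) = k1 * C * F1 by ring.
have -> : k2 * c1 * G = c1 * (k2 * G) by ring.
by rewrite E1 E2; ring.
Qed.

(** * Nonzerodivisors modulo F and norms *)

Section FermatNonzerodivisors.
Variables (p d r : nat).
Hypotheses (p_prime : prime p) (r_ge2 : (2 <= r)%N) (p_ndvd_r : ~~ (p %| r)%N).
Hypothesis d_gt0 : (0 < d)%N.
Local Notation S := {mpoly 'F_p[d.+1]}.
Local Notation Fm := (fermat_poly p d r).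
Implicit Types (u v c w h : S) (m : 'X_{1..d.+1}).

Lemma gen_fermatP u : ideal_gen [set` [:: Fm]] u <-> exists h, u = h * Fm.
Proof.
rewrite ideal_gen_cons ideal_gen_nil; split=> [[h [y [-> ->]]]|[h ->]].
  by exists h; rewrite addr0.
by exists h, 0; rewrite addr0.
Qed.

Lemma fermat_rest_neq0 (i : 'I_d.+1) : fermat_rest p r i != 0.
Proof.
have [j ji] : exists j : 'I_d.+1, j != i.
  have [->|] := eqVneq i ord0; last by move=> h; exists ord0; rewrite eq_sym.
  by exists (lift ord0 (Ordinal d_gt0)).
apply/eqP => /(congr1 (fun q : S => q@_(U_(j) *+ r))).
rewrite mcoeff0 raddf_sum /= (bigD1 j) //= mpolyXn mcoeffX eqxx big1 ?addr0.
  by move/eqP; rewrite oner_eq0.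
move=> k /andP[_ kj]; rewrite mpolyXn mcoeffX; case: eqP => // /mnmP/(_ j).
rewrite !mulmnE !mnm1E eqxx (negbTE kj) mul0n mul1n => E.
by move: r_ge2; rewrite -E.
Qed.

(** Let X_i u = h F and let h0 be the part of h free of X_i. Then h0 (F - X_i^r) is both free of X_i
    and divisible by it, hence zero; F - X_i^r is nonzero as d > 0, so X_i divides h. *)
Lemma var_nonzerodivisor (i : 'I_d.+1) k u :
  ideal_gen [set` [:: Fm]] ('X_i ^+ k * u) -> ideal_gen [set` [:: Fm]] u.
Proof.
elim: k u => [|k IH] u; first by rewrite expr0 mul1r.
rewrite exprSr -mulrA => /IH /gen_fermatP[h E]; apply/gen_fermatP.
pose h0 : S := \sum_(m <- msupp h | m i == 0%N) h@_m *: 'X_[m].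
pose h1 : S := \sum_(m <- msupp h | m i != 0%N) h@_m *: 'X_[m - U_(i)].
have Eh : h = h0 + 'X_i * h1.
  rewrite [LHS]mpolyE (bigID (fun m : 'X_{1..d.+1} => m i == 0%N)) /=; congr (_ + _).
  rewrite mulr_sumr; apply: eq_bigr => m hm.
  by rewrite -scalerAr -mpolyXD addmC submK // lep1mP.
have free0 : xfree i h0.
  apply: xfree_sum => m /eqP hm m'; rewrite mcoeffZ mcoeffX.
  by have [<-|_] := eqVneq m m'; rewrite ?mulr0 ?eqxx.
have E0 : h0 * fermat_rest p r i = 'X_i * (u - h1 * Fm - h0 * 'X_i ^+ r.-1).
  rewrite !mulrBr E [in h * Fm]Eh mulrDl -mulrA addrK {1}(fermat_split p r i) mulrDr.
  by rewrite mulrCA -exprS prednK ?(ltnW r_ge2) // addrAC subrr add0r.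
have : h0 * fermat_rest p r i = 0.
  apply/mpolyP => m; rewrite mcoeff0; apply/eqP; apply: contraT => hm.
  have := xfreeM free0 (@fermat_rest_free p d r i) hm.
  move: hm; rewrite E0 mcoeffXM lep1mP; case: ifP => [/negbTE hm _ /eqP|]; first by rewrite hm.
  by rewrite eqxx.
move/eqP; rewrite mulf_eq0 (negbTE (fermat_rest_neq0 i)) orbF => /eqP h00.
exists h1; have X0 : 'X_i != 0 :> S by rewrite -msize_poly_eq0 msizeX.
by apply: (mulfI X0); rewrite E Eh h00 add0r mulrA.
Qed.

(** With c = 1 and no parameters, [fermat_test_element] yields X_0^(r-1) u in (F), and X_0 is a
    nonzerodivisor. *)
Lemma fermat_reduced u n : ideal_gen [set` [:: Fm]] (u ^+ n) -> ideal_gen [set` [:: Fm]] u.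
Proof.
have hI := ideal_gen_is_ideal [set` [:: Fm]].
move=> hn; pose k := (n + r)%N.
have kp : (k < p ^ k)%N by apply: ltn_expl; apply: prime_gt1.
apply: (@var_nonzerodivisor ord0 r.-1).
apply: (@fermat_test_element p d r p_prime r_ge2 p_ndvd_r ord0 1 u k [::]).
- exact: oner_neq0.
- exact: xfree1.
- by rewrite msize1 expn_gt0 prime_gt0.
- by apply: leq_trans (ltnW kp); rewrite leq_addl.
have nk : (n <= p ^ k)%N by apply: leq_trans (ltnW kp); rewrite leq_addr.
by rewrite mul1r -(subnK nk) exprD; apply: (idealLM hI).
Qed.

Local Notation back := (of_muni 'F_p d).

Let mwiden_free (q : {mpoly 'F_p[d]}) : xfree ord_max (mwiden q).
Proof.
rewrite (mwidenE (leqnn _)); apply: xfree_sum => m _ m'; rewrite mcoeffZ mcoeffX.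
have [<- _|_] := eqVneq (mnmwiden m) m'; last by rewrite mulr0 eqxx.
exact: mnmwiden_ordmax.
Qed.

Let size_muni_fermat : size (muni Fm) = r.+1.
Proof.
have -> : muni Fm = 'X^r + (\sum_(i < d) 'X_i ^+ r)%:P.
  rewrite /fermat_poly big_ord_recr rmorphD rmorph_sum rmorphXn /= muniXmax addrC.
  congr (_ + _); rewrite rmorph_sum; apply: eq_bigr => i _.
  by rewrite [LHS]rmorphXn rmorphXn; congr (_ ^+ _); apply: muniX.
by rewrite size_XnaddC // (leq_trans _ r_ge2).
Qed.

(** Provides the multiplier free of X_d that [fermat_test_element] needs: the resultant of c and F
    with respect to X_d. If it vanished, a common factor would leave a cofactor of F, of smaller
    degree in X_d, whose product with c is in (F), against the regularity of c. *)
Lemma exists_norm c : (forall v, ideal_gen [set` [:: Fm]] (c * v) -> ideal_gen [set` [:: Fm]] v) ->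
  exists c', [/\ c' != 0, xfree ord_max c' & exists a b, c' = a * c + b * Fm].
Proof.
move=> reg.
have [G [sG backG hG]] : exists G : {poly {mpoly 'F_p[d]}}, [/\ size G = r.+1, back G = Fm &
    forall u v, u = v * Fm -> muni u = muni v * G].
  exists (muni Fm); split; [exact: size_muni_fermat | exact: muniK | ].
  by move=> u v ->; rewrite (rmorphM (@muni d 'F_p)).
have G0 : G != 0 by rewrite -size_poly_eq0 sG.
have [C backC] : exists C, back C = c by exists (muni c); apply: muniK.
(* [resultant_in_ideal] needs positive degrees; a multiplier constant in X_d serves as its own
   norm. *)
have [sC|sC] := leqP (size C) 1.
  exists c; split; last by exists 1, 0; rewrite mul1r mul0r addr0.
    apply/eqP => E; have /gen_fermatP[h Eh] : ideal_gen [set` [:: Fm]] 1.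
      by apply: reg; rewrite E mul0r; apply: (ideal0 (ideal_gen_is_ideal _)).
    have := hG _ _ Eh; rewrite (rmorph1 (@muni d 'F_p)).
    move: (muni h) => H Em; have H0 : H != 0.
      by apply/eqP => H0; move/eqP: Em; rewrite H0 mul0r oner_eq0.
    have := size_mul H0 G0; rewrite -Em size_poly1 sG addnS /=.
    by move: r_ge2; case: (size _) => [|s]; lia.
  rewrite -backC (size1_polyC sC) /of_muni hevalC; exact: mwiden_free.
have sG1 : (1 < size G)%N by rewrite sG ltnS (ltnW r_ge2).
have [[a b] _ E] := resultant_in_ideal sC sG1.
exists (mwiden (resultant C G)); split; last first.
- exists (back a), (back b).
  have := congr1 back E; rewrite (rmorphD back) !(rmorphM back) backC backG => <-.
  by rewrite hevalC.
- exact: mwiden_free.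
apply/eqP => R0; have : resultant C G == 0.
  by apply/eqP/(@inj_mwiden d); rewrite R0 rmorph0.
rewrite resultant_eq0 ltnNge => /negP; apply; rewrite leqNgt; apply/negP => sh.
set h := gcdp _ _ in sh.
(* Over a domain that is not a field, the gcd divides only up to the nonzero scalars k1 and k2. *)
have /Pdiv.WeakIdomain.dvdpP[[k1 c1] /= k10 E1] : h %| C by apply: dvdp_gcdl.
have /Pdiv.WeakIdomain.dvdpP[[k2 F1] /= k20 E2] : h %| G by apply: dvdp_gcdr.
have F10 : F1 != 0.
  apply/eqP => F10; move/eqP: E2; rewrite F10 mul0r -mul_polyC mulf_eq0 polyC_eq0.
  by rewrite (negbTE k20) (negbTE G0).
have sF1 : (size F1 < size G)%N.
  have h0 : h != 0 by rewrite -size_poly_gt0 (leq_trans _ sh).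
  have := size_mul F10 h0; rewrite -E2 size_scale // => ->.
  by move: sh; clear; lia.
have /reg /gen_fermatP[v Ev] : ideal_gen [set` [:: Fm]] (c * back (k1 *: F1)).
  apply/gen_fermatP; exists (back (k2 *: c1)).
  have EE : C * (k1 *: F1) = k2 *: c1 * G.
    by rewrite -!mul_polyC in E1 E2 *; apply: cross_mul E1 E2.
  by have := congr1 back EE; rewrite !(rmorphM back) backC backG.
have := hG _ _ Ev; rewrite of_muniK; move: (muni v) => V EV.
have kF0 : k1 *: F1 != 0 by rewrite -mul_polyC mulf_neq0 // polyC_eq0.
have V0 : V != 0 by apply/eqP => V0; move: kF0; rewrite EV V0 mul0r eqxx.
have := size_mul V0 G0; rewrite -EV size_scale //; rewrite -size_poly_gt0 in V0.
move: V0 sF1; move: (size V) (size F1) (size G) => x y z; clear.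
by lia.
Qed.

End FermatNonzerodivisors.

(** * Systems of parameters and Fedder-type descent *)

Lemma exists_submultinomial n (m : 'X_{1..n}) k : (k <= mdeg m)%N ->
  exists2 m' : 'X_{1..n}, (m' <= m)%MM & mdeg m' = k.
Proof.
elim: k => [|k IH] hk; first by exists 0%MM; rewrite ?mdeg0 //; apply/mnm_lepP => i; rewrite mnm0E.
have [m' hm' dm'] := IH (ltnW hk).
have [i hi] : exists i, (m' i < m i)%N.
  apply: contrapT => no; move: hk; rewrite -dm' !mdegE ltnNge leq_sum // => i _.
  by rewrite leqNgt; apply/negP => hi; apply: no; exists i.
exists (m' + U_(i))%MM; last by rewrite mdegD mdeg1 dm' addn1.
apply/mnm_lepP => l; rewrite mnmDE mnm1E; case: eqP => [<-|_]; first by rewrite addn1.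
by rewrite addn0; apply: (mnm_lepP hm').
Qed.

Lemma mdeg_pigeonhole n (m : 'X_{1..n.+1}) (N : 'I_n.+1 -> nat) :
  (\sum_i N i <= mdeg m)%N -> exists i, (N i <= m i)%N.
Proof.
move=> h; apply: contrapT => no.
have lt i : (m i < N i)%N by rewrite ltnNge; apply/negP => hi; apply: no; exists i.
move: h; rewrite mdegE leqNgt => /negP; apply.
rewrite big_ord_recl [X in (_ < X)%N]big_ord_recl /= -addSn leq_add ?lt //.
by apply: leq_sum => i _; apply: ltnW.
Qed.

(** Here the bound on p enters. For r >= d, the assumption K <= p - 2 gives p (r + 1) <= r (p - 2) +
    (d + 1)(r - 1), that is p <= (d-1) r - d - 1. *)
Lemma cap_sum_bound (p d r K sm : nat) : (2 <= d)%N -> (2 <= r)%N ->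
  (d%:Z - 1) * r%:Z - d%:Z < p%:Z -> sm = (r - d)%N ->
  (p * (sm + d.+1) <= r * K + d.+1 * r.-1)%N -> (p.-1 <= K)%N.
Proof.
move=> d2 r2 hp hsm h; rewrite leqNgt; apply/negP => hK.
have hK' : (r * (K.+2) <= r * p)%N by rewrite leq_mul2l; apply/orP; right; move: hK; clear; lia.
have hp' : (d * r < p + d + r)%N by move: hp; rewrite mulrBl mul1r -PoszM; lia.
case: r r2 hp hsm h hK' hp' => [//|r] r2 _ hsm /= h hK' hp'.
have [rd|rd] := leqP d r.+1.
  have E : (sm + d.+1 = r.+2)%N by rewrite hsm addnS subnK.
  by rewrite E in h; move: h hK' hp'; clear; rewrite !(mulnS, mulSn); lia.
have E : sm = 0%N by rewrite hsm; apply/eqP; rewrite subn_eq0 ltnW.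
rewrite E add0n in h; have [k Ed] : exists k, d = (r.+2 + k)%N.
  by exists (d - r.+2)%N; rewrite subnKC.
have rr : (r * r + k * r <= p - r)%N.
  by move: hp'; rewrite Ed; clear; rewrite !(mulnS, mulSn, mulnDl); lia.
have [P Ep] : exists P, p = (r + P)%N.
  by exists (p - r)%N; move: hp'; rewrite Ed; clear; rewrite !(mulnS, mulSn, mulnDl); lia.
move: h hK' rr; rewrite Ep Ed; clear; rewrite !(mulnS, mulSn, mulnDl, mulnDr) addKn => h hK' rr.
have : (0 <= k * P)%N by [].
have : (r * P = P * r)%N by rewrite mulnC.
move: h hK' rr; rewrite [(k * r)%N]mulnC; lia.
Qed.

Lemma eqn_mod_mulr_small p r a b : coprime p r -> (a < p)%N -> (b < p)%N ->
  a * r = b * r %[mod p] -> a = b.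
Proof.
move=> cop; wlog ab : a b / (a <= b)%N => [h|ap bp].
  by case: (leqP a b) => [|/ltnW] ab ap bp E; [| symmetry]; apply: h.
move/eqP; rewrite eq_sym eqn_mod_dvd ?leq_mul2r ?ab ?orbT // -mulnBl Gauss_dvdl //.
by move=> /dvdn_leq; move: ab ap bp; clear; lia.
Qed.

(** * Coefficients of powers of F *)

Section FermatPowers.
Variables (p d r : nat).
Hypotheses (p_prime : prime p) (r_ge2 : (2 <= r)%N) (p_ndvd_r : ~~ (p %| r)%N).
Local Notation S := {mpoly 'F_p[d.+1]}.
Local Notation Fm := (fermat_poly p d r).
Implicit Types (m al : 'X_{1..d.+1}).

Lemma fermat_pow_support k m : (Fm ^+ k)@_m != 0 ->
  exists2 al, mdeg al = k & m = (al *+ r)%MM.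
Proof.
elim: k m => [|k IH] m.
  rewrite expr0 mcoeff1; have [->|_] := eqVneq m 0%MM; last by rewrite eqxx.
  by exists 0%MM; rewrite ?mdeg0 //; apply/mnmP => i; rewrite mulmnE !mnm0E mul0n.
rewrite exprS mulr_suml raddf_sum /= => h.
have [i hi] : exists i : 'I_d.+1, ('X_i ^+ r * Fm ^+ k)@_m != 0.
  apply: contrapT => no; case/eqP: h; apply: big1 => i _.
  by apply: contrapT => /eqP hi; apply: no; exists i.
move: hi; rewrite mpolyXn mcoeffXM; case: ifP => hle; last by rewrite eqxx.
move=> /IH[al dal E]; exists (al + U_(i))%MM; first by rewrite mdegD mdeg1 dal addn1.
rewrite -(submK hle) E; apply/mnmP => l; rewrite !(mnmDE, mulmnE) mulnDl.
by [].
Qed.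

(** The multinomial formula with its denominators cleared, so that it is meaningful in
    characteristic p. *)
Lemma fermat_pow_coef al : (Fm ^+ mdeg al)@_(al *+ r) * (\prod_i (al i)`!)%:R = (mdeg al)`!%:R.
Proof.
move: {2}(mdeg al) (erefl (mdeg al)) => k; elim: k al => [|k IH] al dal.
  have -> : al = 0%MM by apply/eqP; rewrite -mdeg_eq0 dal.
  rewrite mdeg0 expr0 big1 => [|i _]; last by rewrite mnm0E.
  rewrite mulr1 mcoeff1 (_ : (0 *+ r)%MM = 0%MM) ?eqxx //.
  by apply/mnmP => i; rewrite mulmnE !mnm0E mul0n.
rewrite dal exprS mulr_suml raddf_sum /= mulr_suml.
rewrite factS natrM -dal {1}mdegE natr_sum mulr_suml; apply: eq_bigr => i _.
rewrite mpolyXn mcoeffXM.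
have [ai0|ai0] := eqVneq (al i) 0%N.
  rewrite ai0 mul0r; case: ifP => [/mnm_lepP/(_ i)|_]; last by rewrite mul0r.
  by rewrite !mulmnE mnm1E eqxx mul1n ai0 mul0n leqNgt (ltnW r_ge2).
have ui : (U_(i) <= al)%MM by rewrite lep1mP.
have -> : (U_(i) *+ r <= al *+ r)%MM.
  by apply/mnm_lepP => l; rewrite !mulmnE leq_mul2r (mnm_lepP ui) orbT.
have -> : (al *+ r - U_(i) *+ r = (al - U_(i)) *+ r)%MM.
  by apply/mnmP => l; rewrite !(mnmBE, mulmnE) mulnBl.
have dal' : mdeg (al - U_(i)) = k.
  by apply/eqP; rewrite -(eqn_add2r (mdeg U_(i))) -mdegD submK // mdeg1 addn1 dal.
have := IH _ dal'; rewrite dal' => <-.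
have -> : (\prod_l (al l)`! = al i * \prod_l ((al - U_(i))%MM l)`!)%N.
  rewrite (bigD1 i) // [in RHS](bigD1 i) //= mulnA; congr (_ * _)%N.
    by rewrite mnmBE mnm1E eqxx subn1 -{1}(prednK (_ : 0 < al i)%N) ?factS ?prednK ?lt0n.
  by apply: eq_bigr => l li; rewrite mnmBE mnm1E eq_sym (negbTE li) subn0.
by rewrite natrM mulrCA.
Qed.

(** By Wilson's theorem p does not divide (p-1)!. *)
Lemma fermat_pow_coef_neq0 al : mdeg al = p.-1 -> (Fm ^+ p.-1)@_(al *+ r) != 0.
Proof.
move=> dal; have := fermat_pow_coef al; rewrite dal => E; apply/eqP => E0.
move/eqP: E; rewrite E0 mul0r eq_sym => /eqP E.
have : (p %| (p.-1)`!)%N by rewrite (dvdn_pcharf (pchar_Fp p_prime)) E.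
move=> h; have : (p %| 1)%N.
  by rewrite -(dvdn_addr _ h) addn1 -Wilson ?prime_gt1.
by rewrite dvdn1 => /eqP E1; move: p_prime; rewrite E1.
Qed.

End FermatPowers.

(** * Parameter ideals containing F *)

Section SystemsOfParams.
Variables (p d r : nat).
Hypotheses (p_prime : prime p) (r_ge2 : (2 <= r)%N) (p_ndvd_r : ~~ (p %| r)%N).
Hypothesis d_ge2 : (2 <= d)%N.
Local Notation S := {mpoly 'F_p[d.+1]}.
Local Notation Fm := (fermat_poly p d r).
Implicit Types (u w : S) (m al : 'X_{1..d.+1}) (y : 'I_d -> S) (es : 'I_d -> nat).

(** [rev_regular] reads lists backwards, so F, standing last, is the first element of the regular
    sequence and stays when parameters are dropped. *)
Definition par y : seq S := rcons [seq y i | i <- enum 'I_d] Fm.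

(** Lifts to S of a homogeneous system of parameters of R: in place of a dimension, the ideal (y, F)
    is required to contain a power of every variable. *)
Definition params y es := [/\ forall i, y i \is (es i).-homog, forall i, (0 < es i)%N &
  forall i, exists N, ideal_gen [set` par y] ('X_i ^+ N)].

Definition par_degs es : seq nat := rcons [seq es i | i <- enum 'I_d] r.

Lemma size_par y : size (par y) = d.+1.
Proof. by rewrite size_rcons size_map size_enum_ord. Qed.

Lemma homog_par y es : params y es -> homog_seq (par y) (par_degs es).
Proof.
move=> [hy _ _]; split; first by rewrite size_par size_rcons size_map size_enum_ord.
have sz T (f : 'I_d -> T) : size [seq f i | i <- enum 'I_d] = d.
  by rewrite size_map size_enum_ord.
move=> i; rewrite size_par ltnS leq_eqVlt => /orP[/eqP ->|hi].
  by rewrite /par /par_degs !nth_rcons !sz ltnn eqxx; apply: fermat_poly_homog.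
rewrite /par /par_degs !nth_rcons !sz hi.
by rewrite (nth_map (Ordinal hi)) ?size_enum_ord // (nth_map (Ordinal hi)) ?size_enum_ord.
Qed.

Lemma par_regular y es : params y es -> rev_regular (par y).
Proof.
move=> hy; have [_ es0 hX] := hy.
apply: (hsop_regular (homog_par hy)) hX; last exact: size_par.
apply/allP => e; rewrite mem_rcons inE => /orP[/eqP ->|/mapP[i _ ->]]; last exact: es0.
exact: ltnW.
Qed.

(** Iteration of [socle_degree]: as none of the degrees D, ..., D + N - 1 is the socle degree, N
    multiplications by variables can be undone. *)
Lemma par_socle y es (D N : nat) u : params y es -> u \is D.-homog ->
  (forall m, mdeg m = N -> ideal_gen [set` par y] ('X_[m] * u)) ->
  (forall j, (j < N)%N -> (D + j + d.+1)%N != (\sum_i es i + r)%N) ->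
  ideal_gen [set` par y] u.
Proof.
move=> hy; elim: N D u => [|N IH] D u hu hN ne.
  by have := hN 0%MM (@mdeg0 _); rewrite mpolyX0 mul1r.
apply: (socle_degree (homog_par hy) (par_regular hy) (size_par y) hu).
  move=> i; apply: (IH D.+1) => [|m dm|j hj].
  - by rewrite -[D.+1]add1n; apply: dhomogM => //; rewrite dhomogX /= mdeg1.
  - by rewrite mulrA -mpolyXD; apply: hN; rewrite mdegD mdeg1 dm addn1.
  - by rewrite addSnnS; apply: ne.
have -> : sumn (par_degs es) = (\sum_i es i + r)%N.
  by rewrite /par_degs sumn_rcons sumnE big_map big_enum.
by have := ne 0%N isT; rewrite addn0.
Qed.

Lemma par_top y es : params y es -> exists N, forall m, (N <= mdeg m)%N ->
  ideal_gen [set` par y] 'X_[m].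
Proof.
move=> [_ _ /choice[N hN]]; exists (\sum_i N i)%N => m /mdeg_pigeonhole[i hi].
have hI := ideal_gen_is_ideal [set` par y].
have le : (U_(i) *+ N i <= m)%MM.
  by apply/mnm_lepP => l; rewrite mulmnE mnm1E; case: eqP => [<-|_]; rewrite ?mul1n.
by rewrite -(submK le) mpolyXD -mpolyXn; apply: (idealLM hI).
Qed.

Lemma par_vanish y es (D : nat) u : params y es -> u \is D.-homog ->
  (\sum_i es i + r < D + d.+1)%N -> ideal_gen [set` par y] u.
Proof.
move=> hy hu hD; have [N hN] := par_top hy.
have hI := ideal_gen_is_ideal [set` par y].
apply: (par_socle hy hu (N := N)) => [m dm|j _].
  by apply: (idealRM hI); apply: hN; rewrite dm.
by rewrite gtn_eqF // (leq_trans hD) // leq_add2r leq_addr.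
Qed.

Lemma par_frobenius y k u : ideal_gen [set` par y] u ->
  ideal_gen [set` par (fun i => y i ^+ (p ^ k)%N)] (u ^+ (p ^ k)%N).
Proof.
move=> hu; have := @frobenius_gen_mem _ _ (mpoly_pchar d.+1 p_prime) _ k _ hu.
move: (u ^+ _).
apply: ideal_gen_min => [|_ [v hv <-]]; first exact: ideal_gen_is_ideal.
have hI := ideal_gen_is_ideal [set` par (fun i => y i ^+ (p ^ k)%N)].
move: hv; rewrite /= mem_rcons inE => /orP[/eqP ->|/mapP[i _ ->]].
  apply: (ideal_expr hI); first by rewrite expn_gt0 prime_gt0.
  by apply: sub_ideal_gen; rewrite /= mem_rcons inE eqxx.
apply: sub_ideal_gen; rewrite /= mem_rcons inE; apply/orP; right.
by apply: (map_f (fun i => y i ^+ (p ^ k)%N)); rewrite mem_enum.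
Qed.

Lemma par_mono y y' : (forall i, exists a, y i = a * y' i) ->
  ideal_gen [set` par y] `<=` ideal_gen [set` par y'].
Proof.
move=> h; have hI := ideal_gen_is_ideal [set` par y'].
apply: ideal_gen_min => // u; rewrite /= mem_rcons inE => /orP[/eqP ->|/mapP[i _ ->]].
  by apply: sub_ideal_gen; rewrite /= mem_rcons inE eqxx.
have [a ->] := h i; apply: (idealLM hI); apply: sub_ideal_gen.
by rewrite /= mem_rcons inE; apply/orP; right; apply: map_f; rewrite mem_enum.
Qed.

(** Once p^k exceeds all a_i, the new ideal contains the p^k-th powers of the old one. *)
Lemma params_expr y es (a : 'I_d -> nat) : params y es -> (forall i, 0 < a i)%N ->
  params (fun i => y i ^+ a i) (fun i => es i * a i)%N.
Proof.
move=> [hy es0 hX] a0; split=> [i|i|i]; first exact: dhomogMn.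
  by rewrite muln_gt0 es0 a0.
have [N hN] := hX i; pose k := (\max_i a i)%N.
exists (N * p ^ k)%N; rewrite exprM.
apply: (@par_mono (fun i => y i ^+ (p ^ k)%N)); last exact: par_frobenius.
move=> j; have le : (a j <= p ^ k)%N.
  have : (a j <= k)%N by apply: (leq_bigmax (F := a)).
  by move=> /leq_trans; apply; apply/ltnW/ltn_expl/prime_gt1.
by exists (y j ^+ (p ^ k - a j)); rewrite -exprD subnK.
Qed.

Lemma par_map y k : rcons [seq v ^+ k | v <- [seq y i | i <- enum 'I_d]] Fm = par (fun i => y i ^+ k).
Proof. by rewrite /par -map_comp. Qed.

Hypothesis p_gt : (d%:Z - 1) * r%:Z - d%:Z < p%:Z.

(* Fedder-type descent: the coefficients of F^(p-1) over the p-th powers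
   contain all monomials of degree r - d, up to multiples. *)
Lemma frobenius_descent y es (t : nat) w : params y es -> w \is t.-homog ->
  (t < \sum_i es i)%N -> ideal_gen [set` par (fun i => y i ^+ p)] (w ^+ p) ->
  ideal_gen [set` par y] w.
Proof.
move=> hy hw ht mem; have hI := ideal_gen_is_ideal [set` par y].
have p0 : (0 < p)%N by apply: prime_gt0.
(* Since t is below the sum of the degrees, t, ..., t + (r - d) - 1 all stay below the socle degree;
   it suffices to treat X^m w with |m| = r - d, truncated at 0. *)
apply: (par_socle hy hw (N := (r - d)%N)) => [m dm|j hj]; last first.
  by rewrite neq_ltn; apply/orP; left; move: hj ht; clear; lia.
(* The largest exponent whose product with r is less than p (m_i + 1), that is, has quotient at most
   m_i by p. *)
pose cap : 'X_{1..d.+1} := [multinom ((p * (m i).+1).-1 %/ r)%N | i < d.+1].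
have r0 : (0 < r)%N by apply: ltnW.
have capr i : (p * (m i).+1 <= r * cap i + r.-1)%N.
  rewrite mnmE; set x := (p * _)%N; have x0 : (0 < x)%N by rewrite muln_gt0 p0.
  have := divn_eq x.-1 r; have := ltn_pmod x.-1 r0; rewrite mulnC => lt E.
  (* r does not divide p (m_i + 1), because m_i + 1 <= (r - d) + 1 < r. This gains one unit per
     variable in [capr]. *)
  have nr : (x.-1 %% r != r.-1)%N.
    apply/eqP => Er; have : (r %| x)%N.
      by rewrite -(prednK x0) E Er -addnS prednK // dvdn_add ?dvdn_mulr.
    rewrite Gauss_dvdr; last by rewrite coprime_sym -[p]expn1 coprime_pr.
    move=> /dvdn_leq; have : (m i <= mdeg m)%N by rewrite mdegE (bigD1 i) //= leq_addr.
    by rewrite dm; move: d_ge2 r_ge2; clear; lia.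
  by move: E lt nr x0 r0; clear; move: (r * _)%N (x.-1 %% r)%N => a b; lia.
have capm : (p.-1 <= mdeg cap)%N.
  apply: (@cap_sum_bound p d r _ (mdeg m)) => //.
  rewrite !mdegE.
  have -> : (p * (\sum_i m i + d.+1) = \sum_i p * (m i).+1)%N.
    rewrite -big_distrr /=; congr (_ * _)%N.
    under [RHS]eq_bigr => i _ do rewrite -addn1.
    by rewrite big_split /= sum_nat_const card_ord muln1.
  have -> : (r * (\sum_i cap i) + d.+1 * r.-1 = \sum_i (r * cap i + r.-1))%N.
    by rewrite big_split /= -big_distrr sum_nat_const card_ord.
  by apply: leq_sum => i _; apply: capr.
have [al hal dal] := exists_submultinomial capm.
(* Remainder and quotient of al r by p. Exponents in F^(p-1) are r al' with entries of al' below p,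
   so the class be modulo p determines al' = al, and the Cartier coefficient is a scalar times
   X^ga. *)
pose be : 'X_{1..d.+1} := [multinom (al i * r %% p)%N | i < d.+1].
pose ga : 'X_{1..d.+1} := [multinom (al i * r %/ p)%N | i < d.+1].
have hbe i : (be i < p ^ 1)%N by rewrite mnmE expn1 ltn_pmod.
have := @cartier_mem p d.+1 p_prime 1 be (Fm ^+ p.-1) w (par y) hbe.
have hI' := ideal_gen_is_ideal [set` [seq x ^+ (p ^ 1)%N | x <- par y]].
rewrite expn1 in hI' *; have mem' : ideal_gen [set` [seq x ^+ p | x <- par y]] (Fm ^+ p.-1 * w ^+ p).
  rewrite mulrC; have sub : [set` par (fun i => y i ^+ p)] `<=`
      [set x | ideal_gen [set` [seq x ^+ p | x <- par y]] (x * Fm ^+ p.-1)].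
    move=> x /=; rewrite mem_rcons inE => /orP[/eqP ->|/mapP[i _ ->]].
      rewrite -exprS prednK //; apply: sub_ideal_gen; apply: (map_f (fun x => x ^+ p)).
      by rewrite mem_rcons inE eqxx.
    apply: (idealRM hI'); apply: sub_ideal_gen; apply: (map_f (fun x => x ^+ p)).
    by rewrite mem_rcons inE; apply/orP; right; apply: map_f; rewrite mem_enum.
  exact: ideal_gen_min (colon_is_ideal _ hI') sub _ mem.
move=> /(_ mem').
have -> : cartier p be (Fm ^+ p.-1) = (Fm ^+ p.-1)@_(al *+ r) *: 'X_[ga].
  apply/mpolyP => m'; rewrite cartier_coef // mcoeffZ mcoeffX.
  have [<-|ne] := eqVneq ga m'.
    rewrite mulr1; congr (_@__); apply/mnmP => i.
    by rewrite mnmDE !mulmnE !mnmE -divn_eq.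
  rewrite mulr0; apply/eqP; apply: contraT => /fermat_pow_support[al' dal' E].
  case/eqP: ne; apply/mnmP => i; rewrite mnmE.
  have := congr1 (fun m : 'X_{1..d.+1} => m i) E; rewrite mnmDE !mulmnE mnmE => {}E.
  have lt1 (a : 'X_{1..d.+1}) : mdeg a = p.-1 -> (a i < p)%N.
    by move=> da; rewrite -(prednK p0) ltnS -da mdegE (bigD1 i) //= leq_addr.
  have Ea : al i = al' i.
    apply: (@eqn_mod_mulr_small p r); rewrite ?lt1 //.
      by rewrite -[p]expn1 coprime_pr.
    by rewrite -E modnMDl modn_mod.
  by move: E; rewrite -Ea {2}(divn_eq (al i * r) p) => /addIn/eqP; rewrite eqn_pmul2r // => /eqP.
rewrite -scalerAl -mul_mpolyC => h.
have c0 := fermat_pow_coef_neq0 p_prime r_ge2 dal.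
have {}h : ideal_gen [set` par y] ('X_[ga] * w).
  have := idealLM hI ((Fm ^+ p.-1)@_(al *+ r))^-1%:MP h.
  by rewrite mulrA -rmorphM mulVf // rmorph1 mul1r.
have gm : (ga <= m)%MM.
  apply/mnm_lepP => i; rewrite mnmE -ltnS ltn_divLR // mulnC.
  have := mnm_lepP hal i; rewrite mnmE => le.
  have : (r * al i <= r * ((p * (m i).+1).-1 %/ r))%N by rewrite leq_mul2l le orbT.
  have := leq_trunc_div (p * (m i).+1).-1 r; rewrite mulnC.
  rewrite [((m i).+1 * p)%N]mulnC; have : (0 < p * (m i).+1)%N by rewrite muln_gt0 p0.
  by move: (p * _)%N (r * (_ %/ _))%N (r * al i)%N; clear; lia.
by rewrite -(submK gm) mpolyXD -mulrA; apply: (idealLM hI).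
Qed.

Lemma frobenius_descent_iter y es (t k : nat) w : params y es -> w \is t.-homog ->
  (t < \sum_i es i)%N -> ideal_gen [set` par (fun i => y i ^+ (p ^ k)%N)] (w ^+ (p ^ k)%N) ->
  ideal_gen [set` par y] w.
Proof.
move=> hy hw ht; have p0 : (0 < p)%N by apply: prime_gt0.
elim: k => [|k IH] mem.
  have -> : y = (fun i => y i ^+ (p ^ 0)%N) by apply/funext => i; rewrite expn0 expr1.
  by rewrite -[w]expr1 -(expn0 p).
have q0 : (0 < p ^ k)%N by rewrite expn_gt0 p0.
apply: IH; apply: (frobenius_descent (params_expr (a := fun=> (p ^ k)%N) hy (fun=> q0)) (t := t * p ^ k)).
- exact: dhomogMn.
- by rewrite -big_distrl ltn_mul2r q0.
- have -> : (fun i => (y i ^+ (p ^ k)%N) ^+ p) = (fun i => y i ^+ (p ^ k.+1)%N).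
    by apply/funext => i; rewrite -exprM expnSr.
  by rewrite -exprM -expnSr.
Qed.

Lemma hc_frobenius (t k : nat) u :
  hc (t * p ^ k)%N (u ^+ (p ^ k)%N) = hc t u ^+ (p ^ k)%N.
Proof.
have q0 : (0 < p ^ k)%N by rewrite expn_gt0 prime_gt0.
have frob_sum (I : Type) (s : seq I) (G : I -> S) :
    (\sum_(i <- s) G i) ^+ (p ^ k)%N = \sum_(i <- s) G i ^+ (p ^ k)%N.
  elim: s => [|i s IH]; first by rewrite !big_nil expr0n gtn_eqF.
  by rewrite !big_cons (exprD_pchar_pow (mpoly_pchar d.+1 p_prime)) IH.
have := hc_partition u; move: (msize u) => K Eu; rewrite [in LHS]Eu [in RHS]Eu.
rewrite frob_sum !hc_sum frob_sum; apply: eq_bigr => i _.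
have hi : hc (i : nat) u \is (i : nat).-homog by apply: pihomogP.
have [E|ne] := eqVneq (i : nat) t.
  by rewrite -E (hc_homog (dhomogMn (p ^ k)%N hi)) (hc_homog hi).
rewrite (hc_homog_ne hi); last by rewrite eqz_nat eq_sym.
rewrite (hc_homog_ne (dhomogMn (p ^ k)%N hi)) ?expr0n ?(gtn_eqF q0) //.
by rewrite eqz_nat eqn_pmul2r // eq_sym.
Qed.

(** The multiplier c is exchanged for the powers X_i^(r-1), of fixed degree. For a large Frobenius
    exponent q, the degree of the q-th power of a component of low degree lies so far below the
    socle degree that these multipliers can be removed; [frobenius_descent_iter] then goes down to
    exponent 1. *)
Lemma tight_param y es u c (e0 : nat) : params y es ->
  (forall v, ideal_gen [set` [:: Fm]] (c * v) -> ideal_gen [set` [:: Fm]] v) ->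
  (forall e, (e0 <= e)%N ->
    ideal_gen [set` par (fun i => y i ^+ (p ^ e)%N)] (c * u ^+ (p ^ e)%N)) ->
  forall t : nat, (t < \sum_i es i)%N -> ideal_gen [set` par y] (hc t u).
Proof.
move=> hy reg hmem t ht; have p1 := prime_gt1 p_prime; have p0 := ltnW p1.
have test i c' : c' != 0 -> xfree i c' -> (exists e1, forall e, (e1 <= e)%N ->
      ideal_gen [set` par (fun i => y i ^+ (p ^ e)%N)] (c' * u ^+ (p ^ e)%N)) ->
    forall l, ideal_gen [set` par (fun i => y i ^+ (p ^ l)%N)] ('X_i ^+ r.-1 * u ^+ (p ^ l)%N).
  (* The relation at exponent l + k is read as one of Q-th powers, with Q = p^k large compared with
     c', and comes down to the arbitrary exponent l. *)
  move=> c0 ci [e1 he1] l; pose k := (e1 + msize c' + r)%N.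
  have kp : (k < p ^ k)%N by apply: ltn_expl.
  apply: (@fermat_test_element p d r p_prime r_ge2 p_ndvd_r i c' _ k) => //.
  - by apply: leq_trans (ltnW kp); rewrite /k -addnA addnCA leq_addr.
  - by apply: leq_trans (ltnW kp); rewrite /k leq_addl.
  rewrite par_map -exprM -expnD.
  have -> : (fun i => (y i ^+ (p ^ l)%N) ^+ (p ^ k)%N) = (fun i => y i ^+ (p ^ (l + k))%N).
    by apply/funext => j; rewrite -exprM -expnD.
  by apply: he1; rewrite /k -!addnA addnCA leq_addr.
have [c' [c0 cfree [a [b Ec]]]] := exists_norm p_prime r_ge2 p_ndvd_r (ltnW d_ge2) reg.
have mem_max := test _ _ c0 cfree.
have {}mem_max : forall l, ideal_gen [set` par (fun i => y i ^+ (p ^ l)%N)]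
    ('X_ord_max ^+ r.-1 * u ^+ (p ^ l)%N).
  apply: mem_max; exists e0 => e he; have hI := ideal_gen_is_ideal [set` par (fun i => y i ^+ (p ^ e)%N)].
  rewrite Ec mulrDl; apply: (idealD hI).
    by rewrite -mulrA; apply: (idealLM hI); apply: hmem.
  apply: (idealRM hI); apply: (idealLM hI); apply: sub_ideal_gen.
  by rewrite /= mem_rcons inE eqxx.
have mem_all i l : ideal_gen [set` par (fun i => y i ^+ (p ^ l)%N)] ('X_i ^+ r.-1 * u ^+ (p ^ l)%N).
  have [->|ne] := eqVneq i ord_max; first exact: mem_max.
  apply: (test i ('X_ord_max ^+ r.-1)) => //.
  - by apply: expf_neq0; rewrite -msize_poly_eq0 msizeX.
  - by apply/xfree_expr/xfreeX; rewrite eq_sym.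
  - by exists 0%N => e _; apply: mem_max.
(* Every monomial of degree N is divisible by some X_i^(r-1), and p^l > N + d + 1 keeps the degrees
   t p^l + j, j < N, below the socle degree. *)
pose N := (d.+1 * r)%N; pose l := (N + d.+1)%N.
have lq : (l < p ^ l)%N by apply: ltn_expl.
have q0 : (0 < p ^ l)%N by rewrite expn_gt0 p0.
have hyq := params_expr (a := fun=> (p ^ l)%N) hy (fun=> q0).
have hut : hc t u \is t.-homog by apply: pihomogP.
have hI := ideal_gen_is_ideal [set` par (fun i => y i ^+ (p ^ l)%N)].
have mem_t i : ideal_gen [set` par (fun i => y i ^+ (p ^ l)%N)]
    ('X_i ^+ r.-1 * hc t u ^+ (p ^ l)%N).
  have := hc_ideal_gen (r.-1 + t * p ^ l)%N (homog_seq_mem (homog_par hyq)) (mem_all i l).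
  have hX : ('X_i ^+ r.-1 : S) \is r.-1.-homog.
    by rewrite mpolyXn dhomogX /= mdegMn mdeg1 mul1n.
  by rewrite (hc_mul _ _ hX) PoszD addrC addKr hc_frobenius.
apply: (frobenius_descent_iter hy hut ht (k := l)).
apply: (par_socle hyq (dhomogMn (p ^ l)%N hut) (N := N)) => [m dm|j hj].
  have [|i hi] := @mdeg_pigeonhole d m (fun=> r.-1).
    by rewrite sum_nat_const card_ord dm leq_mul2l leq_pred orbT.
  have le : (U_(i) *+ r.-1 <= m)%MM.
    by apply/mnm_lepP => k; rewrite mulmnE mnm1E; case: eqP => [<-|_]; rewrite ?mul1n.
  have -> : 'X_[m] = 'X_[(m - U_(i) *+ r.-1)] * 'X_i ^+ r.-1 :> S.
    by rewrite mpolyXn -mpolyXD submK.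
  by rewrite -mulrA; apply: (idealLM hI); apply: mem_t.
rewrite neq_ltn -big_distrl /=; apply/orP; left.
have : (t.+1 * p ^ l <= (\sum_i es i) * p ^ l)%N by rewrite leq_mul2r ht orbT.
rewrite mulSn => h; apply: leq_trans (leq_addr _ _); apply: leq_trans h.
rewrite -addnA [(p ^ l + _)%N]addnC ltn_add2l.
by apply: leq_ltn_trans lq; rewrite /l leq_add2r ltnW.
Qed.

End SystemsOfParams.

(** * A free basis over the parameters *)

Lemma mpoly_split_var (R : comNzRingType) n (i : 'I_n) (h : {mpoly R[n]}) :
  exists h0 h1, [/\ h = h0 + 'X_i * h1, xfree i h0,
    forall m, h0@_m != 0 -> h@_m != 0 & forall m, h1@_m = h@_(m + U_(i))].
Proof.
pose h0 : {mpoly R[n]} := \sum_(m : 'X_{1..n < msize h}) (if m i == 0%N then h@_m else 0) *: 'X_[m].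
pose h1 : {mpoly R[n]} := \sum_(m : 'X_{1..n < msize h}) h@_(m + U_(i)) *: 'X_[m].
have big0 m : (msize h <= mdeg m)%N -> h@_m = 0.
  by move=> hm; apply: memN_msupp_eq0; apply: msize_mdeg_ge.
have big m (G : 'X_{1..n} -> R) : (msize h <= mdeg m)%N ->
    (\sum_(m : 'X_{1..n < msize h}) G m *: 'X_[m])@_m = 0.
  move=> hm; rewrite raddf_sum big1 //= => m' _; rewrite mcoeffZ mcoeffX.
  have [E|_] := eqVneq (m' : 'X_{1..n}) m; last by rewrite mulr0.
  by have := bmdeg m'; rewrite E ltnNge hm.
have E0 m : h0@_m = if m i == 0%N then h@_m else 0.
  have [hm|hm] := ltnP (mdeg m) (msize h); first by rewrite (mcoeff_mpoly (fun m => if m i == 0%N then h@_m else 0) hm).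
  by rewrite (big m (fun m => if m i == 0%N then h@_m else 0) hm) (big0 m hm); case: ifP.
have E1 m : h1@_m = h@_(m + U_(i)).
  have [hm|hm] := ltnP (mdeg m) (msize h); first by rewrite (mcoeff_mpoly (fun m => h@_(m + U_(i))%MM) hm).
  by rewrite (big m (fun m => h@_(m + U_(i))%MM) hm) big0 // mdegD (leq_trans hm) // leq_addr.
exists h0, h1; split=> //.
- apply/mpolyP => m; rewrite mcoeffD E0 mcoeffXM lep1mP E1.
  have [mi|mi] := eqVneq (m i) 0%N; first by rewrite addr0.
  by rewrite add0r submK // lep1mP.
- by move=> m; rewrite E0; have [//|_] := eqVneq (m i) 0%N; rewrite eqxx.
- by move=> m; rewrite E0; case: ifP => // _; rewrite eqxx.
Qed.

Section FreeBasis.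
Variables (p d r e : nat).
Hypotheses (p_prime : prime p) (r_ge2 : (2 <= r)%N) (d_ge2 : (2 <= d)%N).
Local Notation S := {mpoly 'F_p[d.+1]}.
Local Notation P := {mpoly 'F_p[d]}.
Local Notation Fm := (fermat_poly p d r).
Implicit Types (u v : S).

Variable g : 'I_d -> S.
Hypothesis hg : params r g (fun=> e).

Definition evg : {rmorphism P -> S} := mmap (@mpolyC d.+1 'F_p) g.

Lemma evgX i : evg 'X_i = g i.
Proof. by rewrite [LHS]mmapX mmap1U. Qed.

Lemma evgC c : evg c%:MP = c%:MP.
Proof. exact: mmapC. Qed.

Local Notation I := (ideal_gen [set` par r g]).
Let hI : is_ideal I := ideal_gen_is_ideal _.

Lemma par_memP u : I u <-> exists (v : 'I_d -> S) h, u = \sum_i v i * g i + h * Fm.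
Proof.
split=> [/ideal_gen_seqP[c ->]|[v [h ->]]].
  rewrite size_par big_ord_recr /=; exists (fun i => c i), (c d).
  have sz : size [seq g i | i <- enum 'I_d] = d by rewrite size_map size_enum_ord.
  rewrite /par nth_rcons sz ltnn eqxx; congr (_ + _); apply: eq_bigr => i _.
  by rewrite nth_rcons sz ltn_ord (nth_map i) ?size_enum_ord // nth_ord_enum.
apply: (idealD hI); last first.
  by apply: (idealLM hI); apply: sub_ideal_gen; rewrite /= mem_rcons inE eqxx.
apply: (ideal_sum hI) => i _; apply: (idealLM hI); apply: sub_ideal_gen.
by rewrite /= mem_rcons inE; apply/orP; right; apply: map_f; rewrite mem_enum.
Qed.

Lemma par_homogP (D : nat) u : u \is D.-homog -> I u -> exists (v : 'I_d -> S) h,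
  u = \sum_i hc (D%:Z - e%:Z) (v i) * g i + h * Fm.
Proof.
move=> hu /par_memP[v [h E]]; exists v, (hc (D%:Z - r%:Z) h).
rewrite -{1}(hc_homog hu) {1}E hcD mulrC [in RHS]mulrC (hc_mul _ _ (fermat_poly_homog p d r)).
congr (_ + _); rewrite hc_sum; apply: eq_bigr => i _.
by have [hgi _ _] := hg; rewrite mulrC (hc_mul _ _ (hgi i)) mulrC.
Qed.

Lemma par_proper : ~ I 1.
Proof.
have h1 : (1 : S) \is 0.-homog by apply: dhomog1.
have [_ e0 _] := hg; move=> /(par_homogP h1)[v [h E]].
have {}e0 : (0 < e)%N by apply: (e0 (Ordinal (ltnW d_ge2))).
have hcneg k (w : S) : (0 < k)%N -> hc (0%:Z - k%:Z) w = 0.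
  by case: k => // k _; rewrite sub0r -NegzE.
have : hc 0 (1 : S) = 0.
  rewrite E hcD hc_sum big1 => [|i _]; last by rewrite hcneg // mul0r hc0.
  rewrite mulrC (hc_mul _ _ (fermat_poly_homog p d r)) hcneg ?mulr0 ?addr0 //.
  exact: ltnW.
by rewrite (hc_homog h1) => /eqP; rewrite oner_eq0.
Qed.

Section Choice.
Variable B : nat.
Hypothesis hB : forall m, (B <= mdeg m)%N -> I 'X_[m].
Local Notation T := 'X_{1..d.+1 < B}.

Definition indep (U : {set T}) := forall c : T -> 'F_p, (forall m : T, m \notin U -> c m = 0) ->
  I (\sum_(m : T) c m *: 'X_[m]) -> forall m : T, c m = 0.

Lemma exists_monomial_basis : exists U : {set T}, indep U /\
  forall u, exists2 c : T -> 'F_p, (forall m : T, m \notin U -> c m = 0) &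
    I (u - \sum_(m : T) c m *: 'X_[m]).
Proof.
have ind0 : `[< indep (finset.set0 : {set T}) >].
  by apply/asboolP => c hc _ m; apply: hc; rewrite inE.
pose U := [arg max_(U > (finset.set0 : {set T}) | `[< indep U >]) #|U|].
have [/asboolP indU maxU] : `[< indep U >] /\ forall V : {set T}, `[< indep V >] -> (#|V| <= #|U|)%N.
  by rewrite /U; case: arg_maxnP => // V hV h; split.
exists U; split=> //.
pose Sp u := exists2 c : T -> 'F_p, (forall m : T, m \notin U -> c m = 0) &
    I (u - \sum_(m : T) c m *: 'X_[m]).
have SpD u v : Sp u -> Sp v -> Sp (u + v).
  move=> [c c0 hc] [c' c0' hc']; exists (fun m => c m + c' m) => [m hm|].
    by rewrite c0 ?c0' ?addr0.
  have -> : \sum_m (c m + c' m) *: 'X_[m] = \sum_m c m *: 'X_[m] + \sum_(m : T) c' m *: 'X_[m] :> S.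
    by rewrite -big_split; apply: eq_bigr => m _; rewrite scalerDl.
  by rewrite opprD addrACA; apply: (idealD hI).
have SpZ a u : Sp u -> Sp (a *: u).
  move=> [c c0 hc]; exists (fun m => a * c m) => [m hm|]; first by rewrite c0 ?mulr0.
  have -> : a *: u - \sum_m (a * c m) *: 'X_[m] = a%:MP * (u - \sum_(m : T) c m *: 'X_[m]) :> S.
    rewrite mul_mpolyC scalerBr scaler_sumr; congr (_ - _).
    by apply: eq_bigr => m _; rewrite scalerA.
  exact: (idealLM hI).
have SpI u : I u -> Sp u.
  move=> Iu; exists (fun=> 0) => //; rewrite big1 ?subr0 // => m _; exact: scale0r.
suff SpX m : Sp 'X_[m].
  move=> u; rewrite -/(Sp u) [u]mpolyE; apply: (big_ind Sp) => [|//|m _]; last exact: SpZ.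
  by apply: SpI; apply: (ideal0 hI).
have [hm|hm] := ltnP (mdeg m) B; last by apply: SpI; apply: hB.
pose mb : T := BMultinom hm.
have [mU|mU] := boolP (mb \in U).
  exists (fun m' => (m' == mb)%:R) => [m' hm'|].
    by have [E|//] := eqVneq m' mb; rewrite E mU in hm'.
  rewrite (bigD1 mb) //= eqxx scale1r big1 ?addr0 ?subrr; first exact: (ideal0 hI).
  by move=> m' /negbTE ->; rewrite scale0r.
have : ~ indep (mb |: U).
  move=> /asboolP /maxU; rewrite cardsU1 mU; lia.
move=> /existsNP[c /not_implyP[c0 /not_implyP[hc /existsNP[m1 hm1]]]].
have cmb : c mb != 0.
  apply/eqP => E; apply: hm1; apply: indU => // m' hm'.
  have [->|ne] := eqVneq m' mb => //; apply: c0.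
  by rewrite !inE negb_or ne.
pose c' m' := if m' == mb then 0 else - (c mb)^-1 * c m'.
exists c' => [m' hm'|].
  rewrite /c'; have [//|ne] := eqVneq m' mb.
  suff -> : c m' = 0 by rewrite mulr0.
  by apply: c0; rewrite !inE negb_or ne.
have := idealLM hI (c mb)^-1%:MP hc.
rewrite mul_mpolyC scaler_sumr (bigD1 mb) //= scalerA mulVf // scale1r => h.
congr (I _): h; congr (_ + _); rewrite [in RHS](bigD1 mb) //=.
have -> : c' mb = 0 by rewrite /c' eqxx.
rewrite scale0r add0r -sumrN; apply: eq_bigr => m' /negbTE ne.
by rewrite /c' ne scalerA mulNr scaleNr opprK.
Qed.

End Choice.

(** The basis is taken among monomials so that it is homogeneous; monomials of large degree lie in
    I, so only finitely many compete. *)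
Lemma exists_residue_basis : exists (J : finType) (b : J -> 'X_{1..d.+1}),
  (forall u, exists c : J -> 'F_p, I (u - \sum_j c j *: 'X_[b j])) /\
  (forall c : J -> 'F_p, I (\sum_j c j *: 'X_[b j]) -> forall j, c j = 0).
Proof.
have [B hB] := par_top hg.
have [U [indU spU]] := exists_monomial_basis hB.
pose b (j : 'I_#|U|) : 'X_{1..d.+1} := enum_val j.
have sumU (c : 'X_{1..d.+1 < B} -> 'F_p) : (forall m : 'X_{1..d.+1 < B}, m \notin U -> c m = 0) ->
    \sum_m c m *: 'X_[m] = \sum_j c (enum_val j) *: 'X_[b j] :> S.
  move=> c0; rewrite -(big_enum_val (fun m => c m *: 'X_[m])) /= [RHS]big_mkcond.
  by apply: eq_bigr => m _; case: ifP => // /negbT /c0 ->; rewrite scale0r.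
exists 'I_#|U|, b; split=> [u|c hc j].
  have [c c0 hc] := spU u; exists (fun j => c (enum_val j)).
  by rewrite -sumU.
pose c' m := if [pick j | enum_val j == m] is Some j then c j else 0.
have E j' : c' (enum_val j') = c j'.
  rewrite /c'; case: pickP => [k /eqP /enum_val_inj -> //|/(_ j')].
  by rewrite eqxx.
rewrite -E; apply: indU.
  move=> m hm; rewrite /c'; case: pickP => // k /eqP E'.
  by rewrite -E' enum_valP in hm.
rewrite sumU; first by under eq_bigr do rewrite E.
move=> m hm; rewrite /c'; case: pickP => // k /eqP E'.
by rewrite -E' enum_valP in hm.
Qed.

Section Coordinates.
Variables (J : finType) (b : J -> 'X_{1..d.+1}).
Hypothesis spb : forall u, exists c : J -> 'F_p, I (u - \sum_j c j *: 'X_[b j]).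
Hypothesis indb : forall c : J -> 'F_p, I (\sum_j c j *: 'X_[b j]) -> forall j, c j = 0.
Local Notation K := (ideal_gen [set` [:: Fm]]).
Let hK : is_ideal K := ideal_gen_is_ideal _.

Definition expand (P : J -> {mpoly 'F_p[d]}) : S := \sum_j evg (P j) * 'X_[b j].

Lemma e_gt0 : (0 < e)%N.
Proof. by have [_ h _] := hg; apply: (h (Ordinal (ltnW d_ge2))). Qed.

Lemma hc_par t u : I u -> I (hc t u).
Proof.
apply: hc_ideal_gen => y; rewrite mem_rcons inE => /orP[/eqP ->|/mapP[i _ ->]].
  by exists r; apply: fermat_poly_homog.
by exists e; have [h _ _] := hg; apply: h.
Qed.

(** Graded Nakayama lemma: modulo I, u is a scalar combination of basis monomials of degree D, and
    the remainder is a combination of the g_i with coefficients of degree D - e. The record of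
    degrees later turns powers of the maximal ideal into weights. *)
Lemma graded_expand (D : nat) u : u \is D.-homog -> exists P : J -> {mpoly 'F_p[d]},
  (forall j be, (P j)@_be != 0 -> (mdeg be * e + mdeg (b j))%N = D) /\ K (u - expand P).
Proof.
have e0 := e_gt0.
elim/ltn_ind: D u => D IH u hu.
have [c hcu] := spb u.
pose c' j := if mdeg (b j) == D then c j else 0.
pose v := u - \sum_j c' j *: 'X_[b j].
have Ev : hc D (u - \sum_j c j *: 'X_[b j]) = v.
  rewrite hcB (hc_homog hu) hc_sum; congr (_ - _); apply: eq_bigr => j _.
  have hX : c j *: 'X_[b j] \is (mdeg (b j)).-homog by apply: rpredZ; rewrite dhomogX /=.
  rewrite /c'; have [E|ne] := eqVneq (mdeg (b j)) D; first by rewrite hc_homog // -E.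
  by rewrite (hc_homog_ne hX) ?scale0r // eqz_nat eq_sym.
have hv : v \is D.-homog.
  apply: rpredB => //; apply: rpred_sum => j _; rewrite /c'.
  have [<-|_] := eqVneq (mdeg (b j)) D; last by rewrite scale0r rpred0.
  by apply: rpredZ; rewrite dhomogX /=.
have Iv : I v by rewrite -Ev; apply: hc_par.
have [w [h Ew]] := par_homogP hv Iv.
have /choice[Q hQ] : forall i : 'I_d, exists P : J -> {mpoly 'F_p[d]},
    (forall j be, (P j)@_be != 0 -> (mdeg be * e + mdeg (b j) + e)%N = D) /\
    K (hc (D%:Z - e%:Z) (w i) - expand P).
  move=> i; have [le|lt] := leqP e D.
    rewrite subzn //.
    have hw : hc (D - e)%N (w i) \is (D - e).-homog by apply: pihomogP.
    have [|P [hP KP]] := IH (D - e)%N _ _ hw; first by lia.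
    exists P; split=> // j be /hP ->; exact: subnK.
  exists (fun=> 0); split=> [j be|]; first by rewrite mcoeff0 eqxx.
  have -> : D%:Z - e%:Z = Negz (e - D).-1 by lia.
  rewrite /expand big1 => [|j _]; last by rewrite rmorph0 mul0r.
  by rewrite /= subr0; apply: ideal0.
exists (fun j => (c' j)%:MP + \sum_i Q i j * 'X_i); split=> [j be|].
  rewrite mcoeffD mcoeffC raddf_sum /= => hne.
  have [E|ne] := eqVneq be 0%MM.
    rewrite E mdeg0 mul0n add0n; move: hne; rewrite E eqxx mulr1 big1 ?addr0 => [|i _].
      by rewrite /c'; have [//|_] := eqVneq (mdeg (b j)) D; rewrite eqxx.
    rewrite mulrC mcoeffXM lep1mP mnm0E eqxx //.
  rewrite (negbTE ne) mulr0 add0r in hne.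
  have [i hi] : exists i, (Q i j * 'X_i)@_be != 0.
    apply: contrapT => /forallNP h0; move: hne; rewrite big1 ?eqxx // => i _.
    by apply/eqP/negPn/negP/h0.
  move: hi; rewrite mulrC mcoeffXM lep1mP; case: ifP => [hi|_]; last by rewrite eqxx.
  have [hQ1 _] := hQ i; move=> /hQ1 <-.
  have le : (U_(i) <= be)%MM by rewrite lep1mP hi.
  by rewrite -{1}(submK le) mdegD mdeg1 mulnDl mul1n addnAC.
have -> : u - expand (fun j => (c' j)%:MP + \sum_i Q i j * 'X_i) =
  \sum_i g i * (hc (D%:Z - e%:Z) (w i) - expand (Q i)) + h * Fm.
  have -> : expand (fun j => (c' j)%:MP + \sum_i Q i j * 'X_i) =
      \sum_j c' j *: 'X_[b j] + \sum_i g i * expand (Q i).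
    rewrite /expand.
    have E j : evg ((c' j)%:MP + \sum_i Q i j * 'X_i) * 'X_[b j] =
        c' j *: 'X_[b j] + \sum_i g i * (evg (Q i j) * 'X_[b j]).
      rewrite (rmorphD evg) (rmorph_sum evg) evgC mulrDl mul_mpolyC; congr (_ + _).
      rewrite mulr_suml; apply: eq_bigr => i _.
      by rewrite (rmorphM evg) evgX mulrAC mulrC.
    transitivity (\sum_j (c' j *: 'X_[b j] + \sum_i g i * (evg (Q i j) * 'X_[b j]))).
      by apply: eq_bigr => j _; apply: E.
    rewrite big_split /=; congr (_ + _).
    rewrite exchange_big /=.
    by apply: eq_bigr => i _; rewrite mulr_sumr.
  have -> : \sum_i g i * (hc (D%:Z - e%:Z) (w i) - expand (Q i)) =
      \sum_i hc (D%:Z - e%:Z) (w i) * g i - \sum_i g i * expand (Q i).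
    by rewrite -sumrB; apply: eq_bigr => i _; rewrite mulrBr [g i * hc _ _]mulrC.
  by rewrite addrAC -Ew opprD addrA.
apply: (idealD hK); last by apply: (idealLM hK); apply: sub_ideal_gen; rewrite /= inE.
by apply: (ideal_sum hK) => i _; apply: (idealLM hK); have [] := hQ i.
Qed.

End Coordinates.
End FreeBasis.

(** * Linear independence of the basis monomials over the parameters *)

Section Independence.
Variables (p d r e : nat).
Hypotheses (p_prime : prime p) (r_ge2 : (2 <= r)%N) (d_ge2 : (2 <= d)%N).
Local Notation S := {mpoly 'F_p[d.+1]}.
Local Notation Fm := (fermat_poly p d r).
Implicit Types (u v : S).

Variable g : 'I_d -> S.
Hypothesis hg : params r g (fun=> e).
Variables (J : finType) (b : J -> 'X_{1..d.+1}).
Local Notation I := (ideal_gen [set` par r g]).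
Hypothesis indb : forall c : J -> 'F_p, I (\sum_j c j *: 'X_[b j]) -> forall j, c j = 0.

Lemma expandD P Q : expand g b (fun j => P j + Q j) = expand g b P + expand g b Q.
Proof.
rewrite /expand -big_split; apply: eq_bigr => j _ /=.
by rewrite (rmorphD (evg g)) mulrDl.
Qed.

Lemma expandM q P : expand g b (fun j => q * P j) = evg g q * expand g b P.
Proof.
rewrite /expand [RHS]mulr_sumr; apply: eq_bigr => j _.
by rewrite (rmorphM (evg g)) mulrA.
Qed.

Lemma drop_par (l : 'I_d) : drop l (par r g) = g l :: drop l.+1 (par r g).
Proof.
have sz : size [seq g i | i <- enum 'I_d] = d by rewrite size_map size_enum_ord.
rewrite (drop_nth 0) ?size_par ?ltnS 1?ltnW // /par nth_rcons sz ltn_ord.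
by rewrite (nth_map l) ?size_enum_ord // nth_ord_enum.
Qed.

Lemma rev_regular_drop (T : comNzRingType) k (s : seq T) : rev_regular s -> rev_regular (drop k s).
Proof. by elim: s k => [|x s IH] [|k] //= [_ h]; apply: IH. Qed.

(* Induction on the number k of variables allowed in P: setting the last one to
   0 amounts to adding g_(k-1) to the ideal, and g_(k-1) is a nonzerodivisor
   modulo the remaining parameters. *)
Lemma expand_partial_inj (k : nat) (B : nat) (P : J -> {mpoly 'F_p[d]}) : (k <= d)%N ->
  (forall j m, (P j)@_m != 0 -> (mdeg m < B)%N) ->
  (forall j (l : 'I_d), (k <= l)%N -> xfree l (P j)) ->
  ideal_gen [set` drop k (par r g)] (expand g b P) -> forall j, P j = 0.
Proof.
elim: k B P => [|k IHk] B P.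
  move=> _ _ free; rewrite drop0 => hP j.
  have Pc j' : P j' = ((P j')@_0)%:MP.
    apply/mpolyP => m; rewrite mcoeffC; have [<-|ne] := eqVneq 0%MM m; first by rewrite mulr1.
    rewrite mulr0; apply/eqP/negPn/negP => hm; move/eqP: ne; apply.
    by apply/mnmP => l; rewrite mnm0E (free j' l).
  rewrite Pc (indb (c := fun j' => (P j')@_0)) ?mpolyC0 //.
  move: hP; congr (I _); apply: eq_bigr => j' _.
  by rewrite {1}Pc evgC mul_mpolyC.
move=> kd; pose l : 'I_d := Ordinal kd.
elim: B P => [|B IHB] P hB free hP.
  move=> j; apply/mpolyP => m; rewrite mcoeff0; apply/eqP/negPn/negP => /hB.
  by rewrite ltn0.
have /choice[P0 /choice[P1 hs]] := fun j => mpoly_split_var l (P j).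
have EP : P = fun j => P0 j + 'X_l * P1 j by apply/funext => j; have [] := hs j.
have EX : expand g b P = expand g b P0 + g l * expand g b P1.
  by rewrite EP expandD expandM evgX.
have [reg _] : rev_regular (g l :: drop l.+1 (par r g)).
  by rewrite -drop_par; apply/rev_regular_drop/(par_regular r_ge2 hg).
have h0 : forall j, P0 j = 0.
  apply: (IHk B.+1 P0) => [|j m|j l' hl'|]; first exact: ltnW.
  - by have [_ _ h _] := hs j; move=> /h /hB.
  - have [_ f0 h _] := hs j; have [-> //|ne] := eqVneq l' l.
    move=> m /h; apply: free; rewrite ltn_neqAle hl' andbT eq_sym.
    by apply: contra ne => /eqP E; apply/eqP/val_inj.
  - rewrite (drop_par l) ideal_gen_cons; exists (- expand g b P1), (expand g b P).
    by split=> //; rewrite EX mulNr [g l * _]mulrC addrC addrK.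
have h1 : forall j, P1 j = 0.
  apply: (IHB P1) => [j m|j l' hl' m|].
  - by have [_ _ _ ->] := hs j; move=> /hB; rewrite mdegD mdeg1 addn1.
  - by have [_ _ _ ->] := hs j; move=> /(free j l' hl'); rewrite mnmDE => /eqP; rewrite addn_eq0 => /andP[/eqP].
  apply: reg; move: hP; rewrite EX; congr (ideal_gen _ _).
  by rewrite [expand g b P0]big1 ?add0r // => j _; rewrite h0 rmorph0 mul0r.
by move=> j; rewrite EP h0 h1 mulr0 addr0.
Qed.

Lemma expand_inj (P : J -> {mpoly 'F_p[d]}) :
  ideal_gen [set` [:: Fm]] (expand g b P) -> forall j, P j = 0.
Proof.
move=> hP; apply: (@expand_partial_inj d (\max_j msize (P j))) => // [j m hm|j l|].
- apply: leq_trans (leq_bigmax j); apply: msize_mdeg_lt.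
  by rewrite mcoeff_msupp.
- by rewrite leqNgt ltn_ord.
- have sz : size [seq g i | i <- enum 'I_d] = d by rewrite size_map size_enum_ord.
  by rewrite /par -cats1 drop_cat sz ltnn subnn.
Qed.

End Independence.

(** * Coordinates in the Fermat ring *)

Section WeightedCoordinates.
Variables (F : finFieldType) (A : comNzRingType) (kap : {rmorphism F -> A}).
Variables (D : nat) (th : 'I_D -> A) (J : finType) (w : J -> A).
Local Notation pc := (pcombine kap th w).
Implicit Types (W : J -> 'X_{1..D} -> Prop) (V : 'X_{1..D} -> Prop).

(** Common form of the powers of J, their tight closures and the ideals of powers of parameters: the
    span of the th^m w_j selected by W, where membership is read off coordinates. *)
Definition weighted W : set A :=
  [set x | exists2 P, pc P = x & forall j m, (P j)@_m != 0 -> W j m].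

Lemma weighted0 W : weighted W 0.
Proof.
exists (fun=> 0) => [|j m]; last by rewrite mcoeff0 eqxx.
by rewrite /pcombine big1 // => j _; rewrite mmap0 mul0r.
Qed.

Lemma weightedD W x y : weighted W x -> weighted W y -> weighted W (x + y).
Proof.
move=> [P <- hP] [Q <- hQ]; exists (fun j => P j + Q j); first exact: pcombineD.
move=> j m; rewrite mcoeffD => h; have [E|] := eqVneq ((P j)@_m) 0; last exact: hP.
by apply: hQ; rewrite E add0r in h.
Qed.

Lemma weighted_sum W (T : Type) (s : seq T) (Q : pred T) (G : T -> A) :
  (forall i, Q i -> weighted W (G i)) -> weighted W (\sum_(i <- s | Q i) G i).
Proof.
move=> h; apply: (big_ind (weighted W)) => //; [exact: weighted0 | exact: weightedD].
Qed.

Lemma weighted_mono W W' : (forall j m, W j m -> W' j m) -> weighted W `<=` weighted W'.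
Proof. by move=> h x [P <- hP]; exists P => // j m /hP /h. Qed.

Lemma weighted_min W L : is_ideal L ->
  (forall j m, W j m -> L (mmap1 th m * w j)) -> weighted W `<=` L.
Proof.
move=> hL h x [P <- hP]; apply: (ideal_sum hL) => j _.
rewrite /mmap mulr_suml big_seq; apply: (ideal_sum hL) => m hm.
by rewrite -mulrA; apply/(idealLM hL)/h/hP; rewrite -mcoeff_msupp.
Qed.

Hypothesis pc_surj : forall x, exists P, pc P = x.

Lemma weighted_ideal V : (forall m m', V m -> V (m + m')%MM) -> is_ideal (weighted (fun=> V)).
Proof.
move=> Vup; split; [exact: weighted0 | exact: weightedD |].
move=> a _ [P <- hP]; rewrite /pcombine mulr_sumr; apply: weighted_sum => j _.
have [Q EQ] := pc_surj (a * w j); rewrite mulrCA -EQ -pcombineM.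
exists (fun l => P j * Q l) => // l m /mcoeffM_support[m1 [m2 [h1 h2 ->]]].
exact/Vup/(hP j).
Qed.

Hypothesis pc_inj : forall P, pc P = 0 -> forall j, P j = 0.

Lemma pcombine_eq P Q : pc P = pc Q -> P = Q.
Proof.
move=> E; apply/funext => j; apply/eqP; rewrite -subr_eq0; apply/eqP.
apply: (pc_inj (P := fun j => P j - Q j)).
have -> : (fun j => P j - Q j) = (fun j => P j + (-1) * Q j).
  by apply/funext => l; rewrite mulN1r.
by rewrite pcombineD pcombineM (rmorphN1 (mmap kap th : {rmorphism _ -> _})) mulN1r E subrr.
Qed.

Lemma weightedP W P : weighted W (pc P) <-> forall j m, (P j)@_m != 0 -> W j m.
Proof. by split=> [[Q /pcombine_eq ->]|h] //; exists P. Qed.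

End WeightedCoordinates.

(** * Transfer along a surjection S -> R with kernel (F) *)

Section SurjectionFromPolynomials.
Variables (p d r : nat).
Hypotheses (p_prime : prime p) (r_ge2 : (2 <= r)%N) (p_ndvd_r : ~~ (p %| r)%N).
Hypothesis d_ge2 : (2 <= d)%N.
Local Notation S := {mpoly 'F_p[d.+1]}.
Local Notation Fm := (fermat_poly p d r).
Local Notation K := (ideal_gen [set` [:: Fm]]).
Variables (R : comNzRingType) (pi : {rmorphism S -> R}).
Hypotheses (pi_surj : forall x, exists u, pi u = x) (pi_ker : forall u, pi u = 0 <-> K u).
Implicit Types (u v : S) (y : 'I_d -> S).

Lemma pi_fermat : pi Fm = 0.
Proof. by apply/pi_ker; apply: sub_ideal_gen; apply: mem_head. Qed.

Lemma ideal_gen_pi (ys : seq S) u :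
  ideal_gen [set` map pi ys] (pi u) <-> ideal_gen [set` rcons ys Fm] u.
Proof.
have hI := ideal_gen_is_ideal [set` rcons ys Fm].
have hL := ideal_gen_is_ideal [set` map pi ys].
split; last first.
  move: u; apply: (ideal_gen_min (I := [set u | ideal_gen [set` map pi ys] (pi u)])) => [|u].
    split=> [|u v hu hv|a u hu] /=; first by rewrite rmorph0; apply: ideal0.
      by rewrite rmorphD; apply: (idealD hL).
    by rewrite rmorphM; apply: (idealLM hL).
  rewrite /= mem_rcons inE => /orP[/eqP ->|hu]; first by rewrite pi_fermat; apply: ideal0.
  by apply: sub_ideal_gen; apply: map_f.
suff h x : ideal_gen [set` map pi ys] x -> exists2 v, pi v = x & ideal_gen [set` rcons ys Fm] v.
  move=> /h[v E hv]; apply: (idealDr hI (y := v - u)); last by rewrite addrC subrK.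
  have /pi_ker : pi (v - u) = 0 by rewrite rmorphB E subrr.
  apply: ideal_gen_min => // z; rewrite /= inE => /eqP ->.
  by apply: sub_ideal_gen; rewrite /= mem_rcons inE eqxx.
move: x; apply: (ideal_gen_min (I := [set x | exists2 v, pi v = x & ideal_gen [set` rcons ys Fm] v])).
  split=> [|_ _ [u1 <- h1] [u2 <- h2]|a _ [v <- hv]].
  - by exists 0; [rewrite rmorph0 | apply: ideal0].
  - by exists (u1 + u2); [rewrite rmorphD | apply: (idealD hI)].
  - have [b <-] := pi_surj a; exists (b * v); [by rewrite rmorphM | exact: (idealLM hI)].
move=> _ /= /mapP[v hv ->]; exists v => //.
by apply: sub_ideal_gen; rewrite /= mem_rcons inE hv orbT.
Qed.

Lemma range_pi y : [set` map pi [seq y i | i <- enum 'I_d]] = range (fun i => pi (y i)).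
Proof.
apply/seteqP; split=> [_ /= /mapP[_ /mapP[i _ ->] ->]|_ [i _ <-]]; first by exists i.
by apply/map_f/map_f; rewrite mem_enum.
Qed.

Lemma ideal_gen_par y u : ideal_gen (range (fun i => pi (y i))) (pi u) <-> ideal_gen [set` par r y] u.
Proof. by rewrite -range_pi; apply: ideal_gen_pi. Qed.

Definition irrelevant : set R := ideal_gen [set pi 'X_i | i in [set: 'I_d.+1]].

Lemma irrelevant_pow N x : ideal_pow irrelevant N x <->
  exists2 u, (forall m, u@_m != 0 -> (N <= mdeg m)%N) & pi u = x.
Proof.
pose L N := [set x | exists2 u, (forall m, u@_m != 0 -> (N <= mdeg m)%N) & pi u = x].
have hL k : is_ideal (L k).
  split=> [|_ _ [u1 h1 <-] [u2 h2 <-]|a _ [u hu <-]].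
  - by exists 0; [move=> m; rewrite mcoeff0 eqxx | rewrite rmorph0].
  - exists (u1 + u2); last by rewrite rmorphD.
    move=> m; rewrite mcoeffD => h; have [E|] := eqVneq (u1@_m) 0; last exact: h1.
    by apply: h2; rewrite E add0r in h.
  - have [b <-] := pi_surj a; exists (b * u); last by rewrite rmorphM.
    move=> m /mcoeffM_support[m1 [m2 [_ h ->]]]; rewrite mdegD.
    by apply: leq_trans (hu _ h) _; apply: leq_addl.
split.
  elim: N x => [|N IH] x /=; first by have [u <-] := pi_surj x; exists u.
  apply: (ideal_mul_min (hL N.+1)) => {}x z hx /IH hz.
  move: x hx; apply: (ideal_gen_min (colon_is_ideal z (hL N.+1))) => _ [i _ <-].
  have [u hu <-] := hz; exists ('X_i * u); last by rewrite rmorphM.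
  move=> m; rewrite mcoeffXM lep1mP; case: ifP => [hi|_]; last by rewrite eqxx.
  have le : (U_(i) <= m)%MM by rewrite lep1mP hi.
  by move=> /hu h; rewrite -(submK le) mdegD mdeg1 addn1.
move=> [u hu <-]; have hI := ideal_pow_is_ideal irrelevant N.
rewrite [u]mpolyE rmorph_sum big_seq; apply: (ideal_sum hI) => m hm.
rewrite -mul_mpolyC rmorphM; apply: (idealLM hI).
have {hm hu} : (N <= mdeg m)%N by apply: hu; rewrite -mcoeff_msupp.
elim: N m {hI} => [|N IH] m //= hN.
have [i hi] : exists i, m i != 0%N.
  apply: contrapT => /forallNP h; suff E : m = 0%MM by rewrite E mdeg0 in hN.
  by apply/mnmP => i; rewrite mnm0E; apply/eqP/negPn/negP/h.
have le : (U_(i) <= m)%MM by rewrite lep1mP.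
rewrite -(submK le) mpolyXD rmorphM mulrC; apply: ideal_mul_in.
  by apply: sub_ideal_gen; exists i.
by apply: IH; move: hN; rewrite -{1}(submK le) mdegD mdeg1 addn1.
Qed.

(** R is reduced, so elements of R^0 are nonzerodivisors. *)
Lemma off_minimal_primes_pi u : off_minimal_primes (pi u) -> forall v, K (u * v) -> K v.
Proof.
move=> hu v /pi_ker; rewrite rmorphM => E; apply/pi_ker.
apply: (off_minimal_primes_regular _ hu) E => x n; have [z <-] := pi_surj x.
rewrite -rmorphXn => /pi_ker h; apply/pi_ker.
by apply: (fermat_reduced p_prime r_ge2 p_ndvd_r (ltnW d_ge2)) h.
Qed.

Lemma var_off_minimal_primes i k : off_minimal_primes (pi ('X_i ^+ k)).
Proof.
apply: nonzerodivisor_off_minimal_primes => x; have [z <-] := pi_surj x.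
rewrite -rmorphM => /pi_ker h; apply/pi_ker.
exact: (var_nonzerodivisor r_ge2 (ltnW d_ge2)) h.
Qed.

End SurjectionFromPolynomials.

(** * Reduction number of the irrelevant ideal *)

Lemma ideal_pow_pow (A : comPzRingType) (I : set A) a n :
  ideal_pow (ideal_pow I a) n = ideal_pow I (a * n).
Proof.
elim: n => [|n IH]; first by rewrite muln0.
by rewrite /= IH ideal_pow_add mulnS.
Qed.

Lemma ideal_pow_expr (A : comPzRingType) (I : set A) x n : I x -> ideal_pow I n (x ^+ n).
Proof. by move=> Ix; elim: n => [|n IH] //=; rewrite exprS; apply: ideal_mul_in. Qed.

Lemma ideal_pow_mem_mul (A : comPzRingType) (I : set A) m n x y :
  ideal_pow I m x -> ideal_pow I n y -> ideal_pow I (m + n) (x * y).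
Proof. by move=> hx hy; rewrite -ideal_pow_add; apply: ideal_mul_in. Qed.

Lemma ideal_pow_decr (A : comPzRingType) (I : set A) m n : (m <= n)%N ->
  ideal_pow I n `<=` ideal_pow I m.
Proof.
move=> le; rewrite -(subnK le) -ideal_pow_add.
by apply: ideal_mul_min (ideal_pow_is_ideal I m) _ => x y _; apply: idealLM (ideal_pow_is_ideal I m) _ _.
Qed.

Lemma mmap1_ideal_pow (A : comNzRingType) n (h : 'I_n -> A) (m : 'X_{1..n}) :
  ideal_pow (ideal_gen (range h)) (mdeg m) (mmap1 h m).
Proof.
rewrite /mmap1 mdegE.
have : forall s : seq 'I_n, ideal_pow (ideal_gen (range h)) (\sum_(i <- s) m i) (\prod_(i <- s) h i ^+ m i).
  elim=> [|i s IH]; first by rewrite !big_nil.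
  rewrite !big_cons; apply: ideal_pow_mem_mul IH; apply: ideal_pow_expr.
  by apply: sub_ideal_gen; exists i.
by apply.
Qed.

Section TightClosureOfPowers.
Variables (p d r e : nat).
Hypotheses (p_prime : prime p) (r_ge2 : (2 <= r)%N) (p_ndvd_r : ~~ (p %| r)%N).
Hypothesis d_ge2 : (2 <= d)%N.
Hypothesis p_gt : (d%:Z - 1) * r%:Z - d%:Z < p%:Z.
Local Notation S := {mpoly 'F_p[d.+1]}.
Local Notation Fm := (fermat_poly p d r).
Variables (R : comNzRingType) (pi : {rmorphism S -> R}).
Hypotheses (pi_surj : forall x, exists u, pi u = x).
Hypothesis pi_ker : forall u, pi u = 0 <-> ideal_gen [set` [:: Fm]] u.
Variable g : 'I_d -> S.
Hypothesis hg : params r g (fun=> e).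
Implicit Types (u v : S).

Local Notation f := (fun i => pi (g i)).
Local Notation J := (ideal_gen (range f)).
Local Notation mm := (irrelevant pi).
Let e0 : (0 < e)%N := e_gt0 d_ge2 hg.
Let hJ : is_ideal J := ideal_gen_is_ideal _.

Lemma irrelevant_homog (D N : nat) u : u \is D.-homog -> (N <= D)%N -> ideal_pow mm N (pi u).
Proof.
move=> hu le; apply/(irrelevant_pow pi_surj); exists u => // m hm.
by move/dhomogP: hu => /(_ m); rewrite mcoeff_msupp => /(_ hm) /= ->.
Qed.

Lemma hc_homog_mem (t : nat) u : hc t u \is t.-homog.
Proof. exact: pihomogP. Qed.

Lemma irrelevant_pow_hc N x : ideal_pow mm N x -> exists k (u : nat -> S),
  x = \sum_(t < k) pi (u t) /\
  forall t, u t \is t.-homog /\ ((t < N)%N -> u t = 0).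
Proof.
move=> /(irrelevant_pow pi_surj)[u hu <-]; exists (msize u), (fun t => hc t u).
split; first by rewrite {1}(hc_partition u) rmorph_sum.
move=> t; split=> [|lt]; first exact: hc_homog_mem.
have -> : u = \sum_(k < msize u) hc (k : nat) u by apply: hc_partition.
apply/mpolyP => m; rewrite mcoeff0 -hc_partition.
rewrite /= pihomogE raddf_sum big1_seq //= => m' /andP[/eqP dm' hm'].
by move: (hu m'); rewrite -mcoeff_msupp => /(_ hm'); rewrite dm' leqNgt lt.
Qed.

Lemma J_sub_irrelevant : J `<=` ideal_pow mm e.
Proof.
apply: ideal_gen_min; first exact: ideal_pow_is_ideal.
by move=> _ [i _ <-]; have [h _ _] := hg; apply: irrelevant_homog (h i) _.
Qed.

Lemma irrelevant_pow_step (k : nat) : (d * e + r <= k.+1 * e + d)%N ->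
  ideal_mul J (ideal_pow mm (e * k)) = ideal_pow mm (e * k.+1).
Proof.
move=> hk; rewrite mulnS -ideal_pow_add; apply/seteqP; split.
  apply: ideal_mul_min => [|x y /J_sub_irrelevant hx hy]; first exact: ideal_gen_is_ideal.
  exact: ideal_mul_in.
rewrite ideal_pow_add -mulnS => x /irrelevant_pow_hc[n [u [-> hu]]].
have hI := ideal_gen_is_ideal [set x | exists y z, [/\ J y, ideal_pow mm (e * k) z & x = y * z]].
apply: (ideal_sum hI) => t _; have [ht lt] := hu t.
have [/lt ->|le] := ltnP t (e * k.+1); first by rewrite rmorph0; apply: (ideal0 hI).
have It : ideal_gen [set` par r g] (u t).
  apply: (par_vanish r_ge2 hg ht); rewrite sum_nat_const card_ord addnS ltnS.
  by apply: leq_trans hk _; rewrite leq_add2r mulnC.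
have [v [h ->]] := par_homogP hg ht It.
rewrite rmorphD rmorphM (pi_fermat pi_ker) mulr0 addr0 rmorph_sum.
apply: (ideal_sum hI) => i _; rewrite rmorphM mulrC; apply: ideal_mul_in.
  by apply: sub_ideal_gen; exists i.
have et : (e <= t)%N by apply: leq_trans le; rewrite mulnS leq_addr.
rewrite subzn //; apply: (irrelevant_homog (hc_homog_mem _ _)).
by rewrite leq_subRL // -mulnS.
Qed.

Lemma irrelevant_pow_not_sub (D : nat) : (D + d.+1 <= d * e + r)%N ->
  ~ (ideal_pow mm D `<=` J).
Proof.
move=> hD sub; apply: (par_proper r_ge2 d_ge2 hg).
apply: (par_socle r_ge2 hg (D := 0) (N := D)) => [|m dm|j lt]; first exact: dhomog1.
  rewrite mulr1 -(ideal_gen_par pi_surj pi_ker); apply: sub.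
  by apply: (irrelevant_homog (D := D)) => //; rewrite dhomogX /= dm.
by rewrite sum_nat_const card_ord add0n neq_ltn (leq_trans _ hD) // ltn_add2r.
Qed.

Lemma irrelevant_pow_reduction (a : int) : a = ((r%:Z - 1 - d%:Z) %/ e%:Z)%Z ->
  exists2 k : nat, is_reduction_number J (ideal_pow mm e) k & k%:Z = a + d%:Z.
Proof.
move=> Ea; have ez : e%:Z != 0 by rewrite eqz_nat -lt0n.
have lb : a * e%:Z <= r%:Z - 1 - d%:Z by rewrite Ea lez_floor.
have ub : r%:Z - 1 - d%:Z < (a + 1) * e%:Z by rewrite Ea ltz_ceil.
have ad0 : 0 < a + d%:Z.
  have h : (1 - d%:Z) * e%:Z <= 1 - d%:Z by rewrite -[leRHS]mulr1; nia.
  have : (1 - d%:Z) * e%:Z < (a + 1) * e%:Z by apply: le_lt_trans h _; lia.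
  by rewrite ltr_pM2r; lia.
have [k Ek] : exists k : nat, k%:Z = a + d%:Z by exists (absz (a + d%:Z)); lia.
have Ea' : a = k%:Z - d%:Z by lia.
rewrite Ea' in lb ub.
exists k; last by rewrite Ek.
split=> [n kn|l hl].
  rewrite !ideal_pow_pow; apply: irrelevant_pow_step.
  have h : (k.+1 * e <= n.+1 * e)%N by rewrite leq_mul2r ltnS kn orbT.
  suff : (d * e + r <= k.+1 * e + d)%N by move=> h'; apply: leq_trans h' _; rewrite leq_add2r.
  by move: ub; rewrite mulrDl mulrBl mul1r mulSn -!PoszM; lia.
rewrite leqNgt; apply/negP => lk.
have k0 : (0 < k)%N by lia.
(* If k - 1 satisfied the condition, the power e k of the maximal ideal would lie in J. *)
have := hl k.-1; rewrite -ltnS prednK // => /(_ lk).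
rewrite !ideal_pow_pow => E.
apply: (@irrelevant_pow_not_sub (e * k)).
  by move: lb; rewrite mulrBl -!PoszM [(e * k)%N]mulnC; lia.
rewrite -E; apply: (ideal_mul_min hJ) => x y hx _.
exact: (idealRM hJ).
Qed.

End TightClosureOfPowers.

(** * Tight closure of the powers of J *)

Section TightClosure.
Variables (p d r e : nat).
Hypotheses (p_prime : prime p) (r_ge2 : (2 <= r)%N) (p_ndvd_r : ~~ (p %| r)%N).
Hypothesis d_ge2 : (2 <= d)%N.
Hypothesis p_gt : (d%:Z - 1) * r%:Z - d%:Z < p%:Z.
Local Notation S := {mpoly 'F_p[d.+1]}.
Local Notation Fm := (fermat_poly p d r).
Variables (R : comNzRingType) (pi : {rmorphism S -> R}).
Hypotheses (pi_surj : forall x, exists u, pi u = x).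
Hypothesis pi_ker : forall u, pi u = 0 <-> ideal_gen [set` [:: Fm]] u.
Hypothesis pcharR : p \in [pchar R].
Variable g : 'I_d -> S.
Hypothesis hg : params r g (fun=> e).
Implicit Types (u v : S).

Local Notation f := (fun i => pi (g i)).
Local Notation J := (ideal_gen (range f)).
Local Notation mm := (irrelevant pi).
Let e0 : (0 < e)%N := e_gt0 d_ge2 hg.

(** Each application of [par_vanish] splits off one parameter and lowers the degree by E. The
    summand r in the bound is supplied by the test multiplier X_0^r. *)
Lemma pow_vanish (y : 'I_d -> S) E n (D : nat) v : params r y (fun=> E) -> v \is D.-homog ->
  ((n + d) * E + r <= D)%N -> ideal_pow (ideal_gen (range (fun i => pi (y i)))) n.+1 (pi v).
Proof.
move=> hy; elim: n D v => [|n IH] D v hv hD;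
  have hI := ideal_pow_is_ideal (ideal_gen (range (fun i => pi (y i)))).
  have : ideal_gen [set` par r y] v.
    apply: (par_vanish r_ge2 hy hv); rewrite sum_nat_const card_ord addnS ltnS.
    by apply: leq_trans hD _; rewrite leq_addr.
  move=> /(ideal_gen_par pi_surj pi_ker) h; rewrite /= -[pi v]mulr1.
  exact: ideal_mul_in.
have Iv : ideal_gen [set` par r y] v.
  apply: (par_vanish r_ge2 hy hv); rewrite sum_nat_const card_ord addnS ltnS.
  apply: leq_trans (leq_addr _ _); apply: leq_trans hD; rewrite leq_add2r leq_mul2r.
  by rewrite leq_addl orbT.
have [w [h ->]] := par_homogP hy hv Iv.
rewrite rmorphD rmorphM (pi_fermat pi_ker) mulr0 addr0 rmorph_sum.
apply: (ideal_sum (hI n.+2)) => i _; rewrite rmorphM mulrC; apply: ideal_mul_in.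
  by apply: sub_ideal_gen; exists i.
have ED : (E <= D)%N by apply: leq_trans hD; rewrite addSn mulSn -addnA leq_addr.
rewrite subzn //; apply: (IH (D - E)%N); first exact: hc_homog_mem.
by rewrite leq_subRL // addnA -mulSn -addSn.
Qed.

Lemma pow_frobenius_sub k n (cs : seq R) : ideal_pow J n = ideal_gen [set` cs] ->
  ideal_pow (ideal_gen (range (fun i => pi (g i ^+ (p ^ k)%N)))) n `<=`
  ideal_gen [set c ^+ (p ^ k)%N | c in [set` cs]].
Proof.
elim: n cs => [|n IH] cs Ecs.
  move=> x _; have h1 : ideal_gen [set` cs] 1 by rewrite -Ecs.
  have := @frobenius_gen_mem _ _ pcharR _ k _ h1; rewrite expr1n => h.
  by rewrite -[x]mulr1; apply: (idealLM (ideal_gen_is_ideal _)).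
have [bs Ebs] := tc_fg f n; have {}IH := IH _ Ebs.
have hL := ideal_gen_is_ideal [set c ^+ (p ^ k)%N | c in [set` cs]].
apply: (ideal_mul_min hL) => x y hx /IH hy; move: x hx.
apply: (ideal_gen_min (colon_is_ideal y hL)) => _ [i _ <-] /=.
rewrite mulrC; move: y hy.
apply: (ideal_gen_min (colon_is_ideal _ hL)) => _ [b hb <-] /=.
have hb' : ideal_pow J n b by rewrite Ebs; apply: sub_ideal_gen.
rewrite rmorphXn -exprMn; apply: (frobenius_gen_mem pcharR).
rewrite -Ecs mulrC; apply: (ideal_mul_in _ hb').
by apply: sub_ideal_gen; exists i.
Qed.

Lemma irrelevant_pow_sub_tight n : ideal_pow mm ((n + d) * e) `<=` tight_closure p (ideal_pow J n.+1).
Proof.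
have [cs Ecs] := tc_fg f n.+1.
have hT : is_ideal (tight_closure p (ideal_pow J n.+1)).
  by rewrite Ecs; apply: tight_closure_is_ideal.
move=> x /(irrelevant_pow_hc pi_surj)[k [u [-> hu]]].
apply: (ideal_sum hT) => t _; have [ht lt] := hu t.
have [/lt ->|le] := ltnP t ((n + d) * e); first by rewrite rmorph0; apply: (ideal0 hT).
exists (pi ('X_ord0 ^+ r)).
  exact: (var_off_minimal_primes r_ge2 d_ge2 pi_surj pi_ker).
exists 0%N => l _; rewrite Ecs (frobenius_powerE pcharR) -rmorphXn -rmorphM.
apply: (pow_frobenius_sub (n := n.+1)) => //.
have hy := params_expr p_prime (a := fun=> (p ^ l)%N) hg (fun _ => _).
apply: (pow_vanish (E := e * p ^ l) (D := r + t * p ^ l)).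
- by apply: hy; rewrite expn_gt0 prime_gt0.
- apply: dhomogM; last exact: dhomogMn.
  by rewrite mpolyXn dhomogX /= mdegMn mdeg1 mul1n.
- by rewrite addnC leq_add2l mulnA leq_mul2r le orbT.
Qed.

Section Coordinates.
Variables (B : finType) (b : B -> 'X_{1..d.+1}).
Hypothesis spb : forall u, exists c : B -> 'F_p,
  ideal_gen [set` par r g] (u - \sum_j c j *: 'X_[b j]).
Hypothesis indb : forall c : B -> 'F_p,
  ideal_gen [set` par r g] (\sum_j c j *: 'X_[b j]) -> forall j, c j = 0.

Definition scalar_map : {rmorphism 'F_p -> R} := pi \o @mpolyC d.+1 'F_p.
Definition basis_image j : R := pi 'X_[b j].
Local Notation pc := (pcombine scalar_map f basis_image).
Local Notation weighted := (weighted scalar_map f basis_image).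

Lemma mmap_pi q : mmap scalar_map f q = pi (evg g q).
Proof.
pose f1 : {rmorphism {mpoly 'F_p[d]} -> R} := mmap scalar_map f.
apply: (mpoly_rmorph_ext (f1 := f1) (f2 := pi \o evg g)) => [c|i] /=.
  by rewrite [LHS]mmapC evgC.
by rewrite [LHS]mmapX mmap1U evgX.
Qed.

Lemma pcombine_pi P : pc P = pi (expand g b P).
Proof.
rewrite /pcombine /expand rmorph_sum; apply: eq_bigr => j _.
by rewrite mmap_pi rmorphM.
Qed.

Lemma irrelevant_pow_weighted N : ideal_pow mm N `<=`
  weighted (fun j m => (N <= mdeg m * e + mdeg (b j))%N).
Proof.
move=> x /(irrelevant_pow_hc pi_surj)[k [u [-> hu]]].
apply: weighted_sum => t _; have [ht lt] := hu t.
have [/lt ->|le] := ltnP t N; first by rewrite rmorph0; apply: weighted0.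
have [P [hP KP]] := graded_expand p_prime r_ge2 d_ge2 hg spb ht.
exists P => [|j m /hP -> //]; rewrite pcombine_pi.
by apply/eqP; rewrite eq_sym -subr_eq0 -rmorphB; apply/eqP/pi_ker.
Qed.

Lemma coordinates_surj x : exists P, pc P = x.
Proof. by have [P] := @irrelevant_pow_weighted 0%N x I; exists P. Qed.

Lemma coordinates_inj P : pc P = 0 -> forall j, P j = 0.
Proof. by rewrite pcombine_pi => /pi_ker; apply: (expand_inj r_ge2 hg indb). Qed.

Lemma ideal_pow_weighted n : ideal_pow J n = weighted (fun _ m => (n <= mdeg m)%N).
Proof.
apply/seteqP; split; last first.
  apply: weighted_min => [|j m hm]; first exact: ideal_pow_is_ideal.
  apply: (idealRM (ideal_pow_is_ideal _ _)); apply: ideal_pow_decr hm _ _.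
  exact: mmap1_ideal_pow.
have hW k : is_ideal (weighted (fun _ m => (k <= mdeg m)%N)).
  apply: (weighted_ideal coordinates_surj) => m m' h; rewrite mdegD.
  by apply: leq_trans h _; rewrite leq_addr.
elim: n => [|n IH] /=; first by move=> x _; have [P <-] := coordinates_surj x; exists P.
apply: (ideal_mul_min (hW n.+1)) => x y hx /IH hy; move: x hx.
apply: (ideal_gen_min (colon_is_ideal y (hW n.+1))) => _ [i _ <-] /=.
have [P <- hP] := hy; exists (fun j => 'X_i * P j).
  by rewrite pcombineM [mmap _ _ 'X_i]mmapX mmap1U.
move=> j m; rewrite mcoeffXM lep1mP; case: ifP => [hi|_]; last by rewrite eqxx.
have le : (U_(i) <= m)%MM by rewrite lep1mP hi.
by move=> /hP h; rewrite -(submK le) mdegD mdeg1 addn1.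
Qed.

Lemma ideal_gen_expr_weighted (a : 'I_d -> nat) :
  ideal_gen (range (fun i => pi (g i ^+ a i))) =
  weighted (fun _ m => exists i, (a i <= m i)%N).
Proof.
have hL := ideal_gen_is_ideal (range (fun i => pi (g i ^+ a i))).
have hW : is_ideal (weighted (fun _ m => exists i, (a i <= m i)%N)).
  apply: (weighted_ideal coordinates_surj) => m m' [i hi]; exists i.
  by rewrite mnmDE; apply: leq_trans hi _; rewrite leq_addr.
apply/seteqP; split.
  apply: (ideal_gen_min hW) => _ [i _ <-].
  have [P hP] := coordinates_surj 1.
  rewrite -[pi _]mulr1 -hP; exists (fun j => 'X_i ^+ a i * P j).
    by rewrite pcombineM mmap_pi (rmorphXn (evg g)) evgX.
  move=> j m; rewrite mpolyXn mcoeffXM; case: ifP => [hi _|_]; last by rewrite eqxx.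
  by exists i; move/mnm_lepP: hi => /(_ i); rewrite mulmnE mnm1E eqxx mul1n.
apply: (weighted_min hL) => j m [i hi]; apply: (idealRM hL).
rewrite /mmap1 (bigD1 i) //=; apply: (idealRM hL).
rewrite -(subnK hi) exprD; apply: (idealLM hL); rewrite -rmorphXn.
by apply: sub_ideal_gen; exists i.
Qed.

(** A term f^m b_j with |m| < n is excluded by the exponents m_i + 1, the surplus n - 1 - |m| being
    added at one index to reach the sum n + d - 1. *)
Lemma ideal_pow_cap n x : (0 < n)%N ->
  (forall a : 'I_d -> nat, (forall i, 0 < a i)%N -> (\sum_i a i = n + d.-1)%N ->
    ideal_gen (range (fun i => pi (g i ^+ a i))) x) -> ideal_pow J n x.
Proof.
move=> n0 h; have [P EP] := coordinates_surj x; rewrite -EP ideal_pow_weighted; exists P => // j m hm.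
rewrite leqNgt; apply/negP => lt.
pose i0 : 'I_d := Ordinal (ltnW d_ge2).
pose a i := ((m i).+1 + (if i == i0 then n - (mdeg m).+1 else 0))%N.
have := h a (fun _ => isT); rewrite ideal_gen_expr_weighted -EP.
have -> : (\sum_i a i = n + d.-1)%N.
  rewrite big_split /= -big_mkcond big_pred1_eq.
  under eq_bigr do rewrite -addn1.
  rewrite big_split /= -mdegE sum1_card card_ord.
  move: d_ge2 lt; clear; lia.
move=> /(_ erefl) /(weightedP coordinates_inj) /(_ j m hm)[i].
by rewrite leqNgt /a ltnS leq_addr.
Qed.

Lemma ideal_pow_sub_expr n (a : 'I_d -> nat) : (\sum_i a i < n + d)%N -> 
  (forall i, 0 < a i)%N ->
  ideal_pow J n `<=` ideal_gen (range (fun i => pi (g i ^+ a i))).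
Proof.
move=> hn a0; rewrite ideal_pow_weighted ideal_gen_expr_weighted.
apply: weighted_mono => _ m hm; apply: contrapT => /forallNP h.
have : (mdeg m + d <= \sum_i a i)%N.
  rewrite mdegE -[d in (_ + d)%N]card_ord -sum1_card -big_split /=.
  by apply: leq_sum => i _; rewrite addn1 ltnNge; apply/negP/h.
by rewrite leqNgt (leq_trans hn) // leq_add2r.
Qed.

Lemma tight_closure_pow n : (0 < n)%N ->
  tight_closure p (ideal_pow J n) =
  ideal_add (ideal_pow J n) (ideal_pow mm ((n - 1) * e + d * e)).
Proof.
move=> n0; have hT : is_ideal (tight_closure p (ideal_pow J n)) by apply: (tc_ideal pcharR).
apply/seteqP; split; last first.
  move=> _ [x [y [hx hy ->]]]; apply: (idealD hT).
    exists 1; first exact: off_minimal_primes1.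
    have [cs Ecs] := tc_fg f n; rewrite Ecs in hx *.
    exists 0%N => l _; rewrite (frobenius_powerE pcharR) mul1r.
    exact: (frobenius_gen_mem pcharR).
  move: hy; rewrite -mulnDl; case: n n0 {hT hx} => // n _; rewrite subn1 /=.
  exact: irrelevant_pow_sub_tight.
move=> x hx; have [u Eu] := pi_surj x; set N := ((n - 1) * e + d * e)%N.
(* N = (n + d - 1) e is the sum of the degrees of the f_i^(a_i) for every a considered, so
   [tight_param] covers exactly the degrees below N. *)
have hcJ (t : nat) : (t < N)%N -> ideal_pow J n (pi (hc t u)).
  move=> tN; apply: ideal_pow_cap => // a a0 sa.
  apply/(ideal_gen_par pi_surj pi_ker).
  have hy := params_expr p_prime hg a0.
  have sub : ideal_pow J n `<=` ideal_gen (range (fun i => pi (g i ^+ a i))).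
    by apply: ideal_pow_sub_expr => //; rewrite sa ltn_add2l; case: (d) d_ge2.
  have [cs Ecs] := tc_fg f n.
  move: sub; rewrite Ecs -range_pi => sub.
  have := tight_closure_sub pcharR sub; rewrite -Ecs => /(_ _ hx)[c hc' [l0 hl]].
  have [c' Ec] := pi_surj c.
  apply: (tight_param p_prime r_ge2 p_ndvd_r d_ge2 p_gt (c := c') (e0 := l0) hy).
  - rewrite -Ec in hc'.
    exact: (off_minimal_primes_pi p_prime r_ge2 p_ndvd_r d_ge2 pi_surj pi_ker hc').
  - move=> l /hl; rewrite (frobenius_powerE pcharR) -Eu -Ec -rmorphXn -rmorphM => h.
    apply/(ideal_gen_par pi_surj pi_ker); move: h; congr (ideal_gen _ _).
    rewrite -range_pi; apply/seteqP; split=> [_ [_ /= /mapP[_ /mapP[i hi ->] ->] <-]|].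
      rewrite -rmorphXn; apply: map_f.
      exact: (map_f (fun i => (g i ^+ a i) ^+ (p ^ l)%N)).
    move=> _ /= /mapP[_ /mapP[i hi ->] ->]; exists (pi (g i ^+ a i)).
      by apply/map_f/(map_f (fun i => g i ^+ a i)).
    by rewrite -rmorphXn.
  - rewrite -big_distrr /= sa; apply: leq_trans tN _; rewrite /N -mulnDl mulnC leq_mul2l.
    by apply/orP; right; move: n0 d_ge2; clear; lia.
have hA := ideal_pow_is_ideal J n; have hB := ideal_pow_is_ideal mm N.
have hS : is_ideal (ideal_add (ideal_pow J n) (ideal_pow mm N)).
  split=> [|_ _ [x1 [y1 [h1 h2 ->]]] [x2 [y2 [h3 h4 ->]]]|c _ [x1 [y1 [h1 h2 ->]]]].
  - by exists 0, 0; rewrite addr0; split=> //; apply: ideal0.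
  - by exists (x1 + x2), (y1 + y2); rewrite addrACA; split=> //; apply: idealD.
  - by exists (c * x1), (c * y1); rewrite mulrDr; split=> //; apply: idealLM.
rewrite -Eu (hc_partition u) rmorph_sum; apply: (ideal_sum hS) => t _.
have [lt|le] := ltnP t N.
  by exists (pi (hc t u)), 0; rewrite addr0; split=> //; [apply: hcJ | apply: ideal0].
exists 0, (pi (hc t u)); rewrite add0r; split=> //; first exact: ideal0.
exact: (irrelevant_homog pi_surj (hc_homog_mem _ _)).
Qed.

(* delta_j; the truncated subtraction provides the maximum with 0. *)
Definition shift j := (mdeg (b j) %/ e - d.-1)%N.

(** The degree |m| e + deg b_j of f^m b_j reaches (n + d - 1) e exactly when n + d - 1 <= |m| +
    [deg b_j / e]; combined with the alternative n <= |m| this is the weight condition. *)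
Lemma tight_closure_weighted n : tight_closure p (ideal_pow J n) =
  weighted (fun j m => (n <= mdeg m + shift j)%N).
Proof.
case: n => [|n].
  rewrite [LHS](tight_closureT pcharR); apply/seteqP; split=> // x _.
  by have [P <-] := coordinates_surj x; exists P.
have key j m : ((n + d) * e <= mdeg m * e + mdeg (b j))%N =
    (n + d <= mdeg m + mdeg (b j) %/ e)%N by rewrite -leq_divRL // divnMDl.
rewrite tight_closure_pow // subn1 -mulnDl /=; apply/seteqP; split.
  move=> _ [x [y [hx hy ->]]]; apply: weightedD.
    have {}hx : ideal_pow J n.+1 x by [].
    rewrite ideal_pow_weighted in hx; apply: (weighted_mono _ hx) => j m h.
    by apply: leq_trans h _; rewrite leq_addr.
  apply: (weighted_mono _ (irrelevant_pow_weighted hy)) => j m; rewrite key /shift.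
  by move: (mdeg m) (_ %/ _)%N d_ge2; clear; lia.
have hS := tc_ideal pcharR f n.+1.
move: (tight_closure_pow (n := n.+1) isT); rewrite subn1 -mulnDl /= => E.
rewrite -E; apply: (weighted_min hS) => j m h; rewrite E.
have [nm|nm] := leqP n.+1 (mdeg m).
  exists (mmap1 f m * basis_image j), 0; rewrite addr0; split=> //; last exact: ideal0 (ideal_pow_is_ideal _ _).
  apply: (idealRM (ideal_pow_is_ideal J n.+1)); apply: ideal_pow_decr nm _ _.
  exact: mmap1_ideal_pow.
exists 0, (mmap1 f m * basis_image j); rewrite add0r; split=> //; first exact: ideal0 (ideal_pow_is_ideal J n.+1).
have h' : ((n + d) * e <= mdeg m * e + mdeg (b j))%N.
  rewrite key; move: h nm; rewrite /shift; move: (mdeg m) (_ %/ _)%N d_ge2; clear; lia.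
have -> : mmap1 f m * basis_image j = pi (evg g 'X_[m] * 'X_[b j]).
  by rewrite rmorphM -mmap_pi mmapX.
apply: (irrelevant_homog pi_surj (D := mdeg m * e + mdeg (b j))) h'.
apply: dhomogM; last by rewrite dhomogX /=.
rewrite [evg g 'X_[m]]mmapX /mmap1 mdegE big_distrl /=.
have [hgi _ _] := hg.
have : forall s : seq 'I_d, \prod_(i <- s) g i ^+ m i \is (\sum_(i <- s) m i * e)%N.-homog.
  elim=> [|i s IH]; first by rewrite !big_nil; apply: dhomog1.
  by rewrite !big_cons; apply: dhomogM IH; rewrite mulnC; apply: dhomogMn.
by apply.
Qed.

End Coordinates.
End TightClosure.

(** * The associated graded ring *)

Lemma mmap_rmorph (F A B : comNzRingType) (kap : {rmorphism F -> A}) (h : {rmorphism A -> B})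
    D (th : 'I_D -> A) (q : {mpoly F[D]}) :
  h (mmap kap th q) = mmap (h \o kap) (fun i => h (th i)) q.
Proof.
rewrite /mmap rmorph_sum; apply: eq_bigr => m _; rewrite rmorphM rmorph_prod.
by congr (_ * _); apply: eq_bigr => i _; rewrite rmorphXn.
Qed.

Lemma pcombine_rmorph (F : finFieldType) (A B : comNzRingType) (kap : {rmorphism F -> A})
    (h : {rmorphism A -> B}) D (th : 'I_D -> A) (J : finType) (w : J -> A) P :
  h (pcombine kap th w P) = pcombine (h \o kap) (fun i => h (th i)) (fun j => h (w j)) P.
Proof.
rewrite /pcombine rmorph_sum; apply: eq_bigr => j _.
by rewrite rmorphM mmap_rmorph.
Qed.

Lemma eq_pcombine (F : finFieldType) (A : comNzRingType) (kap kap' : {rmorphism F -> A}) D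
    (th th' : 'I_D -> A) (J : finType) (w w' : J -> A) P :
  kap =1 kap' -> th =1 th' -> w =1 w' -> pcombine kap th w P = pcombine kap' th' w' P.
Proof.
move=> hk ht hw; rewrite /pcombine; apply: eq_bigr => j _; rewrite hw; congr (_ * _).
rewrite /mmap; apply: eq_bigr => m _; rewrite hk; congr (_ * _).
by apply: eq_bigr => i _; rewrite ht.
Qed.

Lemma mcoeff_hc (F : fieldType) n (k : nat) (u : {mpoly F[n]}) m :
  (hc k u)@_m = if mdeg m == k then u@_m else 0.
Proof.
rewrite /= pihomogE raddf_sum /=; case: (eqVneq (mdeg m) k) => [E|ne]; last first.
  rewrite big1_seq // => m' /andP[/eqP E _]; rewrite mcoeffZ mcoeffX.
  have [E'|_] := eqVneq m' m; last by rewrite mulr0.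
  by rewrite -E E' eqxx in ne.
rewrite [in RHS](mpolyE u) raddf_sum /= big_mkcond; apply: eq_bigr => m' _.
case: eqP => // ne; rewrite mcoeffZ mcoeffX.
have [E'|_] := eqVneq m' m; last by rewrite mulr0.
by rewrite -E E' in ne.
Qed.

Section FilteredFreeAlgebra.
Variables (F : finFieldType) (A : comNzRingType) (kap : {rmorphism F -> A}).
Variables (d : nat) (f : 'I_d -> A) (J : finType) (w : J -> A).
Local Notation pc := (pcombine kap f w).
Hypothesis pc_surj : forall x, exists P, pc P = x.
Hypothesis pc_inj : forall P, pc P = 0 -> forall j, P j = 0.
Variables (Fil : filtration A) (shift : J -> nat).
Hypothesis FilE : forall n, Fil n = weighted kap f w (fun j m => (n <= mdeg m + shift j)%N).

Local Notation rees_val := (@rees_val A Fil).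
Let val_rees : {rmorphism rees Fil -> {poly A}} := val.

(** The default 0 only makes the map total; its values are computed through [to_reesK] on members of
    the Rees algebra. *)
Definition to_rees (u : {poly A}) : rees Fil := insubd 0 u.

Lemma to_reesK u : u \in rees_pred Fil -> rees_val (to_rees u) = u.
Proof. exact: insubdK. Qed.

Lemma monomial_rees n x : Fil n x -> x%:P * 'X^n \in rees_pred Fil.
Proof.
move=> hx; apply/asboolP => k; rewrite coefCM coefXn.
by have [->|_] := eqVneq k n; rewrite ?mulr1 // mulr0; apply: ideal0; apply: filt_ideal.
Qed.

Lemma const_rees x : x%:P \in rees_pred Fil.
Proof. by rewrite -[_%:P]mulr1 -(expr0 'X); apply: monomial_rees; rewrite filt0. Qed.

Lemma rees_pred0 : 0 \in rees_pred Fil.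
Proof. by rewrite -polyC0; apply: const_rees. Qed.

Lemma rees_predD u v : u \in rees_pred Fil -> v \in rees_pred Fil -> u + v \in rees_pred Fil.
Proof.
move=> /asboolP hu /asboolP hv; apply/asboolP => n; rewrite coefD.
exact: (idealD (filt_ideal Fil n)).
Qed.

Definition rees_const (c : F) : rees Fil := to_rees (kap c)%:P.

Lemma val_rees_const c : rees_val (rees_const c) = (kap c)%:P.
Proof. by rewrite to_reesK // const_rees. Qed.

Fact rees_const_zmod : zmod_morphism rees_const.
Proof.
move=> x y; apply: val_inj; rewrite [RHS](rmorphB val_rees) /= !val_rees_const.
by rewrite !rmorphB.
Qed.

HB.instance Definition _ := GRing.isZmodMorphism.Build F (rees Fil) rees_const rees_const_zmod.

Fact rees_const_monoid : monoid_morphism rees_const.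
Proof.
split=> [|x y]; apply: val_inj.
  by rewrite [RHS](rmorph1 val_rees) /= val_rees_const !rmorph1.
by rewrite [RHS](rmorphM val_rees) /= !val_rees_const !rmorphM.
Qed.

HB.instance Definition _ := GRing.isMonoidMorphism.Build F (rees Fil) rees_const rees_const_monoid.

Lemma Fil_monomial j m n c : (n <= mdeg m + shift j)%N -> Fil n (kap c * mmap1 f m * w j).
Proof.
move=> h; rewrite FilE; exists (fun l => if l == j then c *: 'X_[m] else 0).
  rewrite /pcombine (bigD1 j) //= eqxx big1 ?addr0 => [|l /negbTE ->]; last by rewrite mmap0 mul0r.
  by rewrite mmapZ mmapX.
move=> l m'; have [->|_] := eqVneq l j; last by rewrite mcoeff0 eqxx.
by rewrite mcoeffZ mcoeffX; have [<- //|_] := eqVneq m m'; rewrite mulr0 eqxx.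
Qed.

Lemma Fil_param i : Fil 1%N (f i).
Proof.
have [P hP] := pc_surj 1; rewrite FilE -[f i]mulr1 -hP; exists (fun j => 'X_i * P j).
  by rewrite pcombineM mmapX mmap1U.
move=> j m; rewrite mcoeffXM lep1mP; case: ifP => [hi _|_]; last by rewrite eqxx.
have le : (U_(i) <= m)%MM by rewrite lep1mP hi.
by rewrite -(submK le) mdegD mdeg1 addn1.
Qed.

Lemma rees_ind (Q : set {poly A}) : Q 0 -> (forall u v, Q u -> Q v -> Q (u + v)) ->
  (forall c j m n, (n <= mdeg m + shift j)%N -> Q ((kap c * mmap1 f m * w j)%:P * 'X^n)) ->
  forall u, u \in rees_pred Fil -> Q u.
Proof.
move=> Q0 QD Qm u /asboolP hu; rewrite -[u]coefK poly_def.
apply: (big_ind Q) => // n _; have := hu n; rewrite FilE => -[P <- hP].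
rewrite -mul_polyC /pcombine rmorph_sum mulr_suml; apply: (big_ind Q) => // j _.
rewrite /mmap mulr_suml rmorph_sum mulr_suml big_seq; apply: (big_ind Q) => // m hm.
by apply: Qm; apply: hP; rewrite -mcoeff_msupp.
Qed.

Let kapX : {rmorphism F -> {poly A}} := polyC \o kap.
Let fX i : {poly A} := (f i)%:P * 'X.

Lemma mmap1_fX m : mmap1 fX m = (mmap1 f m)%:P * 'X^(mdeg m).
Proof.
rewrite /mmap1 mdegE; have : forall s : seq 'I_d, \prod_(i <- s) fX i ^+ m i =
    (\prod_(i <- s) f i ^+ m i)%:P * 'X^(\sum_(i <- s) m i).
  elim=> [|i s IH]; first by rewrite !big_nil expr0 mulr1.
  by rewrite !big_cons IH exprD exprMn !rmorphM rmorphXn /=; ring.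
by apply.
Qed.

(** After substitution of the f_i t, the power of t records the degree in the variables. *)
Lemma coef_mmap_fX P (k : nat) : (mmap kapX fX P)`_k = mmap kap f (hc k P).
Proof.
elim/mpolyind: P => [|c m P _ _ IH].
  by rewrite hc0 !mmap0 coef0.
rewrite hcD !mmapD coefD IH; congr (_ + _).
rewrite mmapZ mmapX mmap1_fX mulrA -[kapX c]/((kap c)%:P) -polyCM coefCM coefXn.
have hX : c *: 'X_[m] \is (mdeg m).-homog by apply: rpredZ; rewrite dhomogX /=.
have [->|ne] := eqVneq k (mdeg m).
  by rewrite (hc_homog hX) mmapZ mmapX mulr1.
by rewrite (hc_homog_ne hX) ?mmap0 ?mulr0.
Qed.

Section AssociatedGradedRing.

Local Notation Gr := (quot_ring (gr_is_ideal Fil)).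
Let q : {rmorphism rees Fil -> Gr} := qpi (gr_is_ideal Fil).

(** Otherwise 1 would lie in every [Fil n], while a nonzero coordinate of 1 has a fixed weight. The
    graded ring is thus nonzero, as [free_algebra_cohen_macaulay] requires. *)
Lemma not_Fil1 : ~ Fil 1%N 1.
Proof.
move=> h1; have h n : Fil n 1.
  elim: n => [|n IH]; first by rewrite filt0.
  by rewrite -[1]mulr1 -addn1; apply: filt_mul.
have [P EP] := pc_surj 1.
have P0 : forall j, P j = 0.
  move=> j; apply/mpolyP => m; rewrite mcoeff0; apply/eqP/negPn/negP => hm.
  have := h (mdeg m + shift j).+1; rewrite -EP FilE => /(weightedP pc_inj) /(_ j m hm).
  by rewrite ltnn.
have := oner_neq0 A; rewrite -EP /pcombine big1 ?eqxx // => j _.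
by rewrite P0 mmap0 mul0r.
Qed.

Lemma gr_nonzero : (1 : Gr) != 0.
Proof.
apply/eqP; rewrite -(rmorph1 q) => /qpi_eq0 /(_ 0%N).
by rewrite [rees_val _](rmorph1 val_rees) coef1; apply: not_Fil1.
Qed.

Let thG i := to_rees (fX i).
Let wG j := to_rees ((w j)%:P * 'X^(shift j)).

Let thG_val i : rees_val (thG i) = fX i.
Proof. by rewrite to_reesK // /fX -['X]expr1; apply/monomial_rees/Fil_param. Qed.

Let wG_val j : rees_val (wG j) = (w j)%:P * 'X^(shift j).
Proof.
rewrite to_reesK //; apply: monomial_rees.
have := @Fil_monomial j 0%MM (shift j) 1; rewrite rmorph1 mul1r mdeg0 leqnn => /(_ isT).
by rewrite /mmap1 big1 ?mul1r // => i _; rewrite mnm0E expr0.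
Qed.

Let pcG_val P : rees_val (pcombine rees_const thG wG P) =
  \sum_j mmap kapX fX (P j) * ((w j)%:P * 'X^(shift j)).
Proof.
rewrite [LHS](pcombine_rmorph _ val_rees).
rewrite -/(pcombine kapX fX (fun j => (w j)%:P * 'X^(shift j)) P).
apply: eq_pcombine => [c|i|j]; [exact: val_rees_const | exact: thG_val | exact: wG_val].
Qed.

Let grN := GRing.PzSemiRing_isNonZero.Build Gr gr_nonzero.
Let G : comNzRingType := HB.pack Gr grN.
Let qG : {rmorphism rees Fil -> G} := q.

Let pcG_surj (x : G) : exists P, pcombine (qG \o rees_const) (fun i => qG (thG i)) (fun j => qG (wG j)) P = x.
Proof.
have [u <-] := qpi_surj x.
pose Q v := v \in rees_pred Fil /\ exists P, q (pcombine rees_const thG wG P) = q (to_rees v).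
have [_ [P hP]] : Q (rees_val u).
  apply: rees_ind; last by case: (u).
  - split; first exact: rees_pred0.
    exists (fun=> 0); congr (q _); apply: val_inj; rewrite [RHS]to_reesK ?rees_pred0 //.
    by rewrite [LHS]pcG_val big1 // => j _; rewrite mmap0 mul0r.
  - move=> u1 u2 [h1 [P1 E1]] [h2 [P2 E2]]; split; first exact: rees_predD.
    exists (fun j => P1 j + P2 j); rewrite pcombineD rmorphD E1 E2 -rmorphD; congr (q _).
    apply: val_inj; rewrite [RHS]to_reesK ?rees_predD //.
    by rewrite [LHS](rmorphD val_rees) /= !to_reesK.
  move=> c j m n hn; have hm : (kap c * mmap1 f m * w j)%:P * 'X^n \in rees_pred Fil.
    by apply/monomial_rees/Fil_monomial.
  (* A monomial f^m w_j t^n whose weight exceeds n is zero in the graded ring; with n equal to the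
     weight it is a product of the chosen parameters and a basis element. *)
  split=> //; have [E|lt] : n = (mdeg m + shift j)%N \/ (n < mdeg m + shift j)%N.
    by move: hn; rewrite leq_eqVlt => /orP[/eqP|]; [left|right].
    exists (fun l => if l == j then c *: 'X_[m] else 0); congr (q _); apply: val_inj.
    rewrite [LHS]pcG_val [RHS]to_reesK // (bigD1 j) //= eqxx big1 ?addr0 => [|l /negbTE ->].
      rewrite mmapZ mmapX mmap1_fX E exprD !rmorphM /=; ring.
    by rewrite mmap0 mul0r.
  exists (fun=> 0); transitivity (0 : Gr).
    apply/qpi_eq0 => k; rewrite pcG_val big1 ?coef0; last by move=> l _; rewrite mmap0 mul0r.
    by apply: ideal0; apply: filt_ideal.
  apply/esym/qpi_eq0 => k; rewrite to_reesK // coefCM coefXn.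
  have [->|_] := eqVneq k n; last by rewrite mulr0; apply: ideal0; apply: filt_ideal.
  by rewrite mulr1; apply: Fil_monomial.
exists P; rewrite -(pcombine_rmorph _ qG) [LHS]hP; congr (q _).
by apply: val_inj; rewrite [LHS]to_reesK //; case: (u).
Qed.

Let pcG_inj P : pcombine (qG \o rees_const) (fun i => qG (thG i)) (fun j => qG (wG j)) P = 0 ->
  forall j, P j = 0.
Proof.
rewrite -(pcombine_rmorph _ qG) => /qpi_eq0 h j.
apply/mpolyP => m; rewrite mcoeff0; apply/eqP/negPn/negP => hm.
have := h (mdeg m + shift j)%N; rewrite pcG_val coef_sum.
set n := (mdeg m + shift j)%N.
(* The coordinates of the coefficient of t^n: from P l only the part of degree n - shift l
   contributes. This coefficient lies in [Fil n.+1], whereas f^m w_j has weight n. *)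
pose Q l := if (n < shift l)%N then 0 else hc (n - shift l)%N (P l).
have -> : \sum_(l : J) (mmap kapX fX (P l) * ((w l)%:P * 'X^(shift l)))`_n = pc Q.
  apply: eq_bigr => l _; rewrite mulrA coefMXn /Q; case: ifP => _; first by rewrite mmap0 mul0r.
  by rewrite coefMC coef_mmap_fX.
rewrite FilE => /(weightedP pc_inj) /(_ j m).
by rewrite /Q ltnNge leq_addl /= addnK mcoeff_hc eqxx => /(_ hm); rewrite ltnn.
Qed.

Theorem assoc_gr_cohen_macaulay : cohen_macaulay (assoc_gr Fil).
Proof. exact: (free_algebra_cohen_macaulay pcG_surj pcG_inj). Qed.

End AssociatedGradedRing.
End FilteredFreeAlgebra.

(** * The Rees algebra *)

(* Modulo the terms divisible by a parameter one may trade x_(k+1) for x_k t and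
   back, so a product of at least two x's can be moved towards x_0, which is
   itself a parameter. *)
Lemma skew_monomial_span (A : comNzRingType) (x : nat -> A) (t : A) (Q : set A) (s0 : nat) :
  (forall u v, Q u -> Q v -> Q (u - v)) ->
  (forall u, Q u -> Q (x 0%N * u)) ->
  (forall k u, Q u -> Q ((x k.+1 - x k * t) * u)) ->
  (forall n, (n <= s0)%N -> Q (t ^+ n)) -> (forall k, (s0 < k)%N -> Q (x k)) ->
  forall s n, (n <= size s + s0)%N -> Q ((\prod_(k <- s) x k) * t ^+ n).
Proof.
move=> QB Q0 QS Qt Qx.
have QN u v : Q u -> Q (u - v) -> Q v by move=> h1 h2; have := QB _ _ h1 h2; rewrite opprB addrC subrK.
have QN' u v : Q v -> Q (u - v) -> Q u.
  move=> h1 h2; have := QB _ _ h2 (QB _ _ (QB _ _ h1 h1) h1).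
  by rewrite subrr sub0r opprK subrK.
suff main l : forall s, size s = l -> forall n, (n <= l + s0)%N ->
  Q ((\prod_(k <- s) x k) * t ^+ n) by move=> s n; apply: main.
elim: l => [|l IH] s; first by move=> /size0nil -> n hn; rewrite big_nil mul1r; apply: Qt.
case: s => // k s [ss]; rewrite big_cons.
have slide c z n : Q (z * t ^+ n) -> Q (x c.+1 * (z * t ^+ n) - x c * (z * t ^+ n.+1)).
  by move=> h; have := QS c _ h; rewrite mulrBl exprS; congr (Q (_ - _)); rewrite -!mulrA; congr (_ * _); rewrite mulrCA.
(* With a second factor present, lowering one index raises the other through the exchange with t,
   until x_0 appears. A single x_c with c <= s0 is traded for x_0 t^c. *)
have base c : Q (x c * \prod_(i <- s) x i).
  case: s ss => [|c' s'] ss.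
    rewrite big_nil mulr1; have [cs|/Qx //] := leqP c s0.
    suff h n : (c + n <= s0)%N -> Q (x c * t ^+ n).
      by have := h 0%N; rewrite addn0 expr0 mulr1; apply.
    elim: c n {cs} => [|c IHc] n hn; first by apply/Q0/Qt.
    have hn' : (n <= s0)%N by apply: leq_trans hn; rewrite leq_addl.
    have := slide c 1 n; rewrite !mul1r => /(_ (Qt _ hn')); apply: QN'.
    by apply: IHc; rewrite addnS -addSn.
  rewrite big_cons; elim: c c' ss => [|c IHc] c' ss.
    by have := IH _ ss 0%N isT; rewrite big_cons expr0 mulr1; apply: Q0.
  have low c0 : Q ((x c0 * \prod_(i <- s') x i) * t ^+ 0).
    by have := IH (c0 :: s') ss 0%N isT; rewrite big_cons.
  have := slide c _ 0%N (low c'); rewrite expr0 mulr1 expr1; apply: QN'.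
  have -> : x c * (x c' * \prod_(i <- s') x i * t) = x c' * (x c * \prod_(i <- s') x i * t) by ring.
  have := slide c' _ 0%N (low c); rewrite expr0 mulr1 expr1; apply: QN.
  have -> : x c'.+1 * (x c * \prod_(i <- s') x i) = x c * (x c'.+1 * \prod_(i <- s') x i) by ring.
  exact: IHc.
(* Each factor t is absorbed by trading x_k t^(n+1) for x_(k+1) t^n. *)
move=> n; elim: n k => [|n IHn] k hn; first by rewrite expr0 mulr1.
rewrite -mulrA; have hn' : (n <= l + s0)%N by [].
apply: (QN _ _ _ (slide k _ _ (IH s ss n hn'))).
by rewrite mulrA; apply: IHn; apply: ltnW.
Qed.

Lemma distinct_size_sum0 (I : finType) (T : nzRingType) (G : I -> {poly T}) : \sum_i G i = 0 ->
  (forall i j, G i != 0 -> G j != 0 -> size (G i) = size (G j) -> i = j) -> forall i, G i = 0.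
Proof.
move=> h0 dist i0; apply/eqP/negPn/negP => hi0.
pose i1 := [arg max_(i > i0) size (G i)].
have hmax j : (size (G j) <= size (G i1))%N by rewrite /i1; case: arg_maxnP => // i _ h; apply: h.
have h1 : G i1 != 0 by rewrite -size_poly_gt0; apply: leq_trans (hmax i0); rewrite size_poly_gt0.
have/eqP := congr1 (fun u : {poly T} => u`_(size (G i1)).-1) h0; apply/negP.
rewrite /= coef0 coef_sum (bigD1 i1) //= big1 ?addr0 => [|j ne]; first by rewrite -lead_coefE lead_coef_eq0.
have [->|hj] := eqVneq (G j) 0; first by rewrite coef0.
apply: nth_default; rewrite -ltnS prednK ?size_poly_gt0 // ltn_neqAle hmax andbT.
by apply: contra ne => /eqP /(dist _ _ hj h1) ->.
Qed.

(** * Parameters and basis of the Rees algebra *)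

Section SkewParameters.
Variables (T : comNzRingType) (d : nat) (x : 'I_d -> T).

(* x_k as a constant polynomial in t, with the convention x_k = 0 for d <= k;
   thus skew_param d = - x_(d-1) t. *)
Definition cgen (k : nat) : {poly T} := if insub k is Some i then (x i)%:P else 0.

Definition skew_param (k : nat) : {poly T} :=
  if k is k'.+1 then cgen k - cgen k' * 'X else cgen 0.

(** Indices start at 0, so [cgen k] stands for f_(k+1); s is the value delta_j, and each basis
    element b_j receives exactly d multiples, one for every k < d. *)
Definition skew_basis (s k : nat) : {poly T} := if (k <= s)%N then 'X^k else cgen k.

Lemma cgenE (i : 'I_d) : cgen i = (x i)%:P.
Proof. by rewrite /cgen valK. Qed.

Lemma cgen_default k : (d <= k)%N -> cgen k = 0.
Proof. by move=> h; rewrite /cgen insubF // ltnNge h. Qed.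

(* x_k expressed through theta_i := skew_param i as sum_(i <= k) theta_i t^(k-i);
   below, theta_i is again written x_i. *)
Fixpoint horner_sum (k : nat) : {poly T} :=
  if k is k'.+1 then horner_sum k' * 'X + cgen k else cgen 0.

End SkewParameters.

Section SkewIndependence.
Variables (F : finFieldType) (d : nat).
Hypothesis d_gt0 : (0 < d)%N.
Local Notation M := {mpoly F[d]}.
Let X (i : 'I_d) : M := 'X_i.
Let kapM : {rmorphism F -> {poly M}} := polyC \o @mpolyC d F.

Lemma size_horner_sum k : (k < d)%N -> size (horner_sum X k) = k.+1.
Proof.
elim: k => [|k IH] hk.
  have := cgenE X (Ordinal hk); rewrite /= => ->; rewrite size_polyC.
  by rewrite -msize_poly_eq0 msizeX.
have := cgenE X (Ordinal hk); rewrite /= => ->; rewrite size_MXaddC.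
have := IH (ltnW hk); have [->|_] := eqVneq (horner_sum X k) 0; first by rewrite size_poly0.
by move=> ->.
Qed.

(* After the substitution x_k |-> horner_sum k, the last parameter has t-degree
   d and the k-th basis element has t-degree k < d, so no two nonzero terms have
   the same t-degree. *)
Theorem skew_independent s (H : 'I_d -> {mpoly F[d.+1]}) :
  pcombine kapM (fun i : 'I_d.+1 => skew_param X i) (fun k : 'I_d => skew_basis X s k) H = 0 ->
  forall k, H k = 0.
Proof.
pose phi : {rmorphism M -> {poly M}} := mmap kapM (fun i => horner_sum X i).
pose tau : {rmorphism {poly M} -> {poly M}} := heval phi 'X.
have tauX : tau 'X = 'X by apply: hevalX.
have tau_cgen k : (k < d)%N -> tau (cgen X k) = horner_sum X k.
  move=> hk; rewrite (cgenE X (Ordinal hk)) [LHS]hevalC.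
  by rewrite [LHS]mmapX mmap1U.
pose qd := tau (skew_param X d).
have Eqd : qd = - (horner_sum X d.-1 * 'X).
  rewrite /qd.
  have -> : skew_param X d = - (cgen X d.-1 * 'X).
    suff h n : (d <= n)%N -> (0 < n)%N -> skew_param X n = - (cgen X n.-1 * 'X) by apply: h.
    by case: n => // n hn _; rewrite /= cgen_default // sub0r.
  by rewrite rmorphN rmorphM tauX tau_cgen // prednK.
have sqd : size qd = d.+1.
  rewrite Eqd size_polyN size_mulX ?size_horner_sum ?prednK // -size_poly_gt0.
  by rewrite size_horner_sum // prednK.
have tau_param (i : 'I_d) : tau (skew_param X i) = ('X_i)%:P.
  rewrite -[RHS](cgenE X); case: i => -[|i] hi /=; first by rewrite tau_cgen.
  by rewrite rmorphB rmorphM tauX !tau_cgen ?(ltnW hi) //= addrC addKr.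
pose bb (k : 'I_d) := tau (skew_basis X s k).
have sbb k : size (bb k) = k.+1.
  rewrite /bb /skew_basis; case: ifP => _; last by rewrite tau_cgen // size_horner_sum.
  by rewrite rmorphXn tauX size_polyXn.
have sub h : mmap (tau \o kapM) (fun i : 'I_d.+1 => tau (skew_param X i)) h = (muni h) \Po qd.
  pose f1 : {rmorphism {mpoly F[d.+1]} -> {poly M}} :=
    mmap (tau \o kapM) (fun i : 'I_d.+1 => tau (skew_param X i)).
  pose f2 : {rmorphism {mpoly F[d.+1]} -> {poly M}} := heval (@polyC M) qd \o @muni d F.
  apply: (mpoly_rmorph_ext (f1 := f1) (f2 := f2)) => [c|i].
    have -> : f2 c%:MP = (c%:MP)%:P by rewrite /f2 /= muniC [LHS]hevalC.
    by rewrite [LHS]mmapC; apply: etrans (hevalC _ _ _) _; apply: mmapC.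
  rewrite [LHS]mmapX mmap1U; case: (unliftP ord_max i) => [j ->|->].
    have -> : lift ord_max j = widen_ord (leqnSn d) j.
      by apply: val_inj => /=; rewrite /bump leqNgt ltn_ord.
    have -> : f2 'X_(widen_ord (leqnSn d) j) = ('X_j)%:P by rewrite /f2 /= muniX [LHS]hevalC.
    exact: tau_param.
  by have -> : f2 'X_ord_max = qd by rewrite /f2 /= muniXmax [LHS]hevalX.
move=> h0; have : tau 0 = 0 by apply: rmorph0.
rewrite -{1}h0 (pcombine_rmorph _ tau) /pcombine => h1.
have bb0 k : bb k != 0 by rewrite -size_poly_gt0 sbb.
have {h1} : \sum_k (muni (H k) \Po qd) * bb k = 0.
  by rewrite -[RHS]h1; apply: eq_bigr => k _; rewrite sub.
move: sqd bb0 sbb; move: (qd : {poly M}) (bb : 'I_d -> {poly M}) => q v sq v0 sv h1.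
(* Composition with [qd] multiplies the t-degree by d, so k is the residue modulo d of the t-degree
   of its term. *)
have sG (k : 'I_d) (u : {poly M}) : (u \Po q) * v k != 0 ->
    size ((u \Po q) * v k) = ((size u).-1 * d + k).+1.
  rewrite mulf_eq0 negb_or => /andP[n0 _].
  rewrite size_mul // sv addnS /= -(prednK (n := size (_ \Po _))) ?size_poly_gt0 //.
  by rewrite size_comp_poly sq.
have G0 : forall k, (muni (H k) \Po q) * v k = 0.
  apply: distinct_size_sum0 h1 _ => i j /sG -> /sG -> [E]; apply: val_inj.
  by rewrite /= -(modn_small (ltn_ord i)) -(modn_small (ltn_ord j)) -(modnMDl (size (muni (H i))).-1) E modnMDl.
move=> k; have /eqP := G0 k; rewrite mulf_eq0 (negbTE (v0 k)) orbF comp_poly_eq0 ?sq //.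
move=> /eqP E; rewrite -[H k]muniK E; apply: rmorph0.
Qed.

End SkewIndependence.

Section ReesAlgebra.
Variables (F : finFieldType) (A : comNzRingType) (kap : {rmorphism F -> A}).
Variables (d : nat) (f : 'I_d -> A) (J : finType) (w : J -> A).
Hypothesis d_gt0 : (0 < d)%N.
Local Notation pc := (pcombine kap f w).
Hypothesis pc_surj : forall x, exists P, pc P = x.
Hypothesis pc_inj : forall P, pc P = 0 -> forall j, P j = 0.
Variables (Fil : filtration A) (shift : J -> nat).
Hypothesis FilE : forall n, Fil n = weighted kap f w (fun j m => (n <= mdeg m + shift j)%N).
Hypothesis shift_lt : forall j, (shift j < d)%N.

Local Notation rees_val := (@rees_val A Fil).
Let val_rees : {rmorphism rees Fil -> {poly A}} := val.
Let kapX : {rmorphism F -> {poly A}} := polyC \o kap.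
Let th (i : 'I_d.+1) : {poly A} := skew_param f i.
Let sb s (k : 'I_d) : {poly A} := skew_basis f s k.
Let W (jk : J * 'I_d) : {poly A} := (w jk.1)%:P * sb (shift jk.1) jk.2.

Lemma skew_span s c m n : (s < d)%N -> (n <= mdeg m + s)%N ->
  exists H, pcombine kapX th (sb s) H = (kap c * mmap1 f m)%:P * 'X^n.
Proof.
move=> sd hn; pose Q u := exists H, pcombine kapX th (sb s) H = u.
have QM v u : Q u -> Q (mmap kapX th v * u).
  by move=> [H <-]; exists (fun k => v * H k); rewrite pcombineM.
have QB u v : Q u -> Q v -> Q (u - v).
  move=> hu /(QM (- 1)); rewrite (rmorphN1 (mmap kapX th : {rmorphism _ -> _})) mulN1r.
  by case: hu => H <- [H' <-]; exists (fun k => H k + H' k); rewrite pcombineD.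
have Qth k u : Q u -> Q (skew_param f k * u).
  have [kd|kd] := leqP k d.
    have kd' : (k < d.+1)%N by [].
    by move=> /(QM 'X_(Ordinal kd')); rewrite mmapX mmap1U.
  move=> hu; case: k kd => // k kd.
  by rewrite /= !cgen_default // 1?ltnW // mul0r subrr mul0r -(subrr u); apply: QB.
have Qsb (k : 'I_d) : Q (sb s k).
  exists (fun l => if l == k then 1 else 0).
  rewrite /pcombine (bigD1 k) //= eqxx big1 ?addr0 => [|l /negbTE ->]; last by rewrite mmap0 mul0r.
  by rewrite (rmorph1 (mmap kapX th : {rmorphism _ -> _})) mul1r.
have Q0 : Q 0 by rewrite -(subrr (sb s (Ordinal d_gt0))); apply: QB.
have [l [sl El]] : exists l : seq nat, size l = mdeg m /\ (mmap1 f m)%:P = \prod_(k <- l) cgen f k.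
  rewrite /mmap1 mdegE; elim: (index_enum _) => [|i s' [l [sl El]]].
    by exists [::]; rewrite !big_nil.
  exists (nseq (m i) (i : nat) ++ l); rewrite size_cat size_nseq sl !big_cons; split=> //.
  rewrite big_cat /= -El rmorphM /= rmorphXn /= -(cgenE f); congr (_ * _).
  by elim: (m i) => [|n' IH]; rewrite ?big_nil //= big_cons exprS IH.
rewrite rmorphM /= El -mulrA.
have <- : mmap kapX th c%:MP = (kap c)%:P by rewrite mmapC.
apply: QM.
apply: (skew_monomial_span (x := cgen f) (t := 'X) (Q := Q) QB (fun u => @Qth 0%N u) (fun k u => @Qth k.+1 u) (s0 := s)) => [k ks|k ks|].
- have kd := leq_ltn_trans ks sd.
  by have := Qsb (Ordinal kd); rewrite /sb /skew_basis /= ks.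
- have [kd|kd] := ltnP k d; last by rewrite cgen_default.
  by have := Qsb (Ordinal kd); rewrite /sb /skew_basis /= leqNgt ks.
- by rewrite sl.
Qed.

Let pcombine_pair P : pcombine kapX th W P = \sum_j \sum_k mmap kapX th (P (j, k)) * W (j, k).
Proof. by rewrite pair_bigA; apply: eq_bigr => -[j k] _. Qed.

(** A is free over F[f] on w, so a relation in A[t] splits along w and the powers of t into
    relations over the polynomial ring, where [skew_independent] applies. *)
Lemma rees_gens_inj P : pcombine kapX th W P = 0 -> forall jk, P jk = 0.
Proof.
pose X (i : 'I_d) : {mpoly F[d]} := 'X_i.
pose ev : {rmorphism {mpoly F[d]} -> A} := mmap kap f.
pose E : {rmorphism {poly {mpoly F[d]}} -> {poly A}} := map_poly ev.
pose kapM : {rmorphism F -> {poly {mpoly F[d]}}} := polyC \o @mpolyC d F.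
have Ec k : E (cgen X k) = cgen f k.
  rewrite /cgen; case: insubP => [i _ _|_]; last exact: rmorph0.
  by rewrite [LHS]map_polyC /= [ev _]mmapX mmap1U.
have EX : E 'X = 'X by apply: map_polyX.
have Eth (i : 'I_d.+1) : E (skew_param X i) = th i.
  rewrite /th; case: (i : nat) => [|k]; first exact: Ec.
  by rewrite /skew_param (rmorphB E) (rmorphM E) !Ec EX.
have Esb s (k : 'I_d) : E (skew_basis X s k) = sb s k.
  by rewrite /sb /skew_basis; case: ifP => _; rewrite ?Ec // (rmorphXn E) EX.
pose Y j := pcombine kapM (fun i : 'I_d.+1 => skew_param X i)
  (fun k : 'I_d => skew_basis X (shift j) k) (fun k => P (j, k)).
have EY j : E (Y j) = \sum_k mmap kapX th (P (j, k)) * sb (shift j) k.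
  rewrite [LHS](pcombine_rmorph _ E); apply: eq_pcombine => // c.
  by rewrite /= [LHS]map_polyC /= [ev _]mmapC.
move=> h0; have hY n : pc (fun j => (Y j)`_n) = 0.
  rewrite -(coef0 A n) -h0 pcombine_pair /pcombine.
  rewrite coef_sum; apply: eq_bigr => j _.
  have -> : \sum_k mmap kapX th (P (j, k)) * W (j, k) = E (Y j) * (w j)%:P.
    by rewrite EY mulr_suml; apply: eq_bigr => k _; rewrite /W /=; ring.
  by rewrite coefMC coef_map.
move=> [j k]; have Yj : Y j = 0 by apply/polyP => n; rewrite coef0; apply: pc_inj (hY n) j.
exact: (skew_independent d_gt0 Yj).
Qed.

Let thR (i : 'I_d.+1) : rees Fil := to_rees Fil (th i).
Let wR jk : rees Fil := to_rees Fil (W jk).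

Let rees_predB u v : u \in rees_pred Fil -> v \in rees_pred Fil -> u - v \in rees_pred Fil.
Proof. by move=> hu hv; have [_ h _] := rees_subring_closed Fil; apply: h. Qed.

Let cgen_rees k : cgen f k \in rees_pred Fil.
Proof. by rewrite /cgen; case: insubP => [i _ _|_]; [apply: const_rees | apply: rees_pred0]. Qed.

Let thR_val i : rees_val (thR i) = th i.
Proof.
rewrite to_reesK // /th; case: (i : nat) => [|k] /=; first exact: cgen_rees.
apply: rees_predB; first exact: cgen_rees.
rewrite /cgen; case: insubP => [l _ _|_]; last by rewrite mul0r; apply: rees_pred0.
by rewrite -['X]expr1; apply/monomial_rees/(Fil_param pc_surj FilE).
Qed.

Let wR_val jk : rees_val (wR jk) = W jk.
Proof.
rewrite to_reesK // /W /sb /skew_basis; case: ifP => h.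
  apply: monomial_rees.
  have := @Fil_monomial _ _ kap d f J w Fil shift FilE jk.1 0%MM jk.2 1.
  rewrite rmorph1 mul1r mdeg0 add0n => /(_ h).
  by rewrite /mmap1 big1 ?mul1r // => i _; rewrite mnm0E expr0.
rewrite /cgen; case: insubP => [l _ _|_]; last by rewrite mulr0; apply: rees_pred0.
by rewrite -polyCM; apply: const_rees.
Qed.

Let pcR_val P : rees_val (pcombine (rees_const kap Fil) thR wR P) = pcombine kapX th W P.
Proof.
rewrite [LHS](pcombine_rmorph _ val_rees); apply: eq_pcombine => [c|i|jk].
- exact: val_rees_const.
- exact: thR_val.
- exact: wR_val.
Qed.

Theorem rees_cohen_macaulay : cohen_macaulay (rees Fil).
Proof.
apply: (@free_algebra_cohen_macaulay F (rees Fil) (rees_const kap Fil) d.+1 thR _ wR) => [x|P hP].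
  suff [P hP] : exists P, pcombine kapX th W P = rees_val x.
    by exists P; apply: val_inj; rewrite /= pcR_val.
  apply: (rees_ind FilE (Q := [set u | exists P, pcombine kapX th W P = u])) => [|_ _ [P <-] [P' <-]|c j m n hn|].
  - exists (fun=> 0); rewrite /pcombine big1 // => jk _; by rewrite mmap0 mul0r.
  - by exists (fun jk => P jk + P' jk); rewrite pcombineD.
  - have [H hH] := skew_span c (shift_lt j) hn.
    exists (fun jk => if jk.1 == j then H jk.2 else 0).
    rewrite pcombine_pair /= (bigD1 j) //= [X in _ + X]big1 => [|l /negbTE ne]; last first.
      by rewrite big1 // => k _; rewrite ne mmap0 mul0r.
    rewrite eqxx addr0.
    transitivity ((w j)%:P * pcombine kapX th (sb (shift j)) H); last first.
      by rewrite hH !rmorphM /=; ring.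
    by rewrite /pcombine mulr_sumr; apply: eq_bigr => k _; rewrite /W /=; ring.
  - by case: (x).
by apply: rees_gens_inj; rewrite -pcR_val hP; apply: (rmorph0 val_rees).
Qed.

End ReesAlgebra.

(** * The filtration of tight closures in the Fermat ring *)

Section FiltrationReduction.
Variables (p d r e : nat).
Hypotheses (p_prime : prime p) (r_ge2 : (2 <= r)%N) (p_ndvd_r : ~~ (p %| r)%N).
Hypothesis d_ge2 : (2 <= d)%N.
Hypothesis p_gt : (d%:Z - 1) * r%:Z - d%:Z < p%:Z.
Local Notation S := {mpoly 'F_p[d.+1]}.
Local Notation Fm := (fermat_poly p d r).
Variables (R : comNzRingType) (pi : {rmorphism S -> R}).
Hypotheses (pi_surj : forall x, exists u, pi u = x).
Hypothesis pi_ker : forall u, pi u = 0 <-> ideal_gen [set` [:: Fm]] u.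
Hypothesis pcharR : p \in [pchar R].
Variable g : 'I_d -> S.
Hypothesis hg : params r g (fun=> e).

Local Notation f := (fun i => pi (g i)).
Local Notation J := (ideal_gen (range f)).
Local Notation mm := (irrelevant pi).
Local Notation T := (tc_filtration pcharR f).
Variables (B : finType) (b : B -> 'X_{1..d.+1}).
Hypothesis spb : forall u, exists c : B -> 'F_p,
  ideal_gen [set` par r g] (u - \sum_j c j *: 'X_[b j]).
Hypothesis indb : forall c : B -> 'F_p,
  ideal_gen [set` par r g] (\sum_j c j *: 'X_[b j]) -> forall j, c j = 0.

(** Both summands of the tight closure of J^(n+1) are divisible by J inside the n-th step. For the
    power of the maximal ideal this is [irrelevant_pow_step] with k = n + d - 1, whose hypothesis
    reads r <= n e + d. *)
Lemma tc_filtration_step n : (r <= n * e + d)%N -> ideal_mul J (T n) = T n.+1.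
Proof.
move=> hn; have eqT k : (0 < k)%N ->
    T k = ideal_add (ideal_pow J k) (ideal_pow mm ((k - 1) * e + d * e)).
  exact: (tight_closure_pow p_prime r_ge2 p_ndvd_r d_ge2 p_gt pi_surj pi_ker pcharR hg spb indb).
have hL := ideal_gen_is_ideal [set x | exists y z, [/\ J y, T n z & x = y * z]].
have powT : ideal_pow J n `<=` T n.
  case: (n) => [|k]; first by rewrite filt0.
  rewrite eqT // => x hx; exists x, 0; rewrite addr0; split=> //.
  exact: (ideal0 (ideal_pow_is_ideal _ _)).
have mT : ideal_pow mm (e * (n + d).-1) `<=` T n.
  case: (n) => [|k]; first by rewrite filt0.
  rewrite eqT // subn1 addSn -mulnDl mulnC => x hx; exists 0, x; rewrite add0r; split=> //.
  exact: (ideal0 (ideal_pow_is_ideal _ _)).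
apply/seteqP; split.
  apply: ideal_mul_min (filt_ideal T n.+1) _ => x y hx hy.
  rewrite -[n.+1]add1n; apply: filt_mul hy; rewrite eqT //.
  exists x, 0; rewrite addr0; split=> //; last exact: (ideal0 (ideal_pow_is_ideal _ _)).
  by rewrite -[x]mulr1; apply: ideal_mul_in.
rewrite eqT // => _ [x [y [hx hy ->]]]; apply: (idealD hL).
  move: x hx; apply: (ideal_mul_min hL) => x z hx /powT hz; exact: ideal_mul_in.
have nd : (n + d)%N = (n + d).-1.+1 by rewrite prednK // addn_gt0 (ltnW d_ge2) orbT.
move: hy; rewrite subn1 -mulnDl mulnC /= nd -(irrelevant_pow_step r_ge2 pi_surj pi_ker hg).
  move: y; apply: (ideal_mul_min hL) => z y hz /mT hy; exact: ideal_mul_in.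
by rewrite -nd mulnDl addnC; move: hn; clear; lia.
Qed.

(** A monomial above the socle degree is zero modulo I and cannot belong to a basis. *)
Lemma basis_degree_le j : (mdeg (b j) + d.+1 <= d * e + r)%N.
Proof.
rewrite leqNgt; apply/negP => lt.
have hX : ('X_[b j] : S) \is (mdeg (b j)).-homog by rewrite dhomogX /=.
have hI := ideal_gen_is_ideal [set` par r g].
have := indb (c := fun l => (l == j)%:R) _ j; rewrite eqxx => h.
have /eqP : (1 : 'F_p) = 0.
  apply: h; rewrite (bigD1 j) //= eqxx scale1r big1 ?addr0 => [|l /negbTE ->]; last by rewrite scale0r.
  by apply: (par_vanish r_ge2 hg hX); rewrite sum_nat_const card_ord.
by rewrite oner_eq0.
Qed.

End FiltrationReduction.

(** * The projection from S to the Fermat ring *)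

Section FermatProjection.
Variables (p d r : nat).
Hypotheses (p_prime : prime p) (r_ge2 : (2 <= r)%N) (p_ndvd_r : ~~ (p %| r)%N).
Hypothesis d_gt0 : (0 < d)%N.
Local Notation S := {mpoly 'F_p[d.+1]}.
Local Notation R := (fermat_ring p d r_ge2).

Definition fermat_proj : {rmorphism S -> R} := \pi_(fermat_ring p d r_ge2)%qT.

Lemma fermat_projE u : fermat_proj u = fermat_pi r_ge2 u. Proof. by []. Qed.

Lemma fermat_proj_surj x : exists u, fermat_proj u = x.
Proof. by exists (repr x); rewrite fermat_projE /fermat_pi reprK. Qed.

Lemma fermat_proj_ker u :
  fermat_proj u = 0 <-> ideal_gen [set` [:: fermat_poly p d r]] u.
Proof.
have E : (u \in @fermat_ideal p d r r_ge2) <-> fermat_proj u = 0.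
  rewrite -(rmorph0 fermat_proj) -[u in u \in _]subr0 Quotient.idealrBE.
  by split=> /eqP.
split=> [/E/asboolP[h Eh]|/gen_fermatP[h Eh]].
  by apply/gen_fermatP; exists h.
by apply/E/asboolP; exists h.
Qed.

Lemma fermat_maxE : fermat_max p d r_ge2 = irrelevant fermat_proj.
Proof.
by congr ideal_gen; apply/seteqP; split=> _ [i _ <-]; exists i.
Qed.

(** Positivity of e must be derived. For e = 0 the f_i are constants: if all vanish, a power of X_0
    lies in (F); if not, J contains 1, and so does the maximal ideal, its radical. *)
Lemma hsop_lift e (f : 'I_d -> R) : is_hsop f -> (forall i, fermat_homog e (f i)) ->
  exists2 g : 'I_d -> S, f = (fun i => fermat_proj (g i)) & params r g (fun=> e).
Proof.
move=> [_ _ frad] hf.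
have /choice[g hg] i : exists u : S, u \is e.-homog /\ fermat_proj u = f i.
  by have [u hu E] := hf i; exists u.
have Ef : f = fun i => fermat_proj (g i) by apply/funext => i; have [_ ->] := hg i.
have gX i : exists N, ideal_gen [set` par r g] ('X_i ^+ N).
  have : radical (ideal_gen (range f)) (fermat_proj 'X_i).
    by rewrite frad; apply: sub_ideal_gen; exists i.
  move=> [N]; rewrite -rmorphXn Ef => /(ideal_gen_par fermat_proj_surj fermat_proj_ker) h.
  by exists N.
exists g => //; split=> // [i|_]; first by have [] := hg i.
rewrite lt0n; apply/eqP => e0; rewrite {}e0 in hg.
have gC i : g i = ((g i)@_0%MM)%:MP.
  have [/dhomogP h _] := hg i; apply/mpolyP => m; rewrite mcoeffC.
  have [<-|ne] := eqVneq 0%MM m; first by rewrite mulr1.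
  rewrite mulr0; apply: memN_msupp_eq0; apply/negP => /h /= /eqP.
  by rewrite mdeg_eq0 eq_sym (negbTE ne).
have not1 : ~ ideal_gen [set` [:: fermat_poly p d r]] 1.
  move=> /fermat_proj_ker /eqP; rewrite (rmorph1 fermat_proj).
  by rewrite oner_eq0.
have [z|/existsNP[i gi]] := pselect (forall i, g i = 0).
  have [N] := gX ord0.
  have sub : ideal_gen [set` par r g] `<=` ideal_gen [set` [:: fermat_poly p d r]].
    apply: ideal_gen_min => [|u]; first exact: ideal_gen_is_ideal.
    rewrite /= mem_rcons inE => /orP[/eqP ->|/mapP[i _ ->]].
      by apply: sub_ideal_gen; rewrite /= inE.
    by rewrite z; apply: (ideal0 (ideal_gen_is_ideal _)).
  move=> /sub; rewrite -[_ ^+ _]mulr1 => /(var_nonzerodivisor r_ge2 d_gt0).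
  exact: not1.
have J1 : ideal_gen (range f) 1.
  have hJ := ideal_gen_is_ideal (range f).
  have [c c0 Eg] : exists2 c : 'F_p, c != 0 & g i = c%:MP.
    by exists ((g i)@_0%MM) => //; apply/eqP => c0; apply: gi; rewrite gC c0 mpolyC0.
  have -> : 1 = fermat_proj (c^-1)%:MP * f i.
    by rewrite Ef -rmorphM Eg -mpolyCM mulVf // mpolyC1 rmorph1.
  by apply: (idealLM hJ); apply: sub_ideal_gen; exists i.
have : fermat_max p d r_ge2 1 by rewrite -frad; exists 0%N; rewrite expr0; apply: J1.
rewrite fermat_maxE.
move=> h1; have : ideal_pow (irrelevant fermat_proj) 1 1 by rewrite -[X in _ X]mulr1; apply: ideal_mul_in.
move=> /(irrelevant_pow fermat_proj_surj)[u hu E].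
have /gen_fermatP[h Eh] : ideal_gen [set` [:: fermat_poly p d r]] (1 - u).
  by apply/fermat_proj_ker; rewrite rmorphB E rmorph1 subrr.
have : (1 - u)@_0%MM = 0.
  rewrite Eh; apply/eqP/negPn/negP => /mcoeffM_support[m1 [m2 [_ h2 /esym/eqP]]].
  rewrite -mdeg_eq0 mdegD addn_eq0 => /andP[_ m20].
  have /dhomogP := fermat_poly_homog p d r.
  move=> /(_ m2); rewrite mcoeff_msupp => /(_ h2) /= Em.
  by have := r_ge2; rewrite -Em (eqP m20).
rewrite mcoeffB mcoeff1 eqxx; have [->|/hu] := eqVneq (u@_0%MM) 0; last by rewrite mdeg0.
by rewrite subr0 => /eqP; rewrite oner_eq0.
Qed.

End FermatProjection.

Theorem proposition1p4 (p r d e : nat) (p_prime : prime p)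
    (r_ge2 : (2 <= r)%N) (d_ge2 : (2 <= d)%N)
    (p_ndvd_r : ~~ (p %| r)%N)
    (p_gt : (d%:Z - 1) * r%:Z - d%:Z < p%:Z)
    (f : 'I_d -> fermat_ring p d r_ge2)
    (f_hsop : is_hsop f)
    (f_deg : forall i : 'I_d, fermat_homog e (f i)) :
  let m := fermat_max p d r_ge2 in
  let J := ideal_gen (range f) in
  let F := tc_filtration (fermat_pchar d r_ge2 p_prime) f in
  let a := ((r%:Z - 1 - d%:Z) %/ e%:Z)%Z in
  [/\ (forall n : nat, (1 <= n)%N ->
         tight_closure p (ideal_pow J n) =
         ideal_add (ideal_pow J n) (ideal_pow m ((n - 1) * e + d * e)%N)),
      cohen_macaulay (assoc_gr F),
      (exists2 k : nat, is_reduction_number J (ideal_pow m e) k &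
                        k%:Z = a + d%:Z) /\
      filt_reduction_number_le J F (a + 1) &
      (a <= d%:Z - 2 -> cohen_macaulay (rees F))].
Proof.
have d0 := ltnW d_ge2.
have [g Ef hg] := hsop_lift d0 f_hsop f_deg.
have e0 := e_gt0 d_ge2 hg.
have surj := @fermat_proj_surj p d r r_ge2; have ker := @fermat_proj_ker p d r r_ge2.
have [B [b [spb indb]]] := exists_residue_basis p_prime r_ge2 d_ge2 hg.
have pch := fermat_pchar d r_ge2 p_prime.
move: f_hsop f_deg; rewrite Ef => _ _ m J T a.
have tc := tight_closure_weighted p_prime r_ge2 p_ndvd_r d_ge2 p_gt surj ker
  (fermat_pchar d r_ge2 p_prime) hg spb indb.
have pcs := coordinates_surj p_prime r_ge2 d_ge2 surj ker hg spb.
have pci := coordinates_inj r_ge2 ker hg indb.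
have Em : m = irrelevant (fermat_proj p d r_ge2) by apply: fermat_maxE.
have lt_a : r%:Z - 1 - d%:Z < (a + 1) * e%:Z by rewrite ltz_ceil ?eqz_nat -?lt0n.
rewrite Em; split.
- exact: (tight_closure_pow p_prime r_ge2 p_ndvd_r d_ge2 p_gt surj ker pch hg spb indb).
- exact: (assoc_gr_cohen_macaulay (Fil := T) pcs pci tc).
- split; first exact: (irrelevant_pow_reduction p_prime r_ge2 p_ndvd_r d_ge2 p_gt surj ker hg).
  move=> n hn; apply: (tc_filtration_step p_prime r_ge2 p_ndvd_r d_ge2 p_gt surj ker _ hg spb indb).
  (* From r - 1 - d < (a + 1) e <= n e follows r <= n e + d. *)
  have : (a + 1) * e%:Z <= n%:Z * e%:Z by apply: ler_wpM2r.
  by move: lt_a; rewrite -[n%:Z * _]PoszM; clear; lia.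
- move=> ha; apply: (rees_cohen_macaulay (Fil := T) d0 pcs pci tc) => j.
  have hb := basis_degree_le r_ge2 hg indb j.
  have : (a + 1) * e%:Z <= (d%:Z - 1) * e%:Z by apply: ler_wpM2r => //; lia.
  rewrite mulrBl mul1r -PoszM => he.
  (* deg b_j <= d e + r - d - 1 < (d + a + 1) e <= (2 d - 1) e, and delta_j < d amounts to
     [deg b_j / e] < 2 d - 1. *)
  have : (mdeg (b j) %/ e < d.-1 + d)%N.
    have E : ((d.-1 + d) * e + e = d * e + d * e)%N.
      by rewrite -{2}[e]mul1n -!mulnDl addnAC addn1 prednK.
    rewrite ltn_divLR //; move: E hb he lt_a; move: (mdeg (b j)) (_ * e)%N (d * e)%N ((a + 1) * _).
    by clear -e0; lia.
  by rewrite /shift; move: (_ %/ _)%N; clear -d0; lia.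
Qed.
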